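(* Let $A,K,j\ge1$ be integers and $\epsilon,\eta>0$ reals. If $A\ge K^{6j}$, then $$A^{-1}\cdot\#\bigl(\mathscr{E}(K;\eta)\cap[-A,A]\bigr)\ll_{j,\epsilon}\eta^{1.8j}+A^{\epsilon}K^{-1.5j}+\eta^{-0.2j}K^{-0.8j}+K^{-1/24}.$$
   Context: Let $F_0(\mathbf{y})=y_1^3+y_2^3+y_3^3$, $F_a=F_0-a$, $e_n(t)=e^{2\pi it/n}$. For integers $n\ge1$ and $a$, $T_a(n)=\sum_{u\in(\mathbb{Z}/n\mathbb{Z})^\times}\sum_{\mathbf{y}\in(\mathbb{Z}/n\mathbb{Z})^3}e_n(uF_a(\mathbf{y}))$, and for integers $K\ge1$, $s_a(K)=\sum_{n\le K}n^{-3}T_a(n)$. For $\eta>0$, $\mathscr{E}(K;\eta)=\{a\in\mathbb{Z}: a\not\equiv\pm4\bmod 9,\ |s_a(K)|\le\eta\}$. *)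

(* Defs.v *)
From mathcomp Require Import all_boot all_order all_algebra.
From mathcomp Require Import complex.
From mathcomp Require Import finmap.
From mathcomp Require Import all_classical all_reals all_analysis.

Set Implicit Arguments.
Unset Strict Implicit.
Unset Printing Implicit Defensive.

Import Order.TTheory GRing.Theory Num.Theory.

Local Open Scope ring_scope.
Local Open Scope complex_scope.
Local Open Scope classical_set_scope.

Definition F0 (y : 'I_3 -> int) : int := \sum_(i < 3) y i ^+ 3.

Definition F_ (a : int) (y : 'I_3 -> int) : int := F0 y - a.

Definition e_ (R : realType) (n : nat) (t : int) : R[i] :=
  let x : R := 2 * pi * t%:~R / n%:R in cos x +i* sin x.

(* Residue classes mod n are represented by 0, ..., n - 1 in 'I_n rather than
   by 'Z_n, which is not Z/nZ for n = 1; for n = 1 the unit group is {0}, in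
   agreement with coprime 1 0. *)
Definition T_ (R : realType) (a : int) (n : nat) : R[i] :=
  \sum_(u < n | coprime n u) \sum_(y : {ffun 'I_3 -> 'I_n})
    e_ R n (u%:Z * F_ a (fun i => (y i)%:Z)).

Definition s_ (R : realType) (a : int) (K : nat) : R[i] :=
  \sum_(1 <= n < K.+1) n%:R ^- 3 * T_ R a n.

Definition exceptional (R : realType) (K : nat) (eta : R) : set int :=
  [set a : int | [/\ (a != 4 %[mod 9])%Z, (a != -4 %[mod 9])%Z
                   & `|s_ R a K| <= eta%:C]].

(* fset_set sends infinite sets to fset0, so the finiteness matters. *)
Lemma finite_exceptionalI (R : realType) (K A : nat) (eta : R) :
  finite_set (exceptional K eta `&` [set a : int | - A%:Z <= a <= A%:Z]).
Proof.
pose f (k : nat) : int := k%:Z - A%:Z.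
apply: (@sub_finite_set _ _ (f @` `I_(A + A).+1)); last first.
  exact: finite_image.
move=> a [_ /= /andP[leAa leaA]].
have a0 : 0 <= a + A%:Z by rewrite -lerBlDr sub0r.
exists (absz (a + A%:Z)); last by rewrite /f gez0_abs // addrK.
by rewrite /= ltnS -lez_nat gez0_abs // PoszD lerD2r.
Qed.

(* Main.v *)
Require Import Defs.
From mathcomp Require Import all_boot all_order all_algebra.
From mathcomp Require Import complex.
From mathcomp Require Import finmap.
From mathcomp Require Import all_classical all_reals all_analysis.
From mathcomp Require Import ring lra zify.

Set Implicit Arguments.
Unset Strict Implicit.
Unset Printing Implicit Defensive.

Import Order.TTheory GRing.Theory Num.Theory.

Local Open Scope ring_scope.
Local Open Scope classical_set_scope.

(** The condition n <= K is not multiplicative, and S_a(p) is bounded only by O(p^(-1/2)) when p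
    divides a, so neither an Euler product nor absolute convergence is available for a single a. The
    truncation error is therefore measured relative to the product: the steps of the telescoping
    then simply add up, and the only price is one division by the lower bound lambda, about
    eta^(2/3). That exponent matters only by being below 1: eta is then smaller than lambda, and a
    small s_a(K) forces some error term to be large. Both losses in lambda are made cheap by taking
    powers. The product of 1 + E/p over p <= z is O(z) for every fixed E, so the product of the 1 -
    O(1/p) costs an arbitrarily small power of z. The average over a of the product of 1 + c
    p^(-1/2) over the primes p dividing a is bounded for every fixed c, because the sum of p^(-3/2)
    converges; so a loss of y has frequency O(y^(-r)) for any fixed r. No Weil or Deligne bound
    enters: square-root cancellation comes from Parseval together with invariance under
    multiplication by unit cubes. *)

(* Idea. Write S_a(n) = n^-3 T_a(n). It is real, multiplicative in n, and, as functions of a,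
   the S_a(n) for distinct n are orthogonal over full periods. Hence, for a in [-A, A], the sum
   of S_a(n) over a set of moduli n <= Y with Y^3 = O(A) has second moment at most the sum of
   v(n) = E_a S_a(n)^2; the local estimate v(p) = O(p^-2) (cubic exponential sums mod p) makes
   the sum of v(n) over n > X at most O(X^(-1/2)).
   It suffices to treat eta >= K^(-5/(216 j)), because a smaller eta can be increased to that
   value at the cost of the term K^(-1/24). Then z, a fixed power of 1/eta, is a small power
   of K, and s_a(K) is compared with the product over p <= z of the truncated local densities
   sigma_p(a):
   - the n <= K with a prime power component above z are themselves > z, so their total
     contribution is small in mean square;
   - adding the primes p <= z one at a time telescopes the difference between the product and
     its truncation to n <= K; each step costs a sum of S_a(n) over K < n <= K z, divided by a
     partial product of the sigma_p(a), which is bounded below.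
   Finally the product itself exceeds a constant times eta^(2/3) outside few a: for p not
   dividing a one has sigma_p(a) >= 1 - O(1/p), and a Chebyshev bound controls the product;
   the factors 1 - O(p^(-1/2)) with p dividing a are controlled by a high moment. *)

(** * Sums of periodic functions *)

Lemma dvdz_addr (d x y : int) : (d %| y)%Z -> (d %| x + y)%Z = (d %| x)%Z.
Proof. by move=> dy; rewrite rpredDr. Qed.

Lemma dvdz_addl (d x y : int) : (d %| x)%Z -> (d %| x + y)%Z = (d %| y)%Z.
Proof. by move=> dx; rewrite rpredDl. Qed.

Definition periodic_mod (V : Type) (n : nat) (f : int -> V) :=
  forall x y : int, (x = y %[mod n])%Z -> f x = f y.

Lemma eqz_modP (m n d : int) : reflect (exists k, m = n + k * d) (m == n %[mod d])%Z.
Proof.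
rewrite eqz_mod_dvd; apply: (iffP dvdzP) => -[k e]; exists k.
  by rewrite -e addrC subrK.
by rewrite e addrC addKr.
Qed.

(** An injection of an [n]-element set into the residues mod [n] is onto, so the sum is a
    reindexing. Shifts, multiplication by a unit and the Chinese remainder map are all instances. *)
Lemma sum_periodic (V : nmodType) (n : nat) (f : int -> V) (I : finType)
    (phi : I -> int) :
  (0 < n)%N -> #|I| = n -> periodic_mod n f ->
  (forall i j, (phi i = phi j %[mod n])%Z -> i = j) ->
  \sum_(i : I) f (phi i) = \sum_(x < n) f x%:Z.
Proof.
move=> n0 cardI pf phiI.
have hlt i : (absz (phi i %% n)%Z < n)%N.
  by rewrite -ltz_nat gez0_abs ?modz_ge0 ?ltz_pmod// ?eqz_nat ?gt_eqF.
pose h i : 'I_n := Ordinal (hlt i).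
have hE i : (h i)%:Z = (phi i %% n)%Z by rewrite /= gez0_abs ?modz_ge0// eqz_nat gt_eqF.
have h_inj : injective h.
  by move=> i j /(congr1 (fun k : 'I_n => k%:Z)); rewrite !hE => /phiI.
have h_bij : bijective h by apply: inj_card_bij => //; rewrite card_ord cardI.
rewrite [RHS](reindex h) /=; last by apply: onW_bij.
by apply: eq_bigr => i _; apply: pf; rewrite hE modz_mod.
Qed.

Lemma sum_periodic_mul (V : nmodType) (n : nat) (f : int -> V) (c : int) :
  (0 < n)%N -> coprimez n c -> periodic_mod n f ->
  \sum_(x < n) f (c * x%:Z) = \sum_(x < n) f x%:Z.
Proof.
move=> n0 cop pf; apply: (@sum_periodic _ n f 'I_n (fun x => c * x%:Z)) => //.
  by rewrite card_ord.
move=> i j /eqP; rewrite eqz_mod_dvd -mulrBr Gauss_dvdzr// -eqz_mod_dvd.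
rewrite !modz_small ?ltz_nat ?ltn_ord ?lez_nat//.
by rewrite eqz_nat => /eqP/val_inj.
Qed.

Lemma sum_periodic_opp (V : nmodType) (n : nat) (f : int -> V) :
  (0 < n)%N -> periodic_mod n f ->
  \sum_(x < n) f (- x%:Z) = \sum_(x < n) f x%:Z.
Proof.
move=> n0 pf; rewrite -(@sum_periodic_mul _ _ _ (-1) n0 _ pf).
  by apply: eq_bigr => i _; rewrite mulN1r.
by rewrite coprimezE abszN coprimen1.
Qed.

(** The parametrisation by [n i + m j], rather than by idempotents, is the one under which
    [e (m * n)] splits as [e m i * e n j]. *)
Lemma sum_periodic_crt (V : nmodType) (m n : nat) (f : int -> V) :
  (0 < m)%N -> (0 < n)%N -> coprime m n -> periodic_mod (m * n) f ->
  \sum_(x < m * n) f x%:Z =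
    \sum_(i < m) \sum_(j < n) f (n%:Z * i%:Z + m%:Z * j%:Z).
Proof.
move=> m0 n0 cop pf; rewrite pair_big /=.
rewrite -(@sum_periodic _ _ _ ('I_m * 'I_n)%type (fun p => n%:Z * p.1%:Z + m%:Z * p.2%:Z)) //.
- by rewrite muln_gt0 m0.
- by rewrite card_prod !card_ord.
move=> [i j] [i' j'] /= /eqP; rewrite eqz_mod_dvd => d.
have E : n%:Z * i%:Z + m%:Z * j%:Z - (n%:Z * i'%:Z + m%:Z * j'%:Z) =
  n%:Z * (i%:Z - i'%:Z) + m%:Z * (j%:Z - j'%:Z) by ring.
rewrite E PoszM in d; congr (_, _); apply: val_inj; apply/eqP; rewrite -eqz_nat.
  have: (m %| n%:Z * (i%:Z - i'%:Z))%Z.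
    rewrite -(@dvdz_addr _ _ (m%:Z * (j%:Z - j'%:Z))) ?dvdz_mulr//.
    exact: dvdz_trans (dvdz_mulr _ (dvdzz _)) d.
  rewrite Gauss_dvdzr ?coprimezE// -eqz_mod_dvd.
  by rewrite !modz_small ?ltz_nat ?ltn_ord ?lez_nat.
have: (n %| m%:Z * (j%:Z - j'%:Z))%Z.
  rewrite -(@dvdz_addl _ (n%:Z * (i%:Z - i'%:Z))) ?dvdz_mulr//.
  exact: dvdz_trans (dvdz_mull _ (dvdzz _)) d.
rewrite Gauss_dvdzr ?coprimezE 1?coprime_sym// -eqz_mod_dvd.
by rewrite !modz_small ?ltz_nat ?ltn_ord ?lez_nat.
Qed.

Lemma sum_ord_split (V : nmodType) (m n : nat) (f : int -> V) :
  \sum_(x < m * n) f x%:Z = \sum_(i < m) \sum_(t < n) f (i%:Z + m%:Z * t%:Z).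
Proof.
transitivity (\sum_(0 <= k < m * n) f k%:Z); first by rewrite big_mkord.
elim: n => [|n IH].
  by rewrite muln0 big_geq// big1// => i _; rewrite big_ord0.
rewrite mulnSr (big_cat_nat (n := m * n)) ?leq_addr//= IH.
under [RHS]eq_bigr do rewrite big_ord_recr/=.
rewrite big_split/=; congr (_ + _).
rewrite -{1}[(m * n)%N]add0n (addnC (m * n)%N m) big_addn addnK big_mkord.
by apply: eq_bigr => i _; rewrite PoszD PoszM.
Qed.

Lemma sum_ord_split_eq (V : nmodType) (N m n : nat) (f : int -> V) : N = (m * n)%N ->
  \sum_(x < N) f x%:Z = \sum_(i < m) \sum_(t < n) f (i%:Z + m%:Z * t%:Z).
Proof. by move=> ->; apply: sum_ord_split. Qed.

Lemma sum_periodic_rep (V : nmodType) (m n : nat) (f : int -> V) :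
  periodic_mod m f -> \sum_(x < m * n) f x%:Z = (\sum_(i < m) f i%:Z) *+ n.
Proof.
move=> pf; rewrite sum_ord_split -sumrMnl; apply: eq_bigr => i _.
rewrite -[in RHS](card_ord n) -sumr_const; apply: eq_bigr => t _.
by apply: pf; rewrite addrC mulrC modzMDl.
Qed.

Lemma sum_periodic_rep_eq (V : nmodType) (N m n : nat) (f : int -> V) : N = (m * n)%N ->
  periodic_mod m f -> \sum_(x < N) f x%:Z = (\sum_(i < m) f i%:Z) *+ n.
Proof. by move=> ->; apply: sum_periodic_rep. Qed.

Lemma sum_dvd_split (V : nmodType) d n (f : int -> V) : (0 < d)%N ->
  \sum_(x < d * n) (if (d %| x%:Z)%Z then f x%:Z else 0) = \sum_(w < n) f (d%:Z * w%:Z).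
Proof.
move=> d0; rewrite (@sum_ord_split _ d n (fun x => if (d %| x)%Z then f x else 0)).
rewrite (bigD1 (Ordinal d0))//= [X in _ + X]big1 ?addr0; last first.
  move=> i i0; apply: big1 => t _; rewrite dvdz_addr; last exact: dvdz_mulr.
  rewrite ifN// dvdzE /= gtnNdvd// lt0n.
  by apply: contra i0 => /eqP i0; apply/eqP/val_inj.
by apply: eq_bigr => t _; rewrite add0r dvdz_mulr.
Qed.

(** * Exponential sums *)

Section ExponentialSums.
Variable R : realType.
Local Open Scope complex_scope.
Local Notation e := (e_ R).

Lemma e_D n s t : e n (s + t) = e n s * e n t.
Proof.
rewrite /e_ intrD mulrDr mulrDl cosD sinD; apply/eqP.
by rewrite eq_complex /= eqxx /= addrC [cos _ * sin _]mulrC [sin _ * cos _]mulrC addrC; apply/eqP; ring.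
Qed.

Lemma e_0 n : e n 0 = 1.
Proof. by rewrite /e_ mulr0 mul0r cos0 sin0. Qed.

Lemma e_mulnn n t : (0 < n)%N -> e n (t * n%:Z) = 1.
Proof.
move=> n0.
have e1 : e n n%:Z = 1.
  rewrite /e_ mulfK ?pnatr_eq0 -?lt0n//.
  by rewrite mulr_natl cos2pi sin2pi.
have eN (k : nat) : e n (k%:Z * n%:Z) = 1.
  by elim: k => [|k IH]; rewrite ?mul0r ?e_0// intS mulrDl mul1r e_D e1 IH mulr1.
case: t => k; first exact: eN.
have := e_D n (Negz k * n%:Z) (k.+1%:Z * n%:Z).
by rewrite -mulrDl NegzE addNr mul0r e_0 eN mulr1.
Qed.

Lemma e_periodic n : (0 < n)%N -> periodic_mod n (e n).
Proof.
by move=> n0 x y /eqP/eqz_modP[k ->]; rewrite e_D e_mulnn// mulr1.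
Qed.

Lemma e_mull m n t : (0 < m)%N -> e (m * n) (m%:Z * t) = e n t.
Proof.
move=> m0; rewrite /e_.
suff -> : 2 * pi * (m%:Z * t)%:~R / (m * n)%:R = 2 * pi * t%:~R / n%:R :> R by [].
have m0' : m%:R != 0 :> R by rewrite pnatr_eq0 -lt0n.
(* For [n = 0] both angles are [0], since division by zero yields [0]. *)
have [->|n0] := eqVneq n 0%N; first by rewrite muln0 invr0 !mulr0.
have n0' : n%:R != 0 :> R by rewrite pnatr_eq0.
by rewrite intrM natrM -[m%:~R]/(m%:R); field; rewrite m0' n0'.
Qed.

Lemma conj_e n t : conjc (e n t) = e n (- t).
Proof. by rewrite /e_ /= intrN mulrN mulNr cosN sinN. Qed.

(** With the angle of the reduced [t] written as [2 h], [0 < h < pi], the value [1] would give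
    [cos (2 h) = 1], hence [sin h = 0]. *)
Lemma e_neq1 n t : (0 < n)%N -> ~~ (n %| t)%Z -> e n t != 1.
Proof.
move=> n0 nt; have n0' : n%:Z != 0 :> int by rewrite eqz_nat -lt0n.
rewrite -(@e_periodic n n0 (t %% n)%Z t (modz_mod _ _)).
have r0 : 0 < (t %% n)%Z.
  by rewrite lt_neqAle modz_ge0// andbT eq_sym; apply: contra nt => /eqP/dvdz_mod0P.
have rn : (t %% n)%Z < n by rewrite ltz_pmod// ltz_nat.
set r := (t %% n)%Z in r0 rn *.
have n0R : 0 < n%:R :> R by rewrite ltr0n.
have r0R : 0 < r%:~R :> R by rewrite ltr0z.
have rnR : r%:~R < n%:R :> R by rewrite -[n%:R]/(n%:~R) ltr_int.
pose h : R := pi * r%:~R / n%:R.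
have h0 : 0 < h by rewrite divr_gt0// mulr_gt0// pi_gt0.
have hpi : h < pi by rewrite ltr_pdivrMr// ltr_pM2l// pi_gt0.
apply/negP => /eqP/(congr1 (@complex.Re R)) /=.
have -> : 2 * pi * r%:~R / n%:R = h *+ 2 :> R by rewrite /h -mulr_natl; ring.
rewrite cos_mulr2n cos2sin2 => hc.
have s0 : 0 < sin h by rewrite sin_gt0_pi// h0.
have : sin h ^+ 2 = 0 by lra.
by move/eqP; rewrite sqrf_eq0 gt_eqF.
Qed.

Lemma sum_e n t : (0 < n)%N ->
  \sum_(x < n) e n (t * x%:Z) = if (n %| t)%Z then n%:R else 0.
Proof.
move=> n0; case: ifPn => nt.
  rewrite (eq_bigr (fun=> 1)) ?sumr_const ?card_ord// => i _.
  by move/dvdzP: nt => [k ->]; rewrite mulrAC e_mulnn.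
have per : periodic_mod n (fun x => e n (t * x)).
  move=> x y xy; apply: e_periodic => //.
  by apply/eqP; rewrite -modzMmr xy modzMmr.
(* The shift of [x] by one multiplies the sum by [e n t], which is not [1]; so the sum vanishes. *)
have shift : \sum_(x < n) e n (t * (x%:Z + 1)) = \sum_(x < n) e n (t * x%:Z).
  apply: (@sum_periodic _ n (fun x => e n (t * x)) 'I_n (fun x => x%:Z + 1)) => //.
    by rewrite card_ord.
  move=> i j /eqP; rewrite eqz_modDr !modz_small ?ltz_nat ?ltn_ord ?lez_nat//.
  by rewrite eqz_nat => /eqP/val_inj.
move: shift; under eq_bigr do rewrite mulrDr mulr1 e_D.
rewrite -mulr_suml => /eqP; rewrite -subr_eq0 -{2}[\sum_(x < n) _]mulr1 -mulrBr mulf_eq0.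
by rewrite subr_eq0 (negPf (e_neq1 n0 nt)) orbF => /eqP.
Qed.

Lemma conjc_sum (I : finType) (F : I -> R[i]) : conjc (\sum_i F i) = \sum_i conjc (F i).
Proof. exact: rmorph_sum. Qed.

Lemma conjcM (x y : R[i]) : conjc (x * y) = conjc x * conjc y.
Proof. exact: rmorphM. Qed.

Lemma conjcX (x : R[i]) k : conjc (x ^+ k) = conjc x ^+ k.
Proof. exact: rmorphXn. Qed.

(** The cubic Gauss sum; the three variables of [T_] separate into its third power. *)
Definition cubesum (n : nat) (u : int) : R[i] := \sum_(x < n) e n (u * x%:Z ^+ 3).
Local Notation g := cubesum.

Lemma modz_polyX k (x y d : int) : (x = y %[mod d])%Z -> (x ^+ k = y ^+ k %[mod d])%Z.
Proof. by move=> xy; rewrite -modzXm xy modzXm. Qed.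

Lemma periodic_cube n u : (0 < n)%N -> periodic_mod n (fun x => e n (u * x ^+ 3)).
Proof.
move=> n0 x y xy; apply: e_periodic => //.
by rewrite -modzMmr (modz_polyX 3 xy) modzMmr.
Qed.

Lemma cubesum_periodic n : (0 < n)%N -> periodic_mod n (g n).
Proof.
move=> n0 u v uv; apply: eq_bigr => x _; apply: e_periodic => //.
by rewrite -modzMml uv modzMml.
Qed.

Lemma conj_cubesum n u : (0 < n)%N -> conjc (g n u) = g n u.
Proof.
move=> n0; rewrite /cubesum conjc_sum -(sum_periodic_opp n0 (@periodic_cube n u n0)).
by apply: eq_bigr => x _; rewrite conj_e; congr (e n _); ring.
Qed.

Lemma cubesum_mul_cube n u t : (0 < n)%N -> coprimez n t -> g n (u * t ^+ 3) = g n u.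
Proof.
move=> n0 cop; rewrite -[RHS](sum_periodic_mul n0 cop (@periodic_cube n u n0)).
by apply: eq_bigr => x _; congr (e n _); ring.
Qed.

Lemma cubesum1 u : g 1 u = 1.
Proof. by rewrite /cubesum big_ord1 expr0n /= mulr0 e_0. Qed.

Lemma cubesum_crt m n i j : (0 < m)%N -> (0 < n)%N -> coprime m n ->
  g (m * n) (n%:Z * i + m%:Z * j) = g m i * g n j.
Proof.
move=> m0 n0 cop; have mn0 : (0 < m * n)%N by rewrite muln_gt0 m0.
rewrite /cubesum (sum_periodic_crt m0 n0 cop (@periodic_cube _ _ mn0)).
(* Modulo [m n], [n i (n k + m l)^3] keeps only [n i (n k)^3], and symmetrically for [j]; the
   scalings by [n] and [m] bring both factors to this form. *)
have -> : \sum_(x < m) e m (i * x%:Z ^+ 3) = \sum_(x < m) e m (i * (n%:Z * x%:Z) ^+ 3).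
  by rewrite (sum_periodic_mul m0 _ (@periodic_cube m i m0)).
have -> : \sum_(x < n) e n (j * x%:Z ^+ 3) = \sum_(x < n) e n (j * (m%:Z * x%:Z) ^+ 3).
  by rewrite (sum_periodic_mul n0 _ (@periodic_cube n j n0))// coprimez_sym.
rewrite mulr_suml; apply: eq_bigr => k _; rewrite mulr_sumr; apply: eq_bigr => l _.
rewrite mulrDl e_D; congr (_ * _).
  rewrite [(m * n)%N]mulnC -mulrA e_mull//; apply: e_periodic => //.
  apply/eqP/eqz_modP; set k' := k%:Z; set l' := l%:Z.
  exists (i * (3 * (n%:Z * k') ^+ 2 * l' + 3 * (n%:Z * k') * m%:Z * l' ^+ 2 + m%:Z ^+ 2 * l' ^+ 3)).
  by ring.
rewrite -mulrA e_mull//; apply: e_periodic => //.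
apply/eqP/eqz_modP; set k' := k%:Z; set l' := l%:Z.
exists (j * (3 * (m%:Z * l') ^+ 2 * k' + 3 * (m%:Z * l') * n%:Z * k' ^+ 2 + n%:Z ^+ 2 * k' ^+ 3)).
by ring.
Qed.

Lemma T_cubesum a n : (0 < n)%N ->
  T_ R a n = \sum_(u < n | coprime n u) g n u%:Z ^+ 3 * e n (- (u%:Z * a)).
Proof.
move=> n0; apply: eq_bigr => u _.
have -> : g n u%:Z ^+ 3 = \prod_(i < 3) g n u%:Z by rewrite prodr_const card_ord.
rewrite /cubesum bigA_distr_bigA /= mulr_suml.
apply: eq_bigr => y _; rewrite /F_ mulrBr e_D; congr (_ * _).
rewrite /F0 mulr_sumr; symmetry; apply: (big_ind2 (fun (x : R[i]) t => x = e n t)) => //; first by rewrite e_0.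
by move=> x1 x2 y1 y2 -> ->; rewrite e_D.
Qed.

Lemma T_full a n : (0 < n)%N ->
  T_ R a n = \sum_(u < n) if coprimez n u%:Z then g n u%:Z ^+ 3 * e n (- (u%:Z * a)) else 0.
Proof. by move=> n0; rewrite T_cubesum// big_mkcond. Qed.

Lemma periodic_coprimez n : periodic_mod n (coprimez n).
Proof. by move=> x y xy; rewrite /coprimez -gcdz_modr xy gcdz_modr. Qed.

Lemma periodic_T_term a n : (0 < n)%N ->
  periodic_mod n (fun u => if coprimez n u then g n u ^+ 3 * e n (- (u * a)) else 0).
Proof.
move=> n0 u v uv; rewrite (periodic_coprimez uv) (cubesum_periodic n0 uv).
congr (if _ then _ * _ else _); apply: e_periodic => //.
by apply/eqP; rewrite -modzNm -modzMml uv modzMml modzNm.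
Qed.

Lemma T_periodic n : (0 < n)%N -> periodic_mod n (fun a => T_ R a n).
Proof.
move=> n0 a b ab; rewrite !T_cubesum//; apply: eq_bigr => u _; congr (_ * _).
apply: e_periodic => //.
by apply/eqP; rewrite -modzNm -modzMmr ab modzMmr modzNm.
Qed.

Lemma conj_T a n : (0 < n)%N -> conjc (T_ R a n) = T_ R a n.
Proof.
move=> n0; rewrite T_full// -[in RHS](sum_periodic_opp n0 (@periodic_T_term a n n0)).
rewrite conjc_sum; apply: eq_bigr => u _; rewrite coprimezN.
case: ifP => _; last by rewrite conjc0.
rewrite conjcM conjcX conj_cubesum// conj_e.
by congr (_ * _); [congr (_ ^+ _); rewrite -{1}(conj_cubesum _ n0) /cubesum conjc_sum;
  apply: eq_bigr => x _; rewrite conj_e mulNr | congr e; rewrite mulNr opprK].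
Qed.

Lemma T_crt a m n : (0 < m)%N -> (0 < n)%N -> coprime m n ->
  T_ R a (m * n) = T_ R a m * T_ R a n.
Proof.
move=> m0 n0 cop; have mn0 : (0 < m * n)%N by rewrite muln_gt0 m0.
rewrite !T_full// (sum_periodic_crt m0 n0 cop (@periodic_T_term a _ mn0)).
rewrite mulr_suml; apply: eq_bigr => i _; rewrite mulr_sumr; apply: eq_bigr => j _.
have -> : coprimez (m * n)%N (n%:Z * i%:Z + m%:Z * j%:Z) =
    coprimez m i%:Z && coprimez n j%:Z.
  rewrite PoszM coprimezMl; congr (_ && _).
    rewrite /coprimez addrC mulrC gcdzMDl.
    by rewrite -/(coprimez _ _) coprimezMr coprimezE /= cop.
  rewrite /coprimez mulrC gcdzMDl.
  by rewrite -/(coprimez _ _) coprimezMr coprimezE /= coprime_sym cop.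
case: ifPn => [/andP[-> ->]|].
  rewrite cubesum_crt// exprMn [RHS]mulrACA; congr (_ * _).
  rewrite mulrDl opprD e_D; congr (_ * _).
    by rewrite mulnC -mulrA -mulrN e_mull.
  by rewrite -mulrA -mulrN e_mull.
by rewrite negb_and => /orP[]/negPf->; rewrite ?mul0r ?mulr0.
Qed.

(** As a function of [a], [T_ R a n] is a combination of characters whose frequencies are reduced
    fractions with denominator [n]. Reduced fractions with different denominators never add up to an
    integer. *)
Lemma T_orthogonal m n : (0 < m)%N -> (0 < n)%N -> m != n ->
  \sum_(a < m * n) T_ R a%:Z m * T_ R a%:Z n = 0.
Proof.
move=> m0 n0 mn; have mn0 : (0 < m * n)%N by rewrite muln_gt0 m0.
under eq_bigr do rewrite !T_cubesum// mulr_suml.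
rewrite exchange_big big1 //= => u cu.
under eq_bigr do rewrite mulr_sumr.
rewrite exchange_big big1 //= => w cw.
transitivity (\sum_(a < m * n) g m u%:Z ^+ 3 * g n w%:Z ^+ 3 *
    e (m * n) (- (n%:Z * u%:Z + m%:Z * w%:Z) * a%:Z)).
  apply: eq_bigr => a _; rewrite mulrACA; congr (_ * _).
  rewrite -(@e_mull n m)// -(@e_mull m n)// [(n * m)%N]mulnC -e_D.
  by congr e; ring.
rewrite -mulr_sumr sum_e// ifN ?mulr0//.
rewrite rpredN PoszM; apply: contra mn => d.
rewrite eqn_dvd; apply/andP; split.
  have : (m %| n%:Z * u%:Z + m%:Z * w%:Z)%Z by apply: dvdz_trans d; rewrite dvdz_mulr.
  rewrite dvdz_addr; last exact: dvdz_mulr.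
  by rewrite Gauss_dvdzl// coprimezE.
have : (n %| n%:Z * u%:Z + m%:Z * w%:Z)%Z by apply: dvdz_trans d; rewrite dvdz_mull.
rewrite dvdz_addl; last exact: dvdz_mulr.
by rewrite Gauss_dvdzl// coprimezE.
Qed.

End ExponentialSums.

(** * Second moments *)

Section SecondMoment.
Variable R : realType.

(** Taking the real part loses nothing, as [T_real] shows; it moves the whole argument into an
    ordered field. *)
Definition S_ (a : int) (n : nat) : R := complex.Re (T_ R a n) / n%:R ^+ 3.

Lemma T_real a n : (0 < n)%N -> T_ R a n = ((n%:R ^+ 3 * S_ a n)%:C)%C.
Proof.
move=> n0; rewrite /S_ mulrC divfK ?expf_neq0 ?pnatr_eq0 -?lt0n//.
have := conj_T R a n0; case: (T_ R a n) => x y [] /eqP.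
by rewrite -subr_eq0 -opprD oppr_eq0 -mulr2n -[_ *+ 2]mulr_natr mulf_eq0 pnatr_eq0 orbF => /eqP->.
Qed.

Lemma S_one a : S_ a 1 = 1.
Proof.
rewrite /S_ T_full// big_ord1 /= /coprimez /= cubesum1 expr1n mul0r oppr0 e_0 mulr1.
by rewrite /= expr1n divr1.
Qed.

Lemma S_crt a m n : (0 < m)%N -> (0 < n)%N -> coprime m n ->
  S_ a (m * n) = S_ a m * S_ a n.
Proof.
move=> m0 n0 cop; rewrite {1}/S_ T_crt// !T_real// -rmorphM /= natrM.
have m0' : m%:R != 0 :> R by rewrite pnatr_eq0 -lt0n.
have n0' : n%:R != 0 :> R by rewrite pnatr_eq0 -lt0n.
by field; rewrite m0' n0'.
Qed.

Lemma S_periodic n : (0 < n)%N -> periodic_mod n (S_^~ n).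
Proof. by move=> n0 a b ab; rewrite /S_ (T_periodic R n0 ab). Qed.

Lemma S_orthogonal m n : (0 < m)%N -> (0 < n)%N -> m != n ->
  \sum_(a < m * n) S_ a%:Z m * S_ a%:Z n = 0.
Proof.
move=> m0 n0 mn; have := T_orthogonal R m0 n0 mn.
have m0' : m%:R != 0 :> R by rewrite pnatr_eq0 -lt0n.
have n0' : n%:R != 0 :> R by rewrite pnatr_eq0 -lt0n.
have -> : \sum_(a < m * n) T_ R a%:Z m * T_ R a%:Z n =
    ((\sum_(a < m * n) (m%:R ^+ 3 * n%:R ^+ 3) * (S_ a%:Z m * S_ a%:Z n))%:C)%C.
  rewrite rmorph_sum /=; apply: eq_bigr => a _.
  by rewrite !T_real// -rmorphM; congr (_%:C)%C; ring.
move/complexI/eqP; rewrite -mulr_sumr mulf_eq0 => /orP[|/eqP//].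
by rewrite mulf_eq0 !expf_eq0 (negPf m0') (negPf n0').
Qed.

Lemma s_real a K : s_ R a K = ((\sum_(1 <= n < K.+1) S_ a n)%:C)%C.
Proof.
rewrite /s_ rmorph_sum /= !big_nat; apply: eq_bigr => n /andP[n0 _].
have n0' : n%:R != 0 :> R by rewrite pnatr_eq0 -lt0n.
rewrite T_real// -[n%:R]/(n%:R : R[i]) -(rmorph_nat (real_complex R)) -rmorphXn -fmorphV -rmorphM.
by congr (_%:C)%C; rewrite mulKf// expf_neq0.
Qed.

Lemma norm_s a K (eta : R) :
  (`|s_ R a K| <= (eta%:C)%C) = (`|\sum_(1 <= n < K.+1) S_ a n| <= eta).
Proof. by rewrite s_real normc_def /= expr0n addr0 sqrtr_sqr lecR. Qed.

Definition S_variance (n : nat) : R := (\sum_(a < n) S_ a%:Z n ^+ 2) / n%:R.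
Local Notation v := S_variance.

Lemma S_variance_ge0 n : 0 <= v n.
Proof. by rewrite divr_ge0// sumr_ge0// => i _; rewrite sqr_ge0. Qed.

Lemma sum_sqr_S n : (0 < n)%N -> \sum_(a < n) S_ a%:Z n ^+ 2 = n%:R * v n.
Proof. by move=> n0; rewrite mulrC divfK// pnatr_eq0 -lt0n. Qed.

Lemma S_variance1 : v 1 = 1.
Proof. by rewrite /S_variance big_ord1 S_one expr1n divr1. Qed.

Lemma periodic_S2 n : (0 < n)%N -> periodic_mod n (fun a => S_ a n ^+ 2).
Proof. by move=> n0 a b ab; rewrite (S_periodic n0 ab). Qed.

Lemma periodic_mod_mull (V : Type) (m n : nat) (f : int -> V) :
  periodic_mod n f -> periodic_mod (m * n) f.
Proof.
move=> pf x y /eqP/eqz_modP[k xy]; apply: pf; apply/eqP/eqz_modP.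
by exists (k * m%:Z); rewrite xy PoszM mulrA.
Qed.

Lemma periodic_mod_mulr (V : Type) (m n : nat) (f : int -> V) :
  periodic_mod n f -> periodic_mod (n * m) f.
Proof. by rewrite mulnC; apply: periodic_mod_mull. Qed.

Lemma S_variance_crt m n : (0 < m)%N -> (0 < n)%N -> coprime m n ->
  v (m * n) = v m * v n.
Proof.
move=> m0 n0 cop; rewrite /S_variance.
have mn0 : (0 < m * n)%N by rewrite muln_gt0 m0.
rewrite (sum_periodic_crt m0 n0 cop (periodic_S2 mn0)).
have E i j : S_ (n%:Z * i + m%:Z * j) (m * n) ^+ 2 =
    S_ (n%:Z * i) m ^+ 2 * S_ (m%:Z * j) n ^+ 2.
  rewrite S_crt// exprMn; congr (_ ^+ 2 * _ ^+ 2).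
    by apply: S_periodic => //; rewrite addrC mulrC modzMDl.
  by apply: S_periodic => //; rewrite mulrC modzMDl.
under eq_bigr => i _ do (under eq_bigr => j _ do rewrite E; rewrite -mulr_sumr).
rewrite -mulr_suml (sum_periodic_mul m0 _ (periodic_S2 m0))//.
rewrite (sum_periodic_mul n0 _ (periodic_S2 n0)) ?coprimezE 1?coprime_sym//.
by rewrite natrM invfM mulrACA.
Qed.

Lemma sum_periodic_shift (V : nmodType) (n : nat) (f : int -> V) (c : int) :
  (0 < n)%N -> periodic_mod n f ->
  \sum_(x < n) f (x%:Z + c) = \sum_(x < n) f x%:Z.
Proof.
move=> n0 pf; apply: (@sum_periodic _ n f 'I_n (fun x => x%:Z + c)) => //.
  by rewrite card_ord.
move=> i j /eqP; rewrite eqz_modDr !modz_small ?ltz_nat ?ltn_ord ?lez_nat//.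
by rewrite eqz_nat => /eqP/val_inj.
Qed.

Lemma sum_ord_nat (V : nmodType) n (f : int -> V) :
  \sum_(i < n) f i%:Z = \sum_(0 <= i < n) f i%:Z.
Proof. by rewrite big_mkord. Qed.

(** After the full periods less than one period remains, and it is bounded by the sum of [|f|] over
    a whole period. *)
Lemma sum_periodic_interval (q N : nat) (c : int) (f : int -> R) :
  (0 < q)%N -> periodic_mod q f ->
  `|\sum_(i < N) f (i%:Z + c) - (N %/ q)%:R * \sum_(x < q) f x%:Z|
    <= \sum_(x < q) `|f x%:Z|.
Proof.
move=> q0 pf.
have pfc d : periodic_mod q (fun x => f (x + d)).
  move=> x y xy; apply: pf; apply/eqP.
  by rewrite eqz_modDr; apply/eqP.
rewrite (sum_ord_nat _ (fun i => f (i + c))) {1}(divn_eq N q) mulnC.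
rewrite (big_cat_nat (n := (q * (N %/ q))%N)) ?leq_addr//=.
rewrite -(sum_ord_nat _ (fun i => f (i + c))) (sum_periodic_rep _ (pfc c)) sum_periodic_shift//.
rewrite mulr_natl addrAC subrr add0r.
rewrite -[X in \sum_(X <= _ < _) _]add0n big_addn addKn big_mkord.
apply: le_trans (ler_norm_sum _ _ _) _.
have pabs : periodic_mod q (fun x => `|f x|) by move=> x y /pf ->.
rewrite -(sum_periodic_shift ((q * (N %/ q))%N%:Z + c) q0 pabs).
rewrite (big_ord_widen q (fun i => `|f ((i + q * (N %/ q))%N%:Z + c)|)); last by rewrite ltnW// ltn_pmod.
rewrite big_mkcond /=; apply: ler_sum => i _.
by rewrite PoszD addrA; case: ifP.
Qed.

Lemma sum_sqr_S_mulr m n : (0 < n)%N ->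
  \sum_(a < n * m) S_ a%:Z n ^+ 2 = (n * m)%:R * v n.
Proof.
move=> n0; rewrite (sum_periodic_rep m (periodic_S2 n0)) sum_sqr_S//.
by rewrite natrM -[LHS]mulr_natl; ring.
Qed.

Lemma sum_sqr_S_mull m n : (0 < n)%N ->
  \sum_(a < m * n) S_ a%:Z n ^+ 2 = (m * n)%:R * v n.
Proof. by rewrite mulnC => n0; rewrite sum_sqr_S_mulr. Qed.

(** Over full periods orthogonality leaves only [m = n]; the incomplete period is bounded by AM-GM
    and [m n <= Y ^ 2]. *)
Lemma sum_S_mul_le (m n Y N : nat) (c : int) : (0 < m <= Y)%N -> (0 < n <= Y)%N ->
  \sum_(i < N) S_ (i%:Z + c) m * S_ (i%:Z + c) n <=
  (if m == n then N%:R * v n else 0) + Y%:R ^+ 2 * ((v m + v n) / 2).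
Proof.
move=> /andP[m0 mY] /andP[n0 nY]; have mn0 : (0 < m * n)%N by rewrite muln_gt0 m0.
pose f a := S_ a m * S_ a n.
have pf : periodic_mod (m * n) f.
  move=> a b ab; rewrite /f (periodic_mod_mulr (S_periodic m0) ab).
  by rewrite (periodic_mod_mull (S_periodic n0) ab).
have := sum_periodic_interval N c mn0 pf; rewrite ler_distl => /andP[_ /le_trans]; apply.
apply: lerD.
  case: (eqVneq m n) => [mn|mn]; last by rewrite S_orthogonal// mulr0.
  have -> : \sum_(x < m * n) f x%:Z = (m * n)%:R * v n.
    by rewrite -sum_sqr_S_mull//; apply: eq_bigr => a _; rewrite expr2; congr (S_ _ _ * _).
  by rewrite mulrA ler_wpM2r ?S_variance_ge0// -!natrM ler_nat leq_divM.
apply: (@le_trans _ _ (\sum_(x < m * n) (S_ x%:Z m ^+ 2 + S_ x%:Z n ^+ 2) / 2)).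
  apply: ler_sum => x _; rewrite /f normrM.
  rewrite -(real_normK (num_real (S_ x m))) -(real_normK (num_real (S_ x n))).
  by have := sqr_ge0 (`|S_ x m| - `|S_ x n|); rewrite sqrrB; lra.
rewrite -mulr_suml big_split /= sum_sqr_S_mulr// sum_sqr_S_mull//.
rewrite -mulrDr -mulrA ler_wpM2r ?divr_ge0 ?addr_ge0 ?S_variance_ge0//.
by rewrite -natrX ler_nat -mulnn leq_mul.
Qed.

(** A large-sieve type inequality. The diagonal gives [N v(n)]; the boundary errors of all pairs add
    up to [Y^2 |s| V <= Y^3 V], with [V] the sum of the variances. *)
Lemma second_moment (s : seq nat) (Y N : nat) (c : int) :
  uniq s -> (forall n, n \in s -> (0 < n <= Y)%N) ->
  \sum_(i < N) (\sum_(n <- s) S_ (i%:Z + c) n) ^+ 2 <=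
  (N%:R + Y%:R ^+ 3) * \sum_(n <- s) v n.
Proof.
move=> us sY.
have sizes : (size s <= Y)%N.
  rewrite -(size_iota 1 Y); apply: uniq_leq_size => // n /sY.
  by rewrite mem_iota add1n ltnS.
under eq_bigr => i _ do (rewrite expr2 big_distrlr /=).
rewrite exchange_big /=; under eq_bigr do rewrite exchange_big /=.
apply: (@le_trans _ _ (\sum_(m <- s) \sum_(n <- s)
   ((if m == n then N%:R * v n else 0) + Y%:R ^+ 2 * ((v m + v n) / 2)))).
  rewrite big_seq [leRHS]big_seq; apply: ler_sum => m ms.
  rewrite big_seq [leRHS]big_seq; apply: ler_sum => n ns.
  by apply: sum_S_mul_le; apply: sY.
have -> : \sum_(m <- s) \sum_(n <- s)
    ((if m == n then N%:R * v n else 0) + Y%:R ^+ 2 * ((v m + v n) / 2)) =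
  \sum_(m <- s) \sum_(n <- s) (if m == n then N%:R * v n else 0) +
  \sum_(m <- s) \sum_(n <- s) Y%:R ^+ 2 * ((v m + v n) / 2).
  by rewrite -big_split; apply: eq_bigr => m _; rewrite big_split.
rewrite mulrDl; apply: lerD.
  rewrite mulr_sumr big_seq [leRHS]big_seq; apply: ler_sum => m ms.
  rewrite -big_mkcond /= (eq_bigl (pred1 m)) => [|n]; last by rewrite eq_sym.
  by rewrite -big_filter filter_pred1_uniq// big_seq1.
set V := \sum_(n <- s) v n.
have V0 : 0 <= V by apply: sumr_ge0 => n _; exact: S_variance_ge0.
have sumc (x : R) : \sum_(n <- s) x = (size s)%:R * x.
  by rewrite big_const_seq count_predT iter_addr_0 mulr_natl.
have E m : \sum_(n <- s) Y%:R ^+ 2 * ((v m + v n) / 2) =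
    Y%:R ^+ 2 / 2 * ((size s)%:R * v m + V).
  by rewrite -mulr_sumr -mulr_suml big_split /= sumc -/V; field.
rewrite (eq_bigr _ (fun m _ => E m)) -mulr_sumr big_split /= -mulr_sumr sumc -/V.
rewrite (_ : Y%:R ^+ 2 / 2 * _ = Y%:R ^+ 2 * ((size s)%:R * V)); last by field.
by rewrite [Y%:R ^+ 3]exprSr -mulrA ler_wpM2l ?exprn_ge0// ler_wpM2r// ler_nat.
Qed.

End SecondMoment.

(** * Prime moduli *)

Section PrimeModulus.
Variable R : realType.
Local Notation e := (e_ R).
Local Notation g := (cubesum R).
Local Notation S := (S_ R).
Local Notation v := (S_variance R).
Variable p : nat.
Hypothesis pp : prime p.
Let p0 : (0 < p)%N := prime_gt0 pp.

Lemma coprimez_prime (x : int) : coprimez p x = ~~ (p %| x)%Z.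
Proof. by rewrite coprimezE /= prime_coprime. Qed.

Definition cubic_roots (u c : int) : pred 'I_p :=
  [pred x : 'I_p | (p %| u * x%:Z ^+ 3 - c)%Z].

Lemma card_cubic_roots (u c : int) : ~~ (p %| u)%Z ->
  (#|cubic_roots u c| <= 3)%N.
Proof.
move=> pu; have chp : p \in [pchar 'F_p] by rewrite pchar_Fp.
pose q : {poly 'F_p} := (u%:~R)%:P * 'X^3 - (c%:~R)%:P.
have u0 : u%:~R != 0 :> 'F_p by rewrite -(dvdz_pcharf chp).
have szq : size q = 4%N.
  rewrite /q size_polyDl; first by rewrite size_Cmul// size_polyXn.
  by rewrite size_polyN size_Cmul// size_polyXn; apply: leq_ltn_trans (size_polyC_leq1 _) _.
have q0 : q != 0 by rewrite -size_poly_eq0 szq.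
pose rs := [seq (x%:Z%:~R : 'F_p) | x : 'I_p in cubic_roots u c].
have := @max_poly_roots _ q rs q0; rewrite szq size_map -cardE ltnS; apply.
  apply/allP => z /mapP[x + ->]; rewrite mem_enum inE => d.
  rewrite /root /q !hornerE /=.
  have := d; rewrite (dvdz_pcharf chp) rmorphB rmorphM rmorphXn /=.
  by rewrite !exprS expr0 mulr1 !mulrA.
rewrite map_inj_uniq ?enum_uniq// => x y /eqP.
rewrite -subr_eq0 -rmorphB /= -(dvdz_pcharf chp) -eqz_mod_dvd.
rewrite !modz_small ?ltz_nat ?ltn_ord ?lez_nat//.
by rewrite eqz_nat => /eqP/val_inj.
Qed.

(* Averaging f over the cosets of the group of cubes, whose index is at most 3. *)
Lemma cube_invariant_le (f : int -> R) (u : int) :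
  periodic_mod p f -> (forall w, 0 <= f w) ->
  (forall w t, ~~ (p %| t)%Z -> f (w * t ^+ 3) = f w) -> ~~ (p %| u)%Z ->
  p.-1%:R * f u <= 3 * \sum_(w < p) f w%:Z.
Proof.
move=> pf f0 fi pu.
pose P := [pred t : 'I_p | ~~ (p %| t%:Z)%Z].
have cardP : #|P| = p.-1.
  have := cardD1 (Ordinal p0) 'I_p; rewrite card_ord inE add1n => /(congr1 predn) /= ->.
  apply: eq_card => t; rewrite !inE andbT; congr (~~ _).
  apply/idP/eqP => [|->]; last by rewrite dvdz0.
  rewrite dvdzE /= => d; apply/val_inj => /=; apply/eqP; rewrite -leqn0 leqNgt.
  by apply/negP => t0; have := dvdn_leq t0 d; rewrite leqNgt ltn_ord.
have hlt (t : 'I_p) : (absz ((u * t%:Z ^+ 3) %% p)%Z < p)%N.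
  by rewrite -ltz_nat gez0_abs ?modz_ge0 ?ltz_pmod// ?eqz_nat ?gt_eqF.
pose h t : 'I_p := Ordinal (hlt t).
have hE t : (h t)%:Z = ((u * t%:Z ^+ 3) %% p)%Z.
  by rewrite /= gez0_abs ?modz_ge0// eqz_nat gt_eqF.
rewrite -cardP mulr_natl -sumr_const.
rewrite (eq_bigr (fun t => f (h t)%:Z)); last first.
  move=> t Pt; rewrite -(fi u t%:Z Pt); apply: pf.
  by rewrite hE modz_mod.
rewrite (partition_big h xpredT)// mulr_sumr; apply: ler_sum => w _.
rewrite (eq_bigr (fun=> f w%:Z)); last by move=> t /andP[_ /eqP->].
rewrite sumr_const -[leLHS]mulr_natl ler_wpM2r// ler_nat.
apply: leq_trans (card_cubic_roots w%:Z pu).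
apply: subset_leq_card; apply/fintype.subsetP => t; rewrite !inE => /andP[_ /eqP hw].
by rewrite -hw hE -eqz_mod_dvd modz_mod.
Qed.

Lemma pred_prime_ge : p%:R <= 2 * p.-1%:R :> R.
Proof.
by rewrite -natrM ler_nat; have := prime_gt1 pp; lia.
Qed.

Definition rcubesum (u : int) : R := complex.Re (g p u).
Local Notation ga := rcubesum.

Lemma cubesum_real u : g p u = ((ga u)%:C)%C.
Proof.
rewrite /rcubesum; have := conj_cubesum R u p0; case: (g p u) => x y [] /eqP.
by rewrite -subr_eq0 -opprD oppr_eq0 -mulr2n -[_ *+ 2]mulr_natr mulf_eq0 pnatr_eq0 orbF => /eqP->.
Qed.

(** By Parseval the sum is [p] times the number of pairs with [x^3 = y^3] mod [p], and each [y] has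
    at most three partners. *)
Lemma sum_rcubesum_sqr : \sum_(u < p) ga u%:Z ^+ 2 <= 3 * p%:R ^+ 2.
Proof.
pose N := (\sum_(y < p) #|cubic_roots 1 (y%:Z ^+ 3)%R|)%N.
suff -> : \sum_(u < p) ga u%:Z ^+ 2 = p%:R * N%:R.
  rewrite expr2 mulrCA ler_wpM2l// -natrM ler_nat /N.
  have := @leq_sum _ (index_enum 'I_p) xpredT _ (fun=> 3) (fun y _ => card_cubic_roots (y%:Z ^+ 3) _).
  rewrite sum_nat_const card_ord mulnC; apply.
  by rewrite dvdz1 /= gtn_eqF// prime_gt1.
apply: complexI; rewrite rmorph_sum rmorphM /= !rmorph_nat.
transitivity (\sum_(u < p) \sum_(x < p) \sum_(y < p) e p ((x%:Z ^+ 3 - y%:Z ^+ 3) * u%:Z)).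
  apply: eq_bigr => u _; rewrite rmorphXn /= -cubesum_real expr2 -{2}(conj_cubesum R u p0).
  rewrite /cubesum conjc_sum big_distrlr; apply: eq_bigr => x _; apply: eq_bigr => y _.
  rewrite conj_e; transitivity (e p (u%:Z * x%:Z ^+ 3 + - (u%:Z * y%:Z ^+ 3))).
    by rewrite e_D.
  by congr (e p _); ring.
rewrite exchange_big /=; under eq_bigr do rewrite exchange_big /=.
rewrite exchange_big /= /N natr_sum mulr_sumr; apply: eq_bigr => y _.
rewrite -sum1_card natr_sum mulr_sumr [RHS]big_mkcond /=; apply: eq_bigr => x _.
by rewrite sum_e// mulr1 /cubic_roots inE mul1r.
Qed.

(** Square-root cancellation by averaging: the square is constant on the coset of [u] modulo cubes,
    so [(p - 1) ga^2 <= 3 * 3 p^2]; replacing [p - 1] by [p / 2] gives [18]. *)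
Lemma rcubesum_sqr_le u : ~~ (p %| u)%Z -> ga u ^+ 2 <= 18 * p%:R.
Proof.
move=> pu.
have H : p.-1%:R * ga u ^+ 2 <= 3 * \sum_(w < p) ga w%:Z ^+ 2.
  apply: (@cube_invariant_le (fun u => ga u ^+ 2)) => //.
  - by move=> x y xy; rewrite /rcubesum (cubesum_periodic R p0 xy).
  - by move=> w; exact: sqr_ge0.
  - by move=> w t pt; rewrite /rcubesum cubesum_mul_cube// coprimez_prime.
have := le_trans H (ler_wpM2l _ sum_rcubesum_sqr).
have := pred_prime_ge; have := sqr_ge0 (ga u).
have : 0 < p%:R :> R by rewrite ltr0n.
set G := ga u ^+ 2; set q := p.-1%:R; set P := p%:R => P0 G0 Pq /(_ (ler0n R 3)) H2.
rewrite -(ler_pM2l P0); apply: (@le_trans _ _ (2 * q * G)); first by rewrite ler_wpM2r.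
by rewrite -mulrA; nra.
Qed.

(** By Parseval in [a] the sum is [p^-5] times the sixth moment of the Gauss sums over the units.
    Four of the six factors are bounded pointwise, the other two by the second moment:
    [972 = 18^2 * 3]. *)
Lemma sum_sqr_S_prime : \sum_(a < p) S a%:Z p ^+ 2 <= 972 / p%:R.
Proof.
have P0 : 0 < p%:R :> R by rewrite ltr0n.
have E : \sum_(a < p) S a%:Z p ^+ 2 =
    (\sum_(u < p | coprime p u) ga u%:Z ^+ 6) / p%:R ^+ 5.
  suff : \sum_(a < p) (p%:R ^+ 3 * S a%:Z p) ^+ 2 =
    p%:R * \sum_(u < p | coprime p u) ga u%:Z ^+ 6.
    under eq_bigr do rewrite exprMn.
    rewrite -mulr_sumr => /(congr1 (fun x => x / (p%:R ^+ 3) ^+ 2)).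
    by rewrite mulrAC mulfV ?mul1r ?expf_neq0 ?gt_eqF// => ->; field; rewrite gt_eqF.
  apply: complexI; rewrite rmorphM /= rmorph_nat !rmorph_sum /=.
  transitivity (\sum_(a < p) \sum_(u < p | coprime p u) \sum_(w < p | coprime p w)
      g p u%:Z ^+ 3 * g p w%:Z ^+ 3 * e p ((w%:Z - u%:Z) * a%:Z)).
    apply: eq_bigr => a _; rewrite rmorphXn /= -T_real// expr2 -{2}(conj_T R _ p0).
    rewrite !T_cubesum// [X in conjc X]big_mkcond conjc_sum mulr_suml; apply: eq_bigr => u _.
    rewrite mulr_sumr [RHS]big_mkcond /=; apply: eq_bigr => w _.
    case: ifP => _; last by rewrite conjc0 mulr0.
    rewrite conjcM conjcX conj_cubesum// conj_e mulrACA -e_D; congr (_ * e p _); ring.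
  rewrite exchange_big /= mulr_sumr; apply: eq_bigr => u cu.
  rewrite exchange_big /= (bigD1 u)//= [X in _ + X]big1 => [|w /andP[_ wu]].
    rewrite addr0 -mulr_sumr sum_e// subrr dvdz0 cubesum_real !rmorphXn /=.
    by rewrite mulrC -exprD.
  rewrite -mulr_sumr sum_e// ifN ?mulr0// -eqz_mod_dvd.
  by rewrite !modz_small ?ltz_nat ?ltn_ord ?lez_nat// eqz_nat.
rewrite E ler_pdivrMr ?exprn_gt0//.
rewrite [leRHS](_ : _ = (18 * p%:R) ^+ 2 * (3 * p%:R ^+ 2)); last by field; rewrite gt_eqF.
apply: le_trans (ler_wpM2l _ sum_rcubesum_sqr); last by rewrite exprn_ge0// mulr_ge0.
rewrite mulr_sumr big_mkcond /=; apply: ler_sum => u _.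
case: ifP => [cu|_]; last by rewrite mulr_ge0 ?sqr_ge0// exprn_ge0// mulr_ge0.
rewrite (_ : ga u%:Z ^+ 6 = (ga u%:Z ^+ 2) ^+ 2 * ga u%:Z ^+ 2); last by rewrite -exprM -exprD.
rewrite ler_wpM2r ?sqr_ge0// lerXn2r ?nnegrE ?sqr_ge0 ?mulr_ge0//.
by apply: rcubesum_sqr_le; rewrite -coprimez_prime.
Qed.

Lemma S_variance_prime : v p <= 972 / p%:R ^+ 2.
Proof.
have P0 : 0 < p%:R :> R by rewrite ltr0n.
by rewrite /S_variance ler_pdivrMr// (le_trans sum_sqr_S_prime)// expr2 invfM mulrA divfK ?gt_eqF.
Qed.

Lemma S_prime_mul_cube a t : ~~ (p %| t)%Z -> S (a * t ^+ 3) p = S a p.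
Proof.
move=> pt; rewrite /S_; congr (complex.Re _ / _).
have ct : coprimez p (t ^+ 3) by rewrite coprimezXr// coprimez_prime.
rewrite !T_full// -[in RHS](sum_periodic_mul p0 ct (@periodic_T_term R a p p0)).
apply: eq_bigr => u _; rewrite coprimezMr ct /=.
case: ifP => // _; congr (_ ^+ _ * e p _); last by ring.
by rewrite mulrC cubesum_mul_cube// coprimez_prime.
Qed.

(** Averaging over the coset of [a] modulo cubes gives [S^2 <= 2 * 3 * 972 / p^2 = 5832 / p^2], and
    [77^2 = 5929]. *)
Lemma S_prime_coprime_le a : ~~ (p %| a)%Z -> `|S a p| <= 77 / p%:R.
Proof.
move=> pa; have P0 : 0 < p%:R :> R by rewrite ltr0n.
have H : p.-1%:R * S a p ^+ 2 <= 3 * \sum_(w < p) S w%:Z p ^+ 2.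
  apply: (@cube_invariant_le (fun a => S a p ^+ 2)) => //.
  - exact: periodic_S2.
  - by move=> w; exact: sqr_ge0.
  - by move=> w t pt; rewrite S_prime_mul_cube.
have := le_trans H (ler_wpM2l _ sum_sqr_S_prime) => /(_ (ler0n R 3)) {}H.
rewrite -(@ler_pXn2r _ 2) ?nnegrE ?divr_ge0// real_normK ?num_real//.
rewrite [leRHS]expr_div_n ler_pdivlMr ?exprn_gt0//.
have := pred_prime_ge; have := sqr_ge0 (S a p).
move: H; move: (S a p ^+ 2) p.-1%:R (p%:R) P0 => G q P P0 H G0 Pq.
have {}H : q * G * P <= 2916.
  have -> : q * G * P = q * G / P^-1 by rewrite invrK.
  by rewrite ler_pdivrMr ?invr_gt0//; lra.
by nra.
Qed.

(** The multiples of [p] form a single residue class, so averaging gains nothing there; one term is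
    bounded by the whole sum, and [972 <= 32^2]. *)
Lemma S_prime_le a : `|S a p| <= 32 / Num.sqrt p%:R.
Proof.
have P0 : 0 < p%:R :> R by rewrite ltr0n.
rewrite -(@ler_pXn2r _ 2) ?nnegrE ?divr_ge0 ?sqrtr_ge0// real_normK ?num_real//.
rewrite [leRHS]expr_div_n sqr_sqrtr ?(ltW P0)//.
apply: (@le_trans _ _ (972 / p%:R)); last by rewrite ler_pM2r ?invr_gt0//; lra.
apply: (le_trans _ sum_sqr_S_prime).
have hlt : (absz (a %% p)%Z < p)%N.
  by rewrite -ltz_nat gez0_abs ?modz_ge0 ?ltz_pmod// ?eqz_nat ?gt_eqF.
rewrite (bigD1 (Ordinal hlt))//= gez0_abs ?modz_ge0 ?eqz_nat ?gt_eqF//.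
rewrite (@S_periodic R p p0 (a %% p)%Z a (modz_mod _ _)) lerDl.
by apply: sumr_ge0 => i _; exact: sqr_ge0.
Qed.

End PrimeModulus.

(** * Prime powers *)

Section PrimePowers.
Variable R : realType.
Local Notation e := (e_ R).
Local Notation g := (cubesum R).
Local Notation S := (S_ R).
Local Notation v := (S_variance R).
Variable p : nat.
Hypothesis pp : prime p.
Let p0 : (0 < p)%N := prime_gt0 pp.
Let pX0 k : (0 < p ^ k)%N.
Proof. by rewrite expn_gt0 p0. Qed.

Lemma coprimez_primeX k (x : int) : coprimez (p ^ k.+1)%N x = ~~ (p %| x)%Z.
Proof. by rewrite coprimezE /= coprime_pexpl// prime_coprime. Qed.

Lemma dvd_cubic_coef (c u i : int) : ~~ (p %| c)%Z -> ~~ (p %| u)%Z ->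
  (p %| c * u * i ^+ 2)%Z = (p %| i)%Z.
Proof.
rewrite expr2 !dvdzE !abszM => pc pu.
by rewrite !Euclid_dvdM// (negPf pc) (negPf pu) /= orbb.
Qed.

(** With [x = i + p^(k+2) t] the cube is linear in [t] modulo [p^(k+3)], with slope [3 i^2]. The sum
    over [t] vanishes unless [p] divides [i], and then [x^3] carries the factor [p^3]. *)
Lemma cubesum_pow3 k (u : int) : ~~ (p %| u)%Z ->
  g (p ^ k.+3) u = p%:R ^+ 2 * g (p ^ k) u.
Proof.
move=> pu; have e3 (w : nat) : e (p ^ k.+3) (u * (p%:Z * w%:Z) ^+ 3) = e (p ^ k) (u * w%:Z ^+ 3).
  rewrite -[k.+3]/(3 + k)%N expnD -(@e_mull R (p ^ 3) (p ^ k) _ (pX0 3)).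
  by congr (e _ _); rewrite -[(p ^ 3)%N]/(p * (p * p))%N !PoszM; ring.
(* For [p = 3] the slope [3 i^2] carries an additional [3], so the step is [p^(k+1)] and [t] runs
   over nine values, that is three periods of a character mod 3. *)
have [p3|p3] := eqVneq p 3%N.
  have d3 (x : int) : (3 %| u * x ^+ 2)%Z = (p %| x)%Z.
    have p1 : ~~ (p %| 1)%Z by rewrite dvdz1 /= gtn_eqF// prime_gt1.
    by have := dvd_cubic_coef x p1 pu; rewrite mul1r p3.
  have sp : (p ^ k.+3 = p ^ k.+1 * (3 * 3))%N by rewrite p3 -[(3 * 3)%N]/(3 ^ 2)%N -expnD addnC.
  rewrite /cubesum (@sum_ord_split_eq _ _ _ _ (fun x => e (p ^ k.+3) (u * x ^+ 3)) sp).
  transitivity (\sum_(i < p * p ^ k) (if (p %| i%:Z)%Z then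
      p%:R ^+ 2 * e (p ^ k.+3) (u * i%:Z ^+ 3) else 0)).
    rewrite -expnS; apply: eq_bigr => i _.
    transitivity (\sum_(t < 3 * 3) e (p ^ k.+3) (u * i%:Z ^+ 3) * e 3 (u * i%:Z ^+ 2 * t%:Z)).
      apply: eq_bigr => t _.
      rewrite -(@e_mull R (p ^ k.+2) 3)// {5}(_ : 3 = p)%N// -expnSr -e_D.
      apply: e_periodic => //; apply/eqP/eqz_modP.
      move: (i%:Z) (t%:Z) => i' t'.
      rewrite p3 !expnS !PoszM; set q := (3 ^ k)%N%:Z.
      exists (u * (i' * q * t' ^+ 2 + q ^+ 2 * t' ^+ 3)); ring.
    rewrite -mulr_sumr (@sum_periodic_rep _ 3 3 (fun t => e 3 (u * i%:Z ^+ 2 * t))); last first.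
      move=> x y xy; apply: e_periodic => //.
      by apply/eqP; rewrite -modzMmr xy modzMmr.
    rewrite sum_e// d3.
    case: ifP => _; last by rewrite mul0rn mulr0.
    rewrite mulrC (_ : 3 *+ 3 = p%:R ^+ 2)//.
    by rewrite p3 -mulr_natl expr2.
  rewrite (@sum_dvd_split _ p _ (fun i => p%:R ^+ 2 * e (p ^ k.+3) (u * i ^+ 3)) p0) -mulr_sumr.
  by congr (_ * _); apply: eq_bigr => w _.
have pc : ~~ (p %| 3)%Z by rewrite dvdzE /= dvdn_prime2.
rewrite /cubesum (@sum_ord_split_eq _ _ _ _ (fun x => e (p ^ k.+3) (u * x ^+ 3)) (expnSr p k.+2)).
transitivity (\sum_(i < p * (p ^ k * p)) (if (p %| i%:Z)%Z then
    p%:R * e (p ^ k.+3) (u * i%:Z ^+ 3) else 0)).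
  rewrite -expnSr -expnS; apply: eq_bigr => i _.
  transitivity (\sum_(t < p) e (p ^ k.+3) (u * i%:Z ^+ 3) * e p (3 * u * i%:Z ^+ 2 * t%:Z)).
    apply: eq_bigr => t _.
    rewrite -(@e_mull R (p ^ k.+2) p)// -expnSr -e_D.
    apply: e_periodic => //; apply/eqP/eqz_modP.
    move: (i%:Z) (t%:Z) => i' t'.
    rewrite !expnS !PoszM; set q := (p ^ k)%N%:Z; set P := p%:Z.
    exists (u * (3 * i' * q * P * t' ^+ 2 + q ^+ 2 * P ^+ 3 * t' ^+ 3)); ring.
  rewrite -mulr_sumr sum_e// dvd_cubic_coef//.
  by case: ifP => _; rewrite ?mulr0// mulrC.
rewrite (@sum_dvd_split _ p _ (fun i => p%:R * e (p ^ k.+3) (u * i ^+ 3)) p0) -mulr_sumr.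
under eq_bigr do rewrite e3.
rewrite (sum_periodic_rep _ (@periodic_cube R _ u (pX0 k))).
by rewrite -[X in _ * X]mulr_natl mulrA.
Qed.

(** The same linearisation leaves only the [x] divisible by [p], for which [x^3] vanishes modulo
    [p^2]. *)
Lemma cubesum_pow2 (u : int) : p != 3%N -> ~~ (p %| u)%Z -> g (p ^ 2) u = p%:R.
Proof.
move=> p3 pu; have pc : ~~ (p %| 3)%Z by rewrite dvdzE /= dvdn_prime2.
rewrite /cubesum (@sum_ord_split_eq _ _ p p (fun x => e (p ^ 2) (u * x ^+ 3)))//.
transitivity (\sum_(i < p * 1) (if (p %| i%:Z)%Z then
    p%:R * e (p ^ 2) (u * i%:Z ^+ 3) else 0)).
  rewrite muln1; apply: eq_bigr => i _.
  transitivity (\sum_(t < p) e (p ^ 2) (u * i%:Z ^+ 3) * e p (3 * u * i%:Z ^+ 2 * t%:Z)).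
    apply: eq_bigr => t _.
    rewrite -(@e_mull R p p)// -e_D.
    apply: e_periodic => //; apply/eqP/eqz_modP.
    move: (i%:Z) (t%:Z) => i' t'.
    rewrite PoszM; set P := p%:Z.
    exists (u * (3 * i' * t' ^+ 2 + P * t' ^+ 3)); ring.
  rewrite -mulr_sumr sum_e// dvd_cubic_coef//.
  by case: ifP => _; rewrite ?mulr0// mulrC.
rewrite (@sum_dvd_split _ p _ (fun i => p%:R * e (p ^ 2) (u * i ^+ 3)) p0) big_ord1.
by rewrite mulr0 expr0n mulr0 e_0 mulr1.
Qed.

Lemma sum_coprime_split (V : zmodType) k (f : int -> V) :
  \sum_(u < p ^ k.+1) (if coprimez (p ^ k.+1)%N u%:Z then f u%:Z else 0) =
  \sum_(u < p ^ k.+1) f u%:Z - \sum_(w < p ^ k) f (p%:Z * w%:Z).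
Proof.
rewrite -(sum_dvd_split (d := p) _ f p0) -expnS -sumrB; apply: eq_bigr => u _.
by rewrite coprimez_primeX; case: (p %| u%:Z)%Z; rewrite /= ?subr0 ?subrr.
Qed.

Lemma real_if_nat (b : bool) (n : nat) :
  (if b then n%:R else 0) = ((b%:R * n%:R)%:C)%C :> R[i].
Proof.
by case: b; rewrite ?mul1r ?mul0r// -(rmorph_nat (real_complex R)).
Qed.

Lemma complexB (x y : R) : ((x - y)%:C)%C = (x%:C)%C - (y%:C)%C :> R[i].
Proof. exact: (rmorphB (real_complex R)). Qed.

Lemma Re_natXM n k (x : R) : complex.Re ((n%:R : R[i]) ^+ k * (x%:C)%C) = n%:R ^+ k * x.
Proof. by rewrite -(rmorph_nat (real_complex R)) -rmorphXn -rmorphM. Qed.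

Lemma ramanujan_sum k a :
  \sum_(u < p ^ k.+1) (if coprimez (p ^ k.+1)%N u%:Z then e (p ^ k.+1) (- (u%:Z * a)) else 0) =
  ((((p ^ k.+1)%N %| a)%Z%:R * (p ^ k.+1)%:R - ((p ^ k)%N %| a)%Z%:R * (p ^ k)%:R)%:C)%C.
Proof.
rewrite (@sum_coprime_split _ k (fun u => e (p ^ k.+1) (- (u * a)))).
rewrite complexB -!real_if_nat.
congr (_ - _).
  under eq_bigr do rewrite mulrC -mulNr.
  by rewrite sum_e// rpredN.
under eq_bigr do rewrite -mulrA -mulrN expnS e_mull// mulrC -mulNr.
by rewrite sum_e// rpredN.
Qed.

(** By [cubesum_pow3] the Gauss sums depend on [u] only modulo [p^(k+1)]; summing the character over
    the [p^3] lifts of a class detects [p^3 | a]. The factor is [p^9 = p^6 * p^3]. *)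
Lemma T_pow_gt3 a k :
  T_ R a (p ^ k.+4) = if ((p ^ 3)%N %| a)%Z then
    (p ^ 9)%:R * T_ R (a %/ (p ^ 3)%N)%Z (p ^ k.+1) else 0.
Proof.
rewrite T_full//.
have sp : (p ^ k.+4 = p ^ k.+1 * p ^ 3)%N by rewrite -expnD addn3.
pose f (u : int) := if ~~ (p %| u)%Z then
   p%:R ^+ 6 * g (p ^ k.+1) u ^+ 3 * e (p ^ k.+4) (- (u * a)) else 0.
transitivity (\sum_(u < p ^ k.+4) f u%:Z).
  apply: eq_bigr => u _; rewrite coprimez_primeX /f; case: ifP => // pu.
  by rewrite cubesum_pow3// exprMn -exprM.
rewrite (sum_ord_split_eq f sp).
transitivity (\sum_(i < p ^ k.+1) f i%:Z * (if ((p ^ 3)%N %| a)%Z then (p ^ 3)%:R else 0)).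
  apply: eq_bigr => i _; rewrite -rpredN -(@sum_e R)// mulr_sumr; apply: eq_bigr => t _.
  have pe : (p %| (p ^ k.+1)%N%:Z * t%:Z)%Z.
    by rewrite dvdz_mulr// dvdzE /= dvdn_exp.
  rewrite /f dvdz_addr//; case: ifP => _; last by rewrite mul0r.
  rewrite (@cubesum_periodic R _ (pX0 k.+1) (i%:Z + (p ^ k.+1)%N%:Z * t%:Z) i%:Z); last first.
    by rewrite addrC mulrC modzMDl.
  rewrite -[RHS]mulrA; congr (_ * _).
  rewrite -(@e_mull R (p ^ k.+1) (p ^ 3))// -sp -e_D; congr (e _ _); ring.
case: ifPn => [/dvdzP[b ab]|_]; last by rewrite big1// => i _; rewrite mulr0.
rewrite {1}ab mulzK ?eqz_nat -?lt0n// T_full// mulr_sumr; apply: eq_bigr => i _.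
rewrite coprimez_primeX /f; case: ifP => _; last by rewrite mul0r mulr0.
rewrite ab (_ : - (i%:Z * (b * (p ^ 3)%N%:Z)) = (p ^ 3)%N%:Z * (- (i%:Z * b))); last by ring.
by rewrite sp mulnC e_mull// !natrX; ring.
Qed.

Lemma S_pow_gt3 a k :
  S a (p ^ k.+4) = if ((p ^ 3)%N %| a)%Z then S (a %/ (p ^ 3)%N)%Z (p ^ k.+1) else 0.
Proof.
rewrite {1}/S_ T_pow_gt3; case: ifP => _; last by rewrite /= mul0r.
rewrite T_real// -(rmorph_nat (real_complex R)) -rmorphM /=.
have P0 : p%:R != 0 :> R by rewrite pnatr_eq0 -lt0n.
rewrite -[k.+4]/(3 + k.+1)%N expnD natrM !natrX.
by field; rewrite !expf_neq0.
Qed.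

Lemma S_pow3 a :
  S a (p ^ 3) = ((p ^ 3)%N %| a)%Z%:R - ((p ^ 2)%N %| a)%Z%:R / p%:R.
Proof.
rewrite /S_ T_full//.
have -> : \sum_(u < p ^ 3) (if coprimez (p ^ 3)%N u%:Z then
      g (p ^ 3) u%:Z ^+ 3 * e (p ^ 3) (- (u%:Z * a)) else 0) =
    p%:R ^+ 6 * \sum_(u < p ^ 3) (if coprimez (p ^ 3)%N u%:Z then
       e (p ^ 3) (- (u%:Z * a)) else 0).
  rewrite mulr_sumr; apply: eq_bigr => u _.
  rewrite coprimez_primeX; case: ifP => pu; last by rewrite mulr0.
  by rewrite cubesum_pow3// expn0 cubesum1 mulr1 -exprM.
have P0 : p%:R != 0 :> R by rewrite pnatr_eq0 -lt0n.
by rewrite ramanujan_sum Re_natXM !natrX; field; rewrite P0.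
Qed.

Lemma S_pow2 a : p != 3%N ->
  S a (p ^ 2) = ((p ^ 2)%N %| a)%Z%:R / p%:R - (p %| a)%Z%:R / p%:R ^+ 2.
Proof.
move=> p3; rewrite /S_ T_full//.
have -> : \sum_(u < p ^ 2) (if coprimez (p ^ 2)%N u%:Z then
      g (p ^ 2) u%:Z ^+ 3 * e (p ^ 2) (- (u%:Z * a)) else 0) =
    p%:R ^+ 3 * \sum_(u < p ^ 2) (if coprimez (p ^ 2)%N u%:Z then
       e (p ^ 2) (- (u%:Z * a)) else 0).
  rewrite mulr_sumr; apply: eq_bigr => u _.
  rewrite coprimez_primeX; case: ifP => pu; last by rewrite mulr0.
  by rewrite cubesum_pow2.
have P0 : p%:R != 0 :> R by rewrite pnatr_eq0 -lt0n.
by rewrite ramanujan_sum Re_natXM !natrX expn1; field; rewrite P0.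
Qed.

Definition solutions (a : int) (q : nat) : simpl_pred {ffun 'I_3 -> 'I_q} :=
  [pred y : {ffun 'I_3 -> 'I_q} | (q %| F_ a (fun i => (y i)%:Z))%Z].

Definition density (a : int) (q : nat) : R := #|solutions a q|%:R / q%:R ^+ 2.

Lemma full_sum a q : (0 < q)%N ->
  \sum_(u < q) g q u%:Z ^+ 3 * e q (- (u%:Z * a)) = ((q%:R * #|solutions a q|%:R)%:C)%C.
Proof.
move=> q0.
transitivity (\sum_(u < q) \sum_(y : {ffun 'I_3 -> 'I_q})
    e q (F_ a (fun i => (y i)%:Z) * u%:Z)).
  apply: eq_bigr => u _.
  have -> : g q u%:Z ^+ 3 = \prod_(i < 3) g q u%:Z by rewrite prodr_const card_ord.
  rewrite /cubesum bigA_distr_bigA /= mulr_suml.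
  apply: eq_bigr => y _.
  rewrite (_ : F_ a _ * _ = u%:Z * F0 (fun i => (y i)%:Z) + - (u%:Z * a)); last by rewrite /F_; ring.
  rewrite e_D; congr (_ * _).
  rewrite /F0 mulr_sumr.
  apply: (big_ind2 (fun (x : R[i]) t => x = e q t)) => //; first by rewrite e_0.
  by move=> x1 x2 y1 y2 -> ->; rewrite e_D.
rewrite exchange_big /= -sum1_card natr_sum mulr_sumr rmorph_sum big_mkcond /=.
rewrite [RHS]big_mkcond; apply: eq_bigr => y _.
by rewrite sum_e// inE; case: ifP => _; rewrite ?mulr1 ?rmorph_nat.
Qed.

(** Those [u] that are divisible by [p] reduce to the modulus one power lower, at the cost of [p]
    for each of the three variables. Hence a truncated Euler factor is a normalised solution count,
    in particular nonnegative. *)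
Lemma sum_S_density a L : \sum_(0 <= k < L.+1) S a (p ^ k) = density a (p ^ L).
Proof.
pose full L := \sum_(u < p ^ L) g (p ^ L) u%:Z ^+ 3 * e (p ^ L) (- (u%:Z * a)).
have fullS k : full k.+1 = T_ R a (p ^ k.+1) + p%:R ^+ 3 * full k.
  rewrite T_full// (sum_coprime_split _ (fun u => g (p ^ k.+1) u ^+ 3 * e (p ^ k.+1) (- (u * a)))).
  suff -> : \sum_(w < p ^ k) g (p ^ k.+1) (p%:Z * w%:Z) ^+ 3 *
      e (p ^ k.+1) (- (p%:Z * w%:Z * a)) = p%:R ^+ 3 * full k by rewrite subrK.
  rewrite mulr_sumr; apply: eq_bigr => w _.
  rewrite [RHS]mulrA -exprMn; congr (_ ^+ 3 * _); last first.
    by rewrite -mulrA -mulrN expnS e_mull.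
  rewrite /cubesum (@sum_periodic_rep_eq _ _ _ _
    (fun x => e (p ^ k.+1) (p%:Z * w%:Z * x ^+ 3)) (expnSr p k)).
    rewrite -[LHS]mulr_natl; congr (_ * _); apply: eq_bigr => x _.
    by rewrite expnS -mulrA e_mull.
  by move=> x y xy; rewrite expnS -!mulrA !e_mull//; exact: periodic_cube.
have P0 : p%:R != 0 :> R by rewrite pnatr_eq0 -lt0n.
have E k : complex.Re (full k) = (p ^ k)%:R ^+ 3 * \sum_(0 <= i < k.+1) S a (p ^ i).
  elim: k => [|k IH].
    rewrite big_nat1 expn0 S_one /full /= big_ord1 cubesum1 !expr1n mul0r oppr0 e_0 !mulr1.
    by [].
  have -> : full k.+1 = (((p ^ k.+1)%:R ^+ 3 * S a (p ^ k.+1))%:C)%C + p%:R ^+ 3 * full k.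
    by rewrite fullS T_real.
  have fk : full k = (((p ^ k)%:R ^+ 3 * \sum_(0 <= i < k.+1) S a (p ^ i))%:C)%C.
    by rewrite -IH /full full_sum.
  rewrite [in RHS]big_nat_recr//=.
  have -> : complex.Re ((((p ^ k.+1)%:R ^+ 3 * S a (p ^ k.+1))%:C)%C + p%:R ^+ 3 * full k) =
     (p ^ k.+1)%:R ^+ 3 * S a (p ^ k.+1) + complex.Re (p%:R ^+ 3 * full k).
    by case: (p%:R ^+ 3 * full k).
  by rewrite fk Re_natXM expnS !natrM; ring.
have := E L; rewrite /full full_sum// /density => /= H.
have Q0 : (p ^ L)%:R != 0 :> R by rewrite pnatr_eq0 -lt0n.
rewrite -[LHS](mulKf (expf_neq0 3 Q0)) -H.
by field; rewrite Q0.
Qed.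

Lemma density_ge0 a q : 0 <= density a q.
Proof. by rewrite divr_ge0// sqr_ge0. Qed.

Definition sigma (L : nat) (a : int) : R := \sum_(0 <= k < L.+1) S a (p ^ k).

Lemma sum_S_ge4 a L :
  \sum_(0 <= k < L.+1) S a (p ^ k.+4) =
  if ((p ^ 3)%N %| a)%Z then \sum_(1 <= k < L.+2) S (a %/ (p ^ 3)%N)%Z (p ^ k) else 0.
Proof.
rewrite big_add1 /=; case: ifP => d; last by apply: big1 => k _; rewrite S_pow_gt3 d.
by apply: eq_bigr => k _; rewrite S_pow_gt3 d.
Qed.

(** The exponents from 4 on reproduce the series of [a / p^3] without its term [1], and that [1] is
    supplied by [S_pow3] exactly when [p^3 | a]. What results is a density. *)
Lemma sigma_tail a L : 0 <= \sum_(3 <= k < L.+4) S a (p ^ k) + ((p ^ 2)%N %| a)%Z%:R / p%:R.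
Proof.
rewrite big_ltn// S_pow3 addrAC subrK.
rewrite -[4%N]/(0 + 4)%N big_addn subSS !subSS subn0.
case: L => [|L]; first by rewrite big_geq// addr0.
under eq_bigr do rewrite addn4.
rewrite sum_S_ge4; case: ifP => d; last by rewrite addr0.
apply: (@le_trans _ _ (density (a %/ (p ^ 3)%N)%Z (p ^ L.+1))); first exact: density_ge0.
by rewrite -sum_S_density big_ltn// expn0 S_one.
Qed.

(** The positive part of [S a (p ^ 2)] is just what [sigma_tail] asks for, so only its negative part
    is lost. *)
Lemma sigma_ge a L : p != 3%N -> (0 < L)%N ->
  1 + S a p - (p %| a)%Z%:R / p%:R ^+ 2 <= sigma L a.
Proof.
move=> p3; rewrite /sigma big_ltn// expn0 S_one.
case: L => [//|[|L]] _.
  by rewrite big_nat1 expn1 lerBlDr lerDl divr_ge0// sqr_ge0.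
rewrite big_ltn// expn1 big_ltn// S_pow2//.
case: L => [|L].
  rewrite big_geq// addr0; set x := _ / p%:R; set y := _ / _ ^+ 2.
  suff : 0 <= x by lra.
  by rewrite divr_ge0.
have := sigma_tail a L; set x := _ / p%:R; set y := _ / p%:R ^+ 2; lra.
Qed.

(** For [p = 3] there is no closed form for the exponent 2, so the first three terms stay together
    as a density modulo 9. *)
Lemma sigma_ge9 a L : (1 < L)%N -> p = 3%N ->
  density a 9 - (9 %| a)%Z%:R / 3 <= sigma L a.
Proof.
move=> L1 p3; rewrite /sigma (big_cat_nat (n := 3)) ?ltnS//=.
rewrite sum_S_density p3 -[(3 ^ 2)%N]/9%N lerD2l.
case: L L1 => [//|[//|[|L]]] _; first by rewrite big_geq// oppr_le0 divr_ge0.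
by have := sigma_tail a L; rewrite p3 -[(3 ^ 2)%N]/9%N; lra.
Qed.

End PrimePowers.

(** * Smooth numbers *)

Section SmoothNumbers.

(** The caps [L p] on the exponents make the list finite, so that the Euler product is a finite
    identity, and the recursion adds one prime at a time, as the telescoping does. *)
Fixpoint smooth (L : nat -> nat) (ps : seq nat) : seq nat :=
  if ps is p :: ps' then [seq m * p ^ k | m <- smooth L ps', k <- iota 0 (L p).+1]%N
  else [:: 1%N].

Lemma smooth_cons L p ps :
  smooth L (p :: ps) = [seq m * p ^ k | m <- smooth L ps, k <- iota 0 (L p).+1]%N.
Proof. by []. Qed.

Lemma smooth_consP L p ps n :
  reflect (exists m k, [/\ m \in smooth L ps, (k <= L p)%N & n = (m * p ^ k)%N])
          (n \in smooth L (p :: ps)).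
Proof.
apply: (iffP allpairsP) => [[[m k]] [mi ki ->]|[m [k [mi ki ->]]]].
  by exists m, k; rewrite -ltnS; move: ki; rewrite mem_iota.
by exists (m, k); rewrite mem_iota.
Qed.

Lemma smooth_gt0 L ps n : all prime ps -> n \in smooth L ps -> (0 < n)%N.
Proof.
elim: ps n => [|p ps IH] n; first by rewrite inE => _ /eqP->.
move=> /andP[pp aps] /smooth_consP[m [k [mi _ ->]]].
by rewrite muln_gt0 (IH _ aps mi) expn_gt0 prime_gt0.
Qed.

Lemma smooth_dvd L ps n q : all prime ps -> n \in smooth L ps -> prime q -> (q %| n)%N ->
  q \in ps.
Proof.
elim: ps n => [|p ps IH] n.
  by rewrite inE => _ /eqP-> pq; rewrite dvdn1 => /eqP q1; rewrite q1 in pq.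
move=> /andP[pp aps] /smooth_consP[m [k [mi _ ->]]] pq; rewrite inE.
rewrite Euclid_dvdM// => /orP[qm|]; first by rewrite (IH _ aps mi pq qm) orbT.
by rewrite Euclid_dvdX// => /andP[]; rewrite dvdn_prime2// => ->.
Qed.

Lemma smooth_coprime L p ps n k : all prime (p :: ps) -> p \notin ps -> n \in smooth L ps ->
  coprime n (p ^ k).
Proof.
move=> /= /andP[pp aps] pps np; rewrite coprime_sym coprimeXl// prime_coprime//.
by apply: contra pps => pn; apply: smooth_dvd np pp pn.
Qed.

Lemma uniq_smooth L ps : all prime ps -> uniq ps -> uniq (smooth L ps).
Proof.
elim: ps => [|p ps IH]// /andP[pp aps] /andP[pps ups].
apply: (@allpairs_uniq _ _ _ (fun m k => m * p ^ k)%N (smooth L ps) (iota 0 (L p).+1)).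
- exact: IH.
- exact: iota_uniq.
move=> [m k] [m' k'] /allpairsP[[m1 k1] [mi _ [-> ->]]] /allpairsP[[m2 k2] [mi' _ [-> ->]]].
move: m1 k1 m2 k2 mi mi' => {}m {}k {}m' {}k' /= mi mi' E.
have lg n i : n \in smooth L ps -> logn p (n * p ^ i) = i.
  move=> ni; rewrite logn_Gauss ?pfactorK//.
  have := @smooth_coprime L p ps n 1 _ pps ni; rewrite expn1 coprime_sym; apply.
  by rewrite /= pp.
have kk : k = k' by rewrite -(lg m k mi) E lg.
congr (_, _) => //; move: E; rewrite kk => /eqP; rewrite eqn_pmul2r ?expn_gt0 ?prime_gt0//.
by move/eqP.
Qed.

Lemma mem_smooth L ps n : all prime ps -> (0 < n)%N ->
  (forall q, prime q -> (q %| n)%N -> (q \in ps) && (logn q n <= L q)%N) ->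
  n \in smooth L ps.
Proof.
elim: ps n => [|p ps IH] n.
  move=> _ n0 H; rewrite inE; case: (ltngtP n 1%N) => //; first by rewrite ltnS leqn0 gtn_eqF.
  by move=> /pdiv_prime pp; have := H _ pp (pdiv_dvd n).
move=> /andP[pp aps] n0 H.
pose k := logn p n; pose m := (n %/ p ^ k)%N.
have nE : n = (m * p ^ k)%N by rewrite divnK// pfactor_dvdnn.
have m0 : (0 < m)%N by case: m nE n0 => // ->.
have pm : ~~ (p %| m)%N.
  apply/negP => pm; have := lognM p m0 (_ : 0 < p ^ k)%N; rewrite -nE pfactorK//.
  rewrite expn_gt0 prime_gt0// => /(_ isT) /eqP.
  by rewrite -{1}[logn p n]add0n -/k eqn_add2r eq_sym -leqn0 leqNgt logn_gt0 mem_primes pp m0 pm.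
apply/smooth_consP; exists m, k; split => //; last first.
  have [k0|k0] := posnP k; first by rewrite k0.
  have pn : (p %| n)%N by apply: dvdn_trans (pfactor_dvdnn p n); rewrite dvdn_exp.
  by have /andP[] := H p pp pn.
apply: IH => // q pq qm.
have qn : (q %| n)%N by rewrite nE dvdn_mulr.
have /andP[] := H q pq qn; rewrite inE => /orP[/eqP qp|->]/=.
  by move: pm; rewrite -qp qm.
by apply: leq_trans; apply: dvdn_leq_log => //; rewrite [X in (_ %| X)%N]nE dvdn_mulr.
Qed.

Variable R : realType.

Lemma sum_smooth (L : nat -> nat) (ps : seq nat) (F : nat -> R) :
  F 1%N = 1 ->
  (forall m n, (0 < m)%N -> (0 < n)%N -> coprime m n -> F (m * n)%N = F m * F n) ->
  all prime ps -> uniq ps ->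
  \sum_(n <- smooth L ps) F n = \prod_(p <- ps) \sum_(0 <= k < (L p).+1) F (p ^ k)%N.
Proof.
move=> F1 FM; elim: ps => [|p ps IH]; first by rewrite big_seq1 big_nil.
move=> ap /andP[pps ups]; have /andP[pp aps] := ap.
rewrite smooth_cons big_allpairs_dep big_cons -IH// mulr_sumr.
rewrite big_seq [RHS]big_seq; apply: eq_bigr => m mi.
rewrite mulr_suml; apply: eq_bigr => k _; rewrite mulrC FM//.
- exact: smooth_gt0 mi.
- by rewrite expn_gt0 prime_gt0.
- exact: smooth_coprime ap pps mi.
Qed.

Definition primes_le (z : nat) : seq nat := [seq p <- iota 1 z | prime p].

Lemma primes_leP z p : (p \in primes_le z) = prime p && (p <= z)%N.
Proof.
rewrite mem_filter mem_iota add1n ltnS; case: (boolP (prime p)) => //= pp.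
by rewrite prime_gt0.
Qed.

Lemma all_primes_le z : all prime (primes_le z).
Proof. exact: filter_all. Qed.

Lemma uniq_primes_le z : uniq (primes_le z).
Proof. by rewrite filter_uniq// iota_uniq. Qed.

(** The cap [trunc_log p z] is the largest exponent with [p ^ k <= z], and a prime power component
    of [n] is at most [n]. *)
Lemma mem_smooth_primes_le z n : (0 < n <= z)%N -> n \in smooth (trunc_log^~ z) (primes_le z).
Proof.
move=> /andP[n0 nz]; apply: mem_smooth => //; first exact: all_primes_le.
move=> q pq qn; rewrite primes_leP pq /= (leq_trans (dvdn_leq n0 qn) nz) /=.
apply: trunc_log_max; first exact: prime_gt1.
by apply: leq_trans nz; apply: dvdn_leq => //; apply: pfactor_dvdnn.
Qed.

Lemma sum_uniq_sub_le (I : eqType) (s t : seq I) (F : I -> R) :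
  uniq s -> uniq t -> {subset s <= t} -> (forall i, 0 <= F i) ->
  \sum_(i <- s) F i <= \sum_(i <- t) F i.
Proof.
move=> us ut st F0.
have ps : perm_eq s [seq i <- t | i \in s].
  apply: uniq_perm => //; first exact: filter_uniq.
  by move=> i; rewrite mem_filter; case: (boolP (i \in s)) => //= /st ->.
rewrite (perm_big _ ps) big_filter big_mkcond; apply: ler_sum => i _.
by case: ifP.
Qed.

End SmoothNumbers.

(** * Sums of variances *)

Section VarianceSum.
Variable R : realType.
Local Notation S := (S_ R).
Local Notation v := (S_variance R).

Lemma sum_dvd_indicator d n : (0 < d)%N ->
  \sum_(a < d * n) (d %| a%:Z)%Z%:R = n%:R :> R.
Proof.
move=> d0; transitivity (\sum_(a < d * n) (if (d %| a%:Z)%Z then 1 else 0) : R).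
  by apply: eq_bigr => a _; case: ifP.
by rewrite (@sum_dvd_split _ d n (fun=> 1) d0) sumr_const card_ord.
Qed.

Lemma sum_dvd_indicator_eq N d n : (0 < d)%N -> N = (d * n)%N ->
  \sum_(a < N) (d %| a%:Z)%Z%:R = n%:R :> R.
Proof. by move=> d0 ->; apply: sum_dvd_indicator. Qed.

Lemma sqr_indicatorB (b c : bool) (x y : R) : 0 <= x -> 0 <= y ->
  (b%:R * x - c%:R * y) ^+ 2 <= b%:R * x ^+ 2 + c%:R * y ^+ 2.
Proof.
by move=> x0 y0; case: b; case: c; rewrite /= ?mulr1n ?mulr0n; nra.
Qed.

(** The terms from the fourth on are [i] times a shorter sum of the same kind, so inductively the
    total is at most [X + 2 X i]. *)
Lemma sum_recursive_le (w : nat -> R) (X i : R) L :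
  (forall k, 0 <= w k) -> (forall k, w k.+4 = w k.+1 * i) -> 0 <= i <= 1 / 2 ->
  w 1 + w 2 + w 3 <= X -> \sum_(1 <= k < L.+1) w k <= 2 * X.
Proof.
move=> w0 wS /andP[i0 ih] wX.
have W3 : \sum_(1 <= k < 4) w k <= X.
  by rewrite big_nat_recr//= big_nat_recr//= big_nat1.
have X0 : 0 <= X by apply: le_trans W3; apply: sumr_ge0 => k _; exact: w0.
elim/ltn_ind: L => L IH.
have [L4|L4] := ltnP L 4.
  apply: (@le_trans _ _ (\sum_(1 <= k < 4) w k)); last by lra.
  rewrite [leRHS](big_cat_nat (n := L.+1))//= lerDl.
  by apply: sumr_ge0 => k _; exact: w0.
rewrite (big_cat_nat (n := 4))//=; last by rewrite ltnS ltnW.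
have -> : \sum_(4 <= k < L.+1) w k = (\sum_(1 <= k < (L - 3).+1) w k) * i.
  rewrite mulr_suml -[4%N]/(1 + 3)%N big_addn subSn; last by rewrite ltnW.
  rewrite !big_nat; apply: eq_bigr => k /andP[k1 _].
  by case: k k1 => // k _; rewrite addn3 wS.
have := IH (L - 3)%N; rewrite ltn_subrL (leq_trans _ L4)// => /(_ isT) {}IH.
have := ler_wpM2r i0 IH; have : X * i <= X * (1 / 2) by rewrite ler_wpM2l.
by lra.
Qed.

Section PrimePower.
Variable p : nat.
Hypothesis pp : prime p.
Let p0 : (0 < p)%N := prime_gt0 pp.
Let P0 : 0 < p%:R :> R.
Proof. by rewrite ltr0n. Qed.

Lemma S_variance_pow3 : v (p ^ 3) <= 2 / p%:R ^+ 3.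
Proof.
rewrite /S_variance natrX ler_pM2r ?invr_gt0 ?exprn_gt0//.
apply: (@le_trans _ _ (\sum_(a < p ^ 3) (((p ^ 3)%N %| a%:Z)%Z%:R * 1 ^+ 2 +
    ((p ^ 2)%N %| a%:Z)%Z%:R * p%:R^-1 ^+ 2))).
  apply: ler_sum => a _; rewrite S_pow3//.
  by have := @sqr_indicatorB ((p ^ 3)%N %| a%:Z)%Z ((p ^ 2)%N %| a%:Z)%Z 1 p%:R^-1;
    rewrite mulr1; apply; rewrite ?invr_ge0.
rewrite big_split /= -!mulr_suml.
rewrite (@sum_dvd_indicator_eq _ (p ^ 3) 1) ?muln1 ?expn_gt0 ?p0//.
rewrite (@sum_dvd_indicator_eq _ (p ^ 2) p _ (expnSr p 2)) ?expn_gt0 ?p0//.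
rewrite expr1n mulr1 expr2 mulrA divff ?gt_eqF// mul1r.
have : p%:R^-1 <= 1 :> R by rewrite invf_le1// ler1n.
lra.
Qed.

Lemma S_variance_pow2 : p != 3%N -> v (p ^ 2) <= 2 / p%:R ^+ 4.
Proof.
move=> p3; rewrite /S_variance.
have -> : 2 / p%:R ^+ 4 = 2 / p%:R ^+ 2 / (p ^ 2)%:R :> R.
  by rewrite natrX; field; rewrite gt_eqF.
rewrite ler_pM2r ?invr_gt0 ?ltr0n ?expn_gt0 ?p0//.
apply: (@le_trans _ _ (\sum_(a < p ^ 2) (((p ^ 2)%N %| a%:Z)%Z%:R * p%:R^-1 ^+ 2 +
    (p %| a%:Z)%Z%:R * (p%:R^-1 ^+ 2) ^+ 2))).
  apply: ler_sum => a _; rewrite S_pow2//.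
  have := @sqr_indicatorB ((p ^ 2)%N %| a%:Z)%Z (p %| a%:Z)%Z p%:R^-1 (p%:R^-1 ^+ 2).
  by rewrite -exprVn; apply; rewrite ?exprn_ge0 ?invr_ge0.
rewrite big_split /= -!mulr_suml.
rewrite (@sum_dvd_indicator_eq _ (p ^ 2) 1) ?muln1 ?expn_gt0 ?p0//.
rewrite (@sum_dvd_indicator_eq _ p p p0 (esym (mulnn p))) mul1r.
have P1 : 1 <= p%:R :> R by rewrite ler1n.
have -> : p%:R * (p%:R^-1 ^+ 2) ^+ 2 = p%:R^-1 ^+ 2 * p%:R^-1 :> R by field; rewrite gt_eqF.
rewrite -exprVn mulrC [2 * _]mulrC -{1}[p%:R^-1 ^+ 2]mul1r mulrC.
have : p%:R^-1 <= 1 :> R by rewrite invf_le1.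
have : 0 <= p%:R^-1 ^+ 2 :> R by rewrite sqr_ge0.
by nra.
Qed.

(** [S a 9] is a difference of two densities lying between [0] and [9]. *)
Lemma S_variance_pow2_3 : p = 3%N -> v (p ^ 2) <= 81.
Proof.
move=> p3.
rewrite /S_variance ler_pdivrMr ?ltr0n ?expn_gt0 ?p0//.
have -> : 81 * (p ^ 2)%:R = \sum_(a < p ^ 2) 81 :> R.
  by rewrite sumr_const card_ord mulr_natr.
apply: ler_sum => a _.
have dle q : density R a%:Z q <= q%:R.
  have [->|q0] := posnP q; first by rewrite /density expr0n invr0 mulr0.
  rewrite /density ler_pdivrMr ?exprn_gt0 ?ltr0n// -exprS -natrX ler_nat.
  by apply: leq_trans (max_card _) _; rewrite card_ffun !card_ord.
have E : S a%:Z (p ^ 2) = density R a%:Z (p ^ 2) - density R a%:Z (p ^ 1).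
  by rewrite -!sum_S_density// [in RHS]big_nat_recr//= addrAC subrr add0r.
have := density_ge0 R a%:Z (p ^ 2); have := density_ge0 R a%:Z (p ^ 1).
have := dle (p ^ 2)%N; have := dle (p ^ 1)%N.
rewrite E; set x := density R _ (p ^ 2); set y := density R _ (p ^ 1); rewrite p3 !natrX.
nra.
Qed.

Lemma S_variance_pow_gt3 k : v (p ^ k.+4) = v (p ^ k.+1) / p%:R ^+ 3.
Proof.
have E : \sum_(a < p ^ k.+4) S a%:Z (p ^ k.+4) ^+ 2 =
    \sum_(b < p ^ k.+1) S b%:Z (p ^ k.+1) ^+ 2.
  have sp : (p ^ k.+4 = p ^ 3 * p ^ k.+1)%N by rewrite -expnD.
  pose f (a : int) := if ((p ^ 3)%N %| a)%Z then S (a %/ (p ^ 3)%N)%Z (p ^ k.+1) ^+ 2 else 0.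
  transitivity (\sum_(a < p ^ k.+4) f a%:Z).
    by apply: eq_bigr => a _; rewrite S_pow_gt3// /f; case: ifP => // _; rewrite expr0n.
  rewrite sp (@sum_dvd_split _ _ _ (fun a => S (a %/ (p ^ 3)%N)%Z (p ^ k.+1) ^+ 2)) ?expn_gt0 ?p0//.
  apply: eq_bigr => b _; rewrite mulKz// eqz_nat -lt0n expn_gt0 p0//.
rewrite /S_variance E -[k.+4]/(3 + k.+1)%N expnD natrM invfM natrX.
by rewrite mulrCA mulrC.
Qed.

Let s : R := Num.sqrt p%:R.
Let s0 : 0 < s.
Proof. by rewrite sqrtr_gt0. Qed.
Let s2 : s ^+ 2 = p%:R.
Proof. by rewrite sqr_sqrtr// ltW. Qed.

Lemma sqrt_natX k : Num.sqrt (p ^ k)%:R = s ^+ k :> R.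
Proof.
by rewrite natrX -s2 -exprM mulnC exprM sqrtr_sqr ger0_norm// exprn_ge0// ltW.
Qed.

Let w k : R := v (p ^ k) * s ^+ k.
Let w0 k : 0 <= w k.
Proof. by rewrite mulr_ge0 ?S_variance_ge0// exprn_ge0// ltW. Qed.

(** Raising the exponent by three multiplies the weighted variance by [s^-3 <= 1/2], so the sum is
    at most twice the bound for its first three terms, [972 + 1458 + 2 <= 2500]. The value
    [1458 = 81 * 18] comes from [p = 3], where [s^5 <= 18]. *)
Lemma sum_S_variance_pow L : \sum_(1 <= k < L.+1) w k <= 5000 / s ^+ 3.
Proof.
have s3_2 : 2 <= s ^+ 3.
  have : 4 <= (s ^+ 3) ^+ 2.
    rewrite -exprM mulnC exprM s2 -natrX ler_nat; apply: (@leq_trans (2 ^ 3)) => //.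
    by rewrite leq_exp2r// prime_gt1.
  have : 0 <= s ^+ 3 by rewrite exprn_ge0// ltW.
  by nra.
have s3p : 0 < s ^+ 3 by rewrite exprn_gt0.
have wS k : w k.+4 = w k.+1 / s ^+ 3.
  rewrite /w S_variance_pow_gt3 -s2 -exprM -[k.+4]/(3 + k.+1)%N exprD.
  by field; rewrite gt_eqF.
have w1 : w 1 <= 972 / s ^+ 3.
  rewrite /w expn1 expr1 ler_pdivlMr// -mulrA -exprS.
  have := S_variance_prime R pp; rewrite -s2 -exprM ler_pdivlMr ?exprn_gt0//.
have w2 : w 2 <= 1458 / s ^+ 3.
  have [p3|p3] := eqVneq p 3%N.
    rewrite /w ler_pdivlMr// -mulrA -exprD.
    have s5 : s ^+ 5 <= 18.
      have := s2; rewrite p3 => s3.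
      rewrite -(@ler_pXn2r _ 2) ?nnegrE ?exprn_ge0 ?(ltW s0)//.
      by rewrite -exprM mulnC exprM s3; lra.
    apply: (@le_trans _ _ (81 * 18)); last by lra.
    by apply: ler_pM => //; rewrite ?S_variance_ge0 ?exprn_ge0 ?(ltW s0)// S_variance_pow2_3.
  rewrite /w; apply: (@le_trans _ _ (2 / p%:R ^+ 4 * s ^+ 2)).
    by rewrite ler_wpM2r ?exprn_ge0 ?(ltW s0)// S_variance_pow2.
  have -> : 2 / p%:R ^+ 4 * s ^+ 2 = 2 / s ^+ 3 / s ^+ 3.
    by rewrite -s2; field; rewrite gt_eqF.
  rewrite ler_pM2r ?invr_gt0// ler_pdivrMr//; lra.
have w3 : w 3 <= 2 / s ^+ 3.
  have := S_variance_pow3; rewrite -s2 -exprM /w => H.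
  apply: (@le_trans _ _ (2 / s ^+ (2 * 3) * s ^+ 3)).
    by rewrite ler_wpM2r// ltW.
  by rewrite (_ : 2 / s ^+ (2 * 3) * s ^+ 3 = 2 / s ^+ 3)//; field; rewrite gt_eqF.
have i3 : 0 <= (s ^+ 3)^-1 by rewrite invr_ge0 ltW.
have i3h : (s ^+ 3)^-1 <= 1 / 2 by rewrite ler_pdivlMr// mulrC ler_pdivrMr// mul1r.
have -> : 5000 / s ^+ 3 = 2 * (2500 / s ^+ 3) by rewrite mulrA -natrM.
apply: (@sum_recursive_le w _ (s ^+ 3)^-1) => //; first by rewrite i3.
by move: w1 w2 w3 i3; move: (w 1) (w 2) (w 3) (s ^+ 3)^-1 => x1 x2 x3 i; lra.
Qed.

End PrimePower.

Lemma sum_inv_n_sqrt_n N : \sum_(1 <= n < N.+1) (n%:R * Num.sqrt n%:R)^-1 <= 3 :> R.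
Proof.
(* The bound is strengthened to make the induction work: [2 / sqrt n - 2 / sqrt (n + 1)] dominates
   the new term [(n + 1)^(-3/2)]. *)
suff : \sum_(1 <= n < N.+2) (n%:R * Num.sqrt n%:R)^-1 <= 3 - 2 / Num.sqrt N.+1%:R :> R.
  rewrite big_nat_recr//= => H; apply: (@le_trans _ _ (3 - 2 / Num.sqrt N.+1%:R)).
    by apply: le_trans H; rewrite lerDl invr_ge0 mulr_ge0// sqrtr_ge0.
  by rewrite gerBl divr_ge0// sqrtr_ge0.
elim: N => [|N IH]; first by rewrite big_nat1 sqrtr1 mulr1 invr1; lra.
rewrite big_nat_recr//=; apply: le_trans (lerD IH (lexx _)) _.
set x := Num.sqrt N.+1%:R; set y := Num.sqrt N.+2%:R.
have x0 : 0 < x by rewrite sqrtr_gt0.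
have y0 : 0 < y by rewrite sqrtr_gt0.
have x2 : x ^+ 2 = N.+1%:R by rewrite sqr_sqrtr.
have y2 : y ^+ 2 = x ^+ 2 + 1 by rewrite sqr_sqrtr// x2 natr1.
have -> : N.+2%:R = y ^+ 2 by rewrite sqr_sqrtr.
have xy : x <= y by rewrite ler_wsqrtr// ler_nat.
rewrite -lerBrDl opprD opprK addrA [3 + _]addrC addrK.
have -> : - (2 / y) + 2 / x = 2 * (y - x) / (x * y) by field; rewrite !gt_eqF.
rewrite ler_pdivlMr ?mulr_gt0//.
have -> : (y ^+ 2 * y)^-1 * (x * y) = x / y ^+ 2 by field; rewrite gt_eqF.
rewrite ler_pdivrMr ?exprn_gt0//.
have E : (y - x) * (y + x) = 1 by rewrite -subr_sqr y2; ring.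
have yx : 0 <= y - x by rewrite subr_ge0.
have H : 1 <= (y - x) * (2 * y) by rewrite -[X in X <= _]E ler_wpM2l//; lra.
have := ler_wpM2r (ltW y0) H; rewrite mul1r.
by move: xy; rewrite (_ : (y - x) * (2 * y) * y = 2 * (y - x) * y ^+ 2); [lra|ring].
Qed.

Lemma prod_le_exp_sum (I : Type) (s : seq I) (P : pred I) (F : I -> R) :
  (forall i, 0 <= F i) ->
  \prod_(i <- s | P i) (1 + F i) <= expR (\sum_(i <- s | P i) F i).
Proof.
move=> F0; rewrite expR_sum; apply: ler_prod => i _.
by rewrite expR_ge1Dx addr_ge0.
Qed.

Lemma prod_primes_three_halves (c : R) z : 0 <= c ->
  \prod_(p <- primes_le z) (1 + c / (p%:R * Num.sqrt p%:R)) <= expR (3 * c).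
Proof.
move=> c0.
have F0 i : 0 <= c / (i%:R * Num.sqrt i%:R) by rewrite divr_ge0// mulr_ge0// sqrtr_ge0.
apply: le_trans (prod_le_exp_sum _ _ F0) _; rewrite ler_expR.
apply: (@le_trans _ _ (\sum_(1 <= n < z.+1) c / (n%:R * Num.sqrt n%:R))).
  rewrite big_filter big_mkcond /= /index_iota subSS subn0.
  by apply: ler_sum => i _; case: ifP.
by rewrite -mulr_sumr mulrC ler_wpM2r// sum_inv_n_sqrt_n.
Qed.

(** The weight [sqrt n] still leaves Euler factors [1 + O(p^(-3/2))]. Enlarging [n <= Y] to a set of
    smooth numbers is harmless because all terms are nonnegative. *)
Lemma sum_S_variance_sqrt : exists2 C : R, 0 < C &
  forall Y, \sum_(1 <= n < Y.+1) v n * Num.sqrt n%:R <= C.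
Proof.
have [c c0 Hc] : exists2 c : R, 0 <= c & forall p L, prime p ->
    \sum_(1 <= k < L.+1) v (p ^ k) * Num.sqrt p%:R ^+ k <= c / Num.sqrt p%:R ^+ 3.
  by exists 5000; [exact: ler0n|move=> p L pp; exact: sum_S_variance_pow].
exists (expR (3 * c)) => [|Y]; first exact: expR_gt0.
have F0 n : 0 <= v n * Num.sqrt n%:R by rewrite mulr_ge0 ?S_variance_ge0// sqrtr_ge0.
have aps := all_primes_le Y; have ups := uniq_primes_le Y.
apply: (@le_trans _ _ (\sum_(n <- smooth (trunc_log^~ Y) (primes_le Y)) v n * Num.sqrt n%:R)).
  apply: sum_uniq_sub_le => //; [exact: iota_uniq|exact: uniq_smooth|].
  by move=> n; rewrite mem_index_iota ltnS => nY; apply: mem_smooth_primes_le.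
rewrite (@sum_smooth R _ _ (fun n => v n * Num.sqrt n%:R))//; first last.
- move=> m n m0 n0 cop; rewrite S_variance_crt// natrM sqrtrM// mulrACA//.
- by rewrite S_variance1 sqrtr1 mulr1.
apply: le_trans (prod_primes_three_halves Y c0).
rewrite big_seq [leRHS]big_seq; apply: ler_prod => p; rewrite primes_leP => /andP[pp _].
rewrite sumr_ge0 //= big_ltn// expn0 S_variance1 sqrtr1 mulr1 lerD2l.
under eq_bigr do rewrite sqrt_natX//.
apply: le_trans (Hc p _ pp) _; rewrite exprSr sqr_sqrtr//.
Qed.

(** Rankin's trick: [1 <= sqrt n / sqrt X] for [n > X]. *)
Lemma sum_S_variance_tail : exists2 C : R, 0 < C &
  forall (s : seq nat) X, (0 < X)%N -> uniq s -> (forall n, n \in s -> (X < n)%N) ->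
  \sum_(n <- s) v n <= C / Num.sqrt X%:R.
Proof.
have [C C0 HC] := sum_S_variance_sqrt; exists C => // s X X0 us sX.
rewrite ler_pdivlMr ?sqrtr_gt0 ?ltr0n// mulr_suml.
pose Y := (\max_(n <- s) n)%N.
have F0 n : 0 <= v n * Num.sqrt n%:R by rewrite mulr_ge0 ?S_variance_ge0// sqrtr_ge0.
apply: (@le_trans _ _ (\sum_(n <- s) v n * Num.sqrt n%:R)).
  rewrite big_seq [leRHS]big_seq; apply: ler_sum => n ns.
  by rewrite ler_wpM2l ?S_variance_ge0// ler_wsqrtr// ler_nat ltnW// sX.
apply: (le_trans _ (HC Y)); apply: sum_uniq_sub_le => //; first exact: iota_uniq.
move=> n ns; rewrite mem_index_iota ltnS (leq_trans _ (sX n ns))//=.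
by rewrite /Y (big_rem n)//= leq_maxl.
Qed.

End VarianceSum.

(** * Local solvability *)

Section Solvability.
Variable R : realType.
Local Notation S := (S_ R).

Definition ord_mod (q : nat) (q0 : (0 < q)%N) (x : int) : 'I_q :=
  Ordinal (introT idP (ltn_pmod (absz (x %% q)%Z) q0)).

Lemma ord_modE q (q0 : (0 < q)%N) x : (ord_mod q0 x)%:Z = (x %% q)%Z.
Proof.
have h : 0 <= (x %% q)%Z by rewrite modz_ge0// eqz_nat gt_eqF.
by rewrite /= modn_small ?gez0_abs// -ltz_nat gez0_abs// ltz_pmod.
Qed.

Definition ffun3 (q : nat) (q0 : (0 < q)%N) (x y z : int) : {ffun 'I_3 -> 'I_q} :=
  [ffun i : 'I_3 => ord_mod q0 (nth 0 [:: x; y; z] i)].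

Lemma F_ffun3 q (q0 : (0 < q)%N) x y z a :
  (q %| F_ a (fun i => (ffun3 q0 x y z i)%:Z))%Z = (q %| x ^+ 3 + y ^+ 3 + z ^+ 3 - a)%Z.
Proof.
rewrite /F_ /F0 !big_ord_recl big_ord0 /ffun3 !ffunE !ord_modE /= addr0.
have xm t : exists k, (t %% q)%Z = t + k * q%:Z.
  by exists (- (t %/ q)%Z); apply/eqP; rewrite mulNr eq_sym subr_eq addrC -divz_eq.
have [k ->] := xm x; have [l ->] := xm y; have [m ->] := xm z.
pose W (u v : int) := 3 * u ^+ 2 * v + 3 * u * v ^+ 2 * q%:Z + v ^+ 3 * q%:Z ^+ 2.
rewrite (_ : _ + _ - a = x ^+ 3 + y ^+ 3 + z ^+ 3 - a + q%:Z * (W x k + W y l + W z m)).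
  by rewrite dvdz_addr// dvdz_mulr.
by rewrite /W; ring.
Qed.

Lemma solutions_gt0 (q : nat) (x y z a : int) : (0 < q)%N ->
  (q %| x ^+ 3 + y ^+ 3 + z ^+ 3 - a)%Z -> (0 < #|solutions a q|)%N.
Proof.
move=> q0 d; apply/card_gt0P; exists (ffun3 q0 x y z).
by rewrite inE F_ffun3.
Qed.

Section Prime.
Variable p : nat.
Hypothesis pp : prime p.
Let p0 : (0 < p)%N := prime_gt0 pp.

Definition cubes1 (c : int) : Prop := exists x : int, (p %| x ^+ 3 - c)%Z.
Definition cubes2 (c : int) : Prop := exists x y : int, (p %| x ^+ 3 + y ^+ 3 - c)%Z.
Definition cubes3 (c : int) : Prop := exists x y z : int, (p %| x ^+ 3 + y ^+ 3 + z ^+ 3 - c)%Z.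

(** Such sets are unions of classes mod [p] invariant under multiplication by cubes: cosets of the
    group of unit cubes, possibly together with the zero class. *)
Definition cube_stable (X : int -> Prop) :=
  (forall c d, (p %| c - d)%Z -> X c -> X d) /\ (forall c t, X c -> X (c * t ^+ 3)).

Lemma dvdz_sub_trans (s c d : int) : (p %| c - d)%Z -> (p %| s - c)%Z -> (p %| s - d)%Z.
Proof. by move=> cd sc; rewrite -(subrKA c) rpredD. Qed.

Lemma cube_stable1 : cube_stable cubes1.
Proof.
split=> [c d cd [x h]|c t [x h]]; first by exists x; apply: dvdz_sub_trans cd h.
exists (x * t); rewrite (_ : _ - _ = (x ^+ 3 - c) * t ^+ 3); last by ring.
exact: dvdz_mulr.
Qed.

Lemma cube_stable2 : cube_stable cubes2.
Proof.
split=> [c d cd [x [y h]]|c t [x [y h]]]; first by exists x, y; apply: dvdz_sub_trans cd h.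
exists (x * t), (y * t); rewrite (_ : _ - _ = (x ^+ 3 + y ^+ 3 - c) * t ^+ 3); last by ring.
exact: dvdz_mulr.
Qed.

Lemma cube_stable3 : cube_stable cubes3.
Proof.
split=> [c d cd [x [y [z h]]]|c t [x [y [z h]]]].
  by exists x, y, z; apply: dvdz_sub_trans cd h.
exists (x * t), (y * t), (z * t).
rewrite (_ : _ - _ = (x ^+ 3 + y ^+ 3 + z ^+ 3 - c) * t ^+ 3); last by ring.
exact: dvdz_mulr.
Qed.

Lemma cube_stableE X c t : cube_stable X -> ~~ (p %| t)%Z -> X (c * t ^+ 3) <-> X c.
Proof.
move=> [Xm Xt] pt; split; last exact: Xt.
have /coprimezP[[u v] /= uv] : coprimez p t by rewrite coprimez_prime.
move=> /(Xt _ v); apply: Xm.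
rewrite (_ : _ - c = c * ((v * t) ^+ 3 - 1)); last by ring.
rewrite dvdz_mull// -eqz_mod_dvd; apply/eqz_modP.
have -> : v * t = 1 - u * p%:Z by rewrite -uv addrC addKr.
by exists (- u * (3 - 3 * (u * p%:Z) + (u * p%:Z) ^+ 2)); ring.
Qed.

(* A nonempty union of nonzero cosets of the cubes fills a third of the nonzero residues. *)
Lemma cube_stable_diff_card (X Y : int -> Prop) (u : int) :
  cube_stable X -> cube_stable Y -> X u -> ~ Y u -> (forall c, (p %| c)%Z -> Y c) ->
  p.-1%:R <= 3 * \sum_(w < p) `[< X w%:Z /\ ~ Y w%:Z >]%:R :> R.
Proof.
move=> sX sY Xu nYu Y0; pose f (c : int) : R := `[< X c /\ ~ Y c >]%:R.
have -> : p.-1%:R = p.-1%:R * f u by rewrite /f asboolT// mulr1.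
apply: (@cube_invariant_le R p pp f) => //.
- move=> c d cd; have {}cd : (p %| c - d)%Z by rewrite -eqz_mod_dvd; apply/eqP.
  have dc : (p %| d - c)%Z by rewrite -opprB rpredN.
  rewrite /f; congr (nat_of_bool _)%:R; apply: asbool_equiv_eq.
  split=> -[h1 h2]; split.
  + exact: sX.1 cd h1.
  + by move=> h; apply: h2; apply: sY.1 dc h.
  + exact: sX.1 dc h1.
  + by move=> h; apply: h2; apply: sY.1 cd h.
- by move=> w t pt; rewrite /f; congr (nat_of_bool _)%:R; apply: asbool_equiv_eq; rewrite !cube_stableE.
- by apply/negP => /Y0.
Qed.

Lemma residue_ind (X : int -> Prop) : cube_stable X -> X 0 -> (forall c, X c -> X (c + 1)) ->
  forall c, X c.
Proof.
move=> [Xm _] X0 Xs c.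
have Xn (n : nat) : X n%:Z by elim: n => // n /Xs; rewrite addrC -intS.
apply: Xm (Xn (absz (c %% p)%Z)).
by rewrite gez0_abs ?modz_ge0 ?eqz_nat ?gt_eqF// -eqz_mod_dvd modz_mod.
Qed.

(** A missed class would make the chain from the multiples of [p] through [cubes1], [cubes2],
    [cubes3] to all integers strictly increasing, since a set equal to its successor is closed under
    adding [1 = 1^3] and hence everything. Each of the four steps adds a third of the nonzero
    residues, which is too many. *)
Lemma cubes3_all c : cubes3 c.
Proof.
have [//|nc] := pselect (cubes3 c); exfalso.
have s12 d : cubes1 d -> cubes2 d by move=> [x h]; exists x, 0; rewrite expr0n addr0.
have s23 d : cubes2 d -> cubes3 d by move=> [x [y h]]; exists x, y, 0; rewrite expr0n addr0.
have s1z d : (p %| d)%Z -> cubes1 d by move=> h; exists 0; rewrite expr0n sub0r rpredN.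
have [u2 u2P] : exists u, cubes2 u /\ ~ cubes1 u.
  apply: contrapT => /forallNP H; apply: nc; apply/s23/s12.
  apply: (residue_ind cube_stable1); first by apply: s1z; rewrite dvdz0.
  move=> d [x h]; apply: contrapT => h'; apply: (H (d + 1)); split => //.
  by exists x, 1; rewrite expr1n opprD addrACA subrr addr0.
have [u3 u3P] : exists u, cubes3 u /\ ~ cubes2 u.
  apply: contrapT => /forallNP H; apply: nc; apply/s23.
  apply: (residue_ind cube_stable2); first by apply/s12/s1z; rewrite dvdz0.
  move=> d [x [y h]]; apply: contrapT => h'; apply: (H (d + 1)); split => //.
  by exists x, y, 1; rewrite expr1n opprD addrACA subrr addr0.
have sZ : cube_stable (fun c => (p %| c)%Z).
  split=> [a b ab|a t]; last by move=> h; rewrite dvdz_mulr.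
  by move=> h; have := dvdz_addl b ab; rewrite subrK => <-.
have sT : cube_stable (fun=> True) by split.
have p1 : ~ (p %| 1)%Z by apply/negP; rewrite dvdz1 /= gtn_eqF// prime_gt1.
have s11 : cubes1 1 by exists 1; rewrite expr1n subrr dvdz0.
have C1 := cube_stable_diff_card cube_stable1 sZ s11 p1 (fun _ h => h).
have C2 := cube_stable_diff_card cube_stable2 cube_stable1 u2P.1 u2P.2 s1z.
have C3 := cube_stable_diff_card cube_stable3 cube_stable2 u3P.1 u3P.2 (fun c h => s12 c (s1z c h)).
have C4 := cube_stable_diff_card sT cube_stable3 I nc (fun c h => s23 c (s12 c (s1z c h))).
have : \sum_(w < p) (`[< cubes1 w%:Z /\ ~ (p %| w%:Z)%Z >]%:R + `[< cubes2 w%:Z /\ ~ cubes1 w%:Z >]%:R +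
   `[< cubes3 w%:Z /\ ~ cubes2 w%:Z >]%:R + `[< True /\ ~ cubes3 w%:Z >]%:R) <=
   \sum_(w < p) (w != Ordinal p0)%:R :> R.
  apply: ler_sum => w _; have [->|w0] := eqVneq w (Ordinal p0).
    rewrite !asboolF ?addr0//; move=> [].
    - by move=> _; apply; apply/s23/s12/s1z; rewrite dvdz0.
    - by move=> _; apply; apply/s12/s1z; rewrite dvdz0.
    - by move=> _; apply; apply/s1z; rewrite dvdz0.
    - by move=> _; apply; rewrite dvdz0.
  have h12 := s12 w%:Z; have h23 := s23 w%:Z; have h1 := s1z w%:Z.
  rewrite !asbool_and !asbool_neg.
  move: (asboolP (cubes1 w%:Z)) (asboolP (cubes2 w%:Z)) (asboolP (cubes3 w%:Z)).
  case: asboolP => a1; case: asboolP => a2; case: asboolP => a3; case: asboolP => a4;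
    case: asboolP => a5 _ _ _ /=; rewrite ?addr0 ?add0r ?lexx//; exfalso; tauto.
rewrite !big_split /=.
have -> : \sum_(w < p) (w != Ordinal p0)%:R = p.-1%:R :> R.
  transitivity (\sum_(w < p | w != Ordinal p0) (1 : R)).
    by rewrite [RHS]big_mkcond; apply: eq_bigr => w _; case: eqP.
  rewrite sumr_const; congr (_%:R).
  by rewrite -[in RHS](card_ord p) -(cardC1 (Ordinal p0)); apply: eq_card => i.
have : 0 < p.-1%:R :> R by rewrite ltr0n -subn1 subn_gt0 prime_gt1.
lra.
Qed.

(** The subtracted term is worth one solution, present only when [p | a]; then [(0, 0, 0)] and
    [(1, -1, 0)] are two solutions. *)
Lemma density_prime_ge a : p%:R ^- 2 <= density R a p - (p %| a)%Z%:R / p%:R ^+ 2.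
Proof.
rewrite /density -mulrBl -[X in X <= _]mul1r ler_wpM2r ?invr_ge0 ?exprn_ge0//.
case: (boolP (p %| a)%Z) => pa; last first.
  rewrite subr0 ler1n; have [x [y [z h]]] := cubes3_all a.
  exact: solutions_gt0 h.
rewrite lerBrDr -(natrD R 1 1) ler_nat.
pose y0 := ffun3 p0 0 0 0; pose y1 := ffun3 p0 1 (-1) 0.
have y01 : y0 != y1.
  apply/eqP => /ffunP/(_ ord0); rewrite /y0 /y1 !ffunE /= => /(congr1 (fun i : 'I_p => i%:Z)).
  rewrite !ord_modE => /eqP; rewrite eqz_mod_dvd sub0r rpredN dvdz1 /= gtn_eqF//.
  exact: prime_gt1.
have -> : (1 + 1 = #|pred2 y0 y1|)%N by rewrite card2 y01.
apply: subset_leq_card; apply/fintype.subsetP => y; rewrite !inE => /orP[]/eqP->.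
  by rewrite F_ffun3 expr0n !addr0 sub0r rpredN.
by rewrite F_ffun3 expr0n addr0 (_ : 1 ^+ 3 + _ = 0)// sub0r rpredN.
Qed.

End Prime.

(** For [9 | a] the subtracted [1/3 = 27/81] is accounted for by the [27] triples of multiples of
    [3], and [(1, -1, 0)] is one more solution. Otherwise a single solution is enough, and only the
    classes [4] and [5] have none. *)
Lemma density_nine_ge (a : int) : (a != 4 %[mod 9])%Z -> (a != -4 %[mod 9])%Z ->
  81^-1 <= density R a 9 - (9 %| a)%Z%:R / 3.
Proof.
move=> a4 a5; rewrite /density.
have -> : (9 %| a)%Z%:R / 3 = (9 %| a)%Z%:R * 27 / 9%:R ^+ 2 :> R by lra.
have -> : 81^-1 = 1 / 9%:R ^+ 2 :> R by lra.
rewrite -mulrBl ler_wpM2r ?invr_ge0 ?exprn_ge0//.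
case: (boolP (9 %| a)%Z) => d9; last first.
  rewrite mul0r subr0 ler1n.
  have : (a %% 9)%Z \in [:: 1; 2; 3; 6; 7; 8 : int].
    have r0 : 0 <= (a %% 9)%Z by rewrite modz_ge0.
    have r9 : (a %% 9)%Z < 9 by rewrite ltz_pmod.
    have : (a %% 9)%Z != 0 by apply: contra d9 => /eqP/dvdz_mod0P.
    have : (a %% 9)%Z != 4 by exact: a4.
    have : (a %% 9)%Z != 5 by exact: a5.
    case: (a %% 9)%Z r0 r9 => // n _; rewrite ltz_nat.
    by do 9 (case: n => [|n]//).
  have sol x y z : ((x ^+ 3 + y ^+ 3 + z ^+ 3) %% 9)%Z = (a %% 9)%Z ->
      (0 < #|solutions a 9|)%N.
    by move=> h; apply: (@solutions_gt0 9 x y z) => //; rewrite -eqz_mod_dvd; apply/eqP.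
  rewrite !inE => /or4P[/eqP h|/eqP h|/eqP h|/or3P[]/eqP h].
  - by apply: (sol 1 0 0); rewrite h.
  - by apply: (sol 1 1 0); rewrite h.
  - by apply: (sol 1 1 1); rewrite h.
  - by apply: (sol (-1) (-1) (-1)); rewrite h.
  - by apply: (sol (-1) (-1) 0); rewrite h.
  - by apply: (sol (-1) 0 0); rewrite h.
rewrite mul1r lerBrDr -(natrD R 1 27) ler_nat.
pose T := [pred x : 'I_9 | (3 %| x)%N].
have cT : #|T| = 3%N by rewrite -sum1_card big_mkcond !big_ord_recl big_ord0.
have q0 : (0 < 9)%N by [].
pose y1 := ffun3 q0 1 (-1) 0.
have -> : (1 + 27 = #|predU1 y1 (ffun_on T)|)%N.
  have y1T : y1 \notin ffun_on T by apply/negP => /ffun_onP/(_ ord0); rewrite /y1 ffunE.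
  by rewrite cardU1 card_ffun_on cT card_ord y1T.
apply: subset_leq_card; apply/fintype.subsetP => y; rewrite !inE => /orP[/eqP->|/ffun_onP yT].
  by rewrite F_ffun3 expr0n addr0 (_ : 1 ^+ 3 + _ = 0)// sub0r rpredN.
rewrite /F_ rpredB// /F0 rpred_sum// => i _.
have /dvdnP[k ->] : (3 %| y i)%N by have := yT i.
rewrite PoszM exprMn dvdz_mull//.
Qed.

End Solvability.

(** * Products over primes *)

Section PrimeProducts.

Lemma dvdn_prod_primes (s : seq nat) N : all prime s -> uniq s ->
  (forall p, p \in s -> (p %| N)%N) -> (\prod_(p <- s) p %| N)%N.
Proof.
elim: s => [|p s IH]; first by rewrite big_nil dvd1n.
move=> /andP[pp aps] /andP[ps us] H; rewrite big_cons Gauss_dvd.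
  rewrite H ?mem_head//= IH// => q qs; apply: H; by rewrite inE qs orbT.
rewrite prime_coprime//; apply: contra ps => pd.
have : exists2 q, q \in s & (p %| q)%N.
  elim: s pd {IH us H} aps => [|q s IH] /=; first by rewrite big_nil dvdn1 => /eqP p1; rewrite p1 in pp.
  rewrite big_cons Euclid_dvdM// => /orP[pq|/IH h] /andP[_ aps].
    by exists q; rewrite ?mem_head.
  by have [q' q's pq'] := h aps; exists q'; rewrite ?inE ?q's ?orbT.
move=> [q qs]; rewrite dvdn_prime2 ?(allP aps _ qs)// => /eqP->.
exact: qs.
Qed.

Lemma bin_le_pow2 n k : ('C(n, k) <= 2 ^ n)%N.
Proof.
have [kn|kn] := leqP k n; last by rewrite bin_small.
rewrite -[2%N]/(1 + 1)%N expnDn (bigD1 (Ordinal (kn : (k < n.+1)%N)))//=.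
by rewrite !exp1n !muln1 leq_addr.
Qed.

Lemma dvdn_central_bin n p : prime p -> (n < p <= n + n)%N -> (p %| 'C(n + n, n))%N.
Proof.
move=> pp /andP[np pnn].
have E := bin_fact (leq_addr n n); rewrite addnK in E.
have : (p %| (n + n)`!)%N by rewrite dvdn_fact// prime_gt0.
rewrite -E Euclid_dvdM// Euclid_dvdM// => /orP[//|].
have H m : (m <= n)%N -> ~~ (p %| m`!)%N.
  elim: m => [|m IH] mn; first by rewrite dvdn1 gtn_eqF// prime_gt1.
  rewrite factS Euclid_dvdM// negb_or IH ?(ltnW mn)// andbT.
  by rewrite gtnNdvd// (leq_ltn_trans mn).
by rewrite (negPf (H n (leqnn n))).
Qed.

Definition dyadic_primes (k : nat) : seq nat := [seq p <- iota (2 ^ k).+1 (2 ^ k) | prime p].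

Lemma mem_dyadic_primes k p : (p \in dyadic_primes k) = prime p && (2 ^ k < p <= 2 ^ k.+1)%N.
Proof. by rewrite mem_filter mem_iota addSn ltnS addnn -mul2n -expnS. Qed.

(** Chebyshev: the product of these primes divides the central binomial coefficient of [2^k], which
    is at most [2 ^ (2 ^ k.+1)]. *)
Lemma size_dyadic_primes k : (k * size (dyadic_primes k) <= 2 ^ k.+1)%N.
Proof.
rewrite -(@leq_exp2l 2)//.
apply: (@leq_trans (\prod_(p <- dyadic_primes k) p)).
  have -> : (2 ^ (k * size (dyadic_primes k)) = \prod_(p <- dyadic_primes k) 2 ^ k)%N.
    by rewrite big_const_seq count_predT iter_muln_1 expnM.
  rewrite big_seq [leqRHS]big_seq; apply: leq_prod => p.
  by rewrite mem_dyadic_primes => /and3P[_ /ltnW].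
apply: (@leq_trans 'C(2 ^ k + 2 ^ k, 2 ^ k)).
  apply: dvdn_leq; first by rewrite bin_gt0 leq_addr.
  apply: dvdn_prod_primes; first exact: filter_all.
    by rewrite filter_uniq// iota_uniq.
  move=> p; rewrite mem_dyadic_primes => /andP[pp h].
  by apply: dvdn_central_bin => //; rewrite addnn -mul2n -expnS.
by rewrite expnS mul2n -addnn bin_le_pow2.
Qed.

Variable R : realType.

Lemma primes_le_double k : primes_le (2 ^ k.+1) = primes_le (2 ^ k) ++ dyadic_primes k.
Proof.
rewrite /primes_le /dyadic_primes expnS mul2n -addnn iotaD filter_cat.
by rewrite add1n.
Qed.

Lemma primes_le_cat y z : (y <= z)%N -> exists t, primes_le z = primes_le y ++ t.
Proof.
move=> yz; exists [seq p <- iota y.+1 (z - y) | prime p].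
by rewrite /primes_le -[in LHS](subnKC yz) iotaD filter_cat add1n.
Qed.

Lemma prod_primes_le_mono (E : R) y z : 0 <= E -> (y <= z)%N ->
  \prod_(p <- primes_le y) (1 + E / p%:R) <= \prod_(p <- primes_le z) (1 + E / p%:R).
Proof.
move=> E0 /primes_le_cat[t ->].
have F1 p : 1 <= 1 + E / p%:R by rewrite lerDl divr_ge0.
rewrite big_cat /= -[leLHS]mulr1 ler_wpM2l//.
  by apply: prodr_ge0 => p _; apply: le_trans (F1 p).
elim: t => [|p t IH]; first by rewrite big_nil.
by rewrite big_cons mulr_ege1.
Qed.

Lemma expR_half_le2 : expR (1 / 2) <= 2 :> R.
Proof.
have := @expR_ge1Dx R (- (1 / 2)); rewrite expRN => H.
have e0 := expR_gt0 (1 / 2 : R).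
have := ler_wpM2r (ltW e0) H; rewrite mulVf ?gt_eqF//.
by lra.
Qed.

(* Any bound o(log z) for the sum of 1/p would do here: the dyadic block at 2^k
   contributes at most 2/k by Chebyshev's argument. *)
Lemma prod_primes_linear (E : R) : 0 <= E -> exists2 C : R, 0 < C &
  forall z, (0 < z)%N -> \prod_(p <- primes_le z) (1 + E / p%:R) <= C * z%:R.
Proof.
move=> E0; pose f z := \prod_(p <- primes_le z) (1 + E / p%:R).
have f0 z : 0 < f z by apply: prodr_gt0 => p _; rewrite ltr_wpDr// divr_ge0.
(* From [m >= 4 E] on, a block contributes at most [exp (2 E / m) <= exp (1/2) <= 2], so the product
   at most doubles whenever [z] does. *)
pose m0 := (Num.truncn (4 * E)).+1.
have m0E m : (m0 <= m)%N -> 4 * E <= m%:R.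
  move=> mm; apply: (@le_trans _ _ m0%:R); last by rewrite ler_nat.
  by apply/ltW; apply: real_truncnS_gt; exact: num_real.
have fS m : (m0 <= m)%N -> f (2 ^ m.+1)%N <= f (2 ^ m)%N * 2.
  move=> mm; rewrite /f primes_le_double big_cat /= ler_wpM2l ?(ltW (f0 _))//.
  have F0 p : 0 <= E / p%:R by rewrite divr_ge0.
  apply: le_trans (prod_le_exp_sum _ _ F0) _.
  apply: le_trans expR_half_le2; rewrite ler_expR.
  have m0' : 0 < m%:R :> R by rewrite ltr0n (leq_trans _ mm).
  have X0 : 0 < (2 ^ m)%:R :> R by rewrite ltr0n expn_gt0.
  apply: (@le_trans _ _ (\sum_(p <- dyadic_primes m) E / (2 ^ m)%:R)).
    rewrite big_seq [leRHS]big_seq; apply: ler_sum => p.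
    rewrite mem_dyadic_primes => /and3P[_ p1 _].
    have p0 : 0 < p%:R :> R by rewrite ltr0n (leq_ltn_trans _ p1).
    by rewrite ler_wpM2l// lef_pV2 ?posrE// ler_nat ltnW.
  rewrite big_const_seq count_predT iter_addr_0 -[leLHS]mulr_natr mulrAC ler_pdivrMr//.
  have := size_dyadic_primes m; rewrite -(ler_nat R) natrM expnS natrM => H.
  have := m0E m mm; set s := (size _)%:R in H *.
  have s0 : 0 <= s by rewrite ler0n.
  move: H m0' X0 E0; move: (m%:R) ((2 ^ m)%:R) => M X H M0 X0 E0' EM.
  have : 4 * E * s <= M * s by rewrite ler_wpM2r.
  lra.
have fm m : f (2 ^ m)%N <= f (2 ^ m0)%N * (2 ^ m)%:R.
  have [mm|mm] := leqP m m0.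
    apply: (@le_trans _ _ (f (2 ^ m0)%N)).
      by apply: prod_primes_le_mono => //; rewrite leq_exp2l.
    by rewrite ler_peMr ?(ltW (f0 _))// ler1n expn_gt0.
  elim: m mm => // m IH; rewrite ltnS leq_eqVlt => /orP[/eqP me|mm].
    apply: le_trans (fS m _) _; first by rewrite me.
    by rewrite -me ler_wpM2l ?(ltW (f0 _))// ler_nat expnS leq_pmulr// expn_gt0.
  apply: le_trans (fS m (ltnW mm)) _.
  by rewrite expnSr natrM mulrA ler_wpM2r// IH.
exists (f (2 ^ m0)%N * 2) => [|z z0]; first by rewrite mulr_gt0.
have /andP[z1 z2] := trunc_log_bounds (isT : (1 < 2)%N) z0.
apply: (@le_trans _ _ (f (2 ^ (trunc_log 2 z).+1)%N)).
  by apply: prod_primes_le_mono => //; exact: ltnW.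
apply: le_trans (fm _) _; rewrite -mulrA ler_wpM2l ?(ltW (f0 _))//.
by rewrite -natrM ler_nat expnS leq_mul2l z1 orbT.
Qed.

(** Expanding one prime at a time collects the chosen primes in [e]. Only the upper bound [A / e]
    for the number of multiples enters, so there are no error terms and the number of primes is
    unrestricted. *)
Lemma moment_dvd (c : nat -> R) (ps : seq nat) (A e : nat) :
  (forall p, 0 <= c p) -> all prime ps -> uniq ps -> (0 < e)%N ->
  (forall p, p \in ps -> coprime e p) ->
  \sum_(1 <= a < A.+1) (e %| a)%:R * \prod_(p <- ps) (1 + c p * (p %| a)%:R) <=
  A%:R / e%:R * \prod_(p <- ps) (1 + c p / p%:R).
Proof.
move=> c0; elim: ps e => [|p ps IH] e.
  move=> _ _ e0 _; rewrite big_nil mulr1.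
  under eq_bigr do rewrite big_nil mulr1.
  rewrite -natr_sum -divn_count_dvd ler_pdivlMr ?ltr0n//.
  by rewrite -natrM ler_nat leq_divM.
move=> /andP[pp aps] /andP[pps ups] e0 cop.
have cep : coprime e p by apply: cop; rewrite mem_head.
have p0 : (0 < p)%N by exact: prime_gt0.
have E a : (e %| a)%:R * \prod_(q <- p :: ps) (1 + c q * (q %| a)%:R) =
    (e %| a)%:R * \prod_(q <- ps) (1 + c q * (q %| a)%:R) +
    c p * ((e * p %| a)%:R * \prod_(q <- ps) (1 + c q * (q %| a)%:R)) :> R.
  by rewrite big_cons Gauss_dvd// -mulnb natrM; ring.
rewrite (eq_bigr _ (fun a _ => E a)) big_split /= -mulr_sumr.
have H1 : \sum_(1 <= a < A.+1) (e %| a)%:R * \prod_(q <- ps) (1 + c q * (q %| a)%:R) <=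
    A%:R / e%:R * \prod_(q <- ps) (1 + c q / q%:R).
  by apply: IH => // q qs; apply: cop; rewrite inE qs orbT.
have H2 : \sum_(1 <= a < A.+1) (e * p %| a)%:R * \prod_(q <- ps) (1 + c q * (q %| a)%:R) <=
    A%:R / (e * p)%:R * \prod_(q <- ps) (1 + c q / q%:R).
  apply: IH => //; first by rewrite muln_gt0 e0.
  move=> q qs; rewrite coprimeMl cop ?inE ?qs ?orbT//= prime_coprime//.
  rewrite dvdn_prime2 ?(allP aps _ qs)//; apply: contra pps => /eqP->.
  exact: qs.
apply: le_trans (lerD H1 (ler_wpM2l (c0 p) H2)) _.
rewrite big_cons le_eqVlt; apply/orP; left; apply/eqP.
have e0' : e%:R != 0 :> R by rewrite pnatr_eq0 -lt0n.
have p0' : p%:R != 0 :> R by rewrite pnatr_eq0 -lt0n.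
by rewrite natrM; field; rewrite e0' p0'.
Qed.

End PrimeProducts.

(** * Telescoping over primes *)

Section Telescoping.
Variable R : realType.
Variables (S : nat -> R) (L : nat -> nat) (X : nat).
Hypothesis S1 : S 1%N = 1.
Hypothesis SM : forall m n, (0 < m)%N -> (0 < n)%N -> coprime m n -> S (m * n)%N = S m * S n.

Definition local_factor (p : nat) : R := \sum_(0 <= k < (L p).+1) S (p ^ k)%N.

Definition truncated_sum (ps : seq nat) : R := \sum_(n <- smooth L ps | (n <= X)%N) S n.

(* The n in smooth L (p :: ps) that pass the threshold X only through their p-part. *)
Definition crossing (p : nat) (ps : seq nat) : seq nat :=
  [seq n <- smooth L (p :: ps) | (X < n)%N && (n %/ p ^ logn p n <= X)%N].

Fixpoint crossings (ps : seq nat) : seq (seq nat) :=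
  if ps is p :: ps' then crossing p ps' :: crossings ps' else [::].

Lemma size_crossings ps : size (crossings ps) = size ps.
Proof. by elim: ps => //= p ps ->. Qed.

Lemma sum_smooth_cons p ps (F : nat -> R) (P : nat -> bool) :
  \sum_(n <- smooth L (p :: ps) | P n) F n =
  \sum_(m <- smooth L ps) \sum_(0 <= k < (L p).+1) if P (m * p ^ k)%N then F (m * p ^ k)%N else 0.
Proof. by rewrite big_mkcond smooth_cons big_allpairs_dep. Qed.

(** A product [m * p ^ k] with [m <= X] either stays up to [X], and the whole next truncated sum
    arises in this way, or it crosses the threshold. *)
Lemma local_factor_mul p ps : all prime (p :: ps) -> p \notin ps ->
  local_factor p * truncated_sum ps =
  truncated_sum (p :: ps) + \sum_(n <- crossing p ps) S n.
Proof.
move=> ap pps; have /andP[pp aps] := ap.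
rewrite /truncated_sum /crossing big_filter !sum_smooth_cons -big_split /=.
rewrite [X in _ * X]big_mkcond mulr_sumr big_seq [RHS]big_seq; apply: eq_bigr => m mi.
have m0 := smooth_gt0 aps mi.
rewrite -big_split mulr_suml; apply: eq_bigr => k _ /=.
have cop := smooth_coprime k ap pps mi.
have pm : coprime p m.
  by have := @smooth_coprime L p ps m 1 ap pps mi; rewrite expn1 coprime_sym.
have pk0 : (0 < p ^ k)%N by rewrite expn_gt0 prime_gt0.
rewrite logn_Gauss// pfactorK// mulnK// SM//.
have le1 : (m <= m * p ^ k)%N by rewrite leq_pmulr.
case: (leqP (m * p ^ k) X) => h1.
  by rewrite (leq_trans le1 h1) addr0 mulrC.
by rewrite add0r; case: ifP => _; rewrite ?mulr0// mulrC.
Qed.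

Hypothesis X0 : (0 < X)%N.

(** A bound for the relative error, cleared of denominators. Multiplying by a local factor preserves
    the relative error and adds one crossing sum over a partial product; as every [m p] is at most
    [1], the full product of the [m p] is a lower bound for all partial products. *)
Lemma truncated_sum_close (m : nat -> R) ps : all prime ps -> uniq ps ->
  (forall p, p \in ps -> (0 < m p <= 1) && (m p <= local_factor p)) ->
  [/\ 0 < \prod_(p <- ps) m p, \prod_(p <- ps) m p <= \prod_(p <- ps) local_factor p &
   `|\prod_(p <- ps) local_factor p - truncated_sum ps| * \prod_(p <- ps) m p <=
   \prod_(p <- ps) local_factor p * \sum_(s <- crossings ps) `|\sum_(n <- s) S n| ].
Proof.
move=> ap up mP; elim: ps ap up mP => [|p ps IH] ap up mP.
  rewrite !big_nil; split => //.
  by rewrite /truncated_sum big_mkcond /= big_seq1 X0 S1 subrr normr0 mul0r mulr0.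
have /andP[pp aps] := ap; have /andP[pps ups] := up.
have /andP[/andP[m0 m1] mle] := mP p (mem_head _ _).
have [] := IH aps ups; first by move=> q qs; apply: mP; rewrite inE qs orbT.
have E := local_factor_mul ap pps; rewrite !big_cons.
set M := \prod_(q <- ps) m q; set P := \prod_(q <- ps) local_factor q.
set RS := \sum_(s <- crossings ps) _ => M0 MP HI.
rewrite -[truncated_sum (p :: ps)](addrK (\sum_(n <- crossing p ps) S n)) -E.
move: HI E mle; move: (local_factor p) (truncated_sum ps) (\sum_(n <- crossing p ps) S n).
move=> sg U r HI _ mle.
have sg0 : 0 < sg by exact: lt_le_trans mle.
have P0 : 0 < P by exact: lt_le_trans MP.
have RS0 : 0 <= RS by apply: sumr_ge0.
have mM : m p * M <= sg * P by apply: ler_pM => //; exact: ltW.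
split => //; first exact: mulr_gt0.
rewrite (_ : sg * P - (sg * U - r) = sg * (P - U) + r); last by ring.
apply: (@le_trans _ _ ((sg * `|P - U| + `|r|) * (m p * M))).
  rewrite ler_wpM2r ?(ltW (mulr_gt0 _ _))//.
  by apply: le_trans (ler_normD _ _) _; rewrite normrM (gtr0_norm sg0).
rewrite mulrDl mulrDr [leRHS]addrC; apply: lerD; last by rewrite mulrC ler_wpM2r.
rewrite (_ : sg * `|P - U| * (m p * M) = m p * (sg * (`|P - U| * M))); last by ring.
apply: (@le_trans _ _ (1 * (sg * (P * RS)))); last by rewrite mul1r mulrA.
by apply: ler_pM; rewrite ?(ltW m0)// ?mulr_ge0 ?(ltW sg0) ?(ltW M0)// ler_wpM2l ?(ltW sg0).
Qed.

Lemma truncated_sum_ge (m : nat -> R) (ps : seq nat) (la : R) :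
  all prime ps -> uniq ps -> 0 < la -> la <= \prod_(p <- ps) m p ->
  (forall p, p \in ps -> (0 < m p <= 1) && (m p <= local_factor p)) ->
  \sum_(s <- crossings ps) `|\sum_(n <- s) S n| <= la / 2 ->
  la / 2 <= `|truncated_sum ps|.
Proof.
move=> ap up la0 laM mP hR; have [M0 MP H] := truncated_sum_close ap up mP.
move: laM hR M0 MP H; move: (\prod_(p <- ps) m p) (\prod_(p <- ps) local_factor p) => M P.
move: (\sum_(s <- _) _) (truncated_sum ps) => RS U laM hR M0 MP H.
have P0 : 0 < P by exact: lt_le_trans MP.
have {}H : `|P - U| <= P / 2.
  rewrite -(ler_pM2r M0); apply: le_trans H _; rewrite -mulrA ler_wpM2l ?(ltW P0)//.
  by apply: le_trans hR _; lra.
have : `|P| <= `|P - U| + `|U| by rewrite -{1}[P](subrK U) ler_normD.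
rewrite (gtr0_norm P0); lra.
Qed.

Lemma uniq_crossing p ps : all prime (p :: ps) -> uniq (p :: ps) -> uniq (crossing p ps).
Proof. by move=> ap up; rewrite filter_uniq// uniq_smooth. Qed.

Lemma crossingsP ps s : all prime ps -> uniq ps -> s \in crossings ps ->
  exists p qs, [/\ s = crossing p qs, p \in ps, all prime (p :: qs) & uniq (p :: qs)].
Proof.
elim: ps => // p ps IH ap up; have /andP[pp aps] := ap; have /andP[pps ups] := up.
rewrite inE => /orP[/eqP->|/(IH aps ups)[q [qs [-> qps aqs uqs]]]].
  by exists p, ps; rewrite mem_head.
by exists q, qs; rewrite inE qps orbT.
Qed.

Lemma crossing_bounds p ps n : all prime (p :: ps) -> uniq (p :: ps) ->
  n \in crossing p ps -> (X < n <= X * p ^ L p)%N.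
Proof.
move=> ap up; rewrite mem_filter => /andP[/andP[-> h] /smooth_consP[m [k [mi kL nE]]]] /=.
have /andP[pp aps] := ap; have /andP[pps ups] := up.
have pm : coprime p m.
  by have := @smooth_coprime L p ps m 1 ap pps mi; rewrite expn1 coprime_sym.
move: h; rewrite nE logn_Gauss// pfactorK// mulnK ?expn_gt0 ?prime_gt0// => mX.
by rewrite leq_mul// leq_exp2l// prime_gt1.
Qed.

End Telescoping.

(** * Lower bounds for the local factors *)

Section LocalLowerBound.
Variable R : realType.
Local Notation S := (S_ R).

(** The factor [P.+1 ^ 2] covers the bound [p^-2] for the local factor at [p <= P], and [81] covers
    [p = 3]. *)
Definition threshold_constant (P : nat) : R := (81 * P.+1%:R ^+ 2)^-1.

Definition coprime_bound (P p : nat) : R := if (p <= P)%N then 1 else 1 - 77 / p%:R.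

(** [33 = 32 + 1]: the bound [32 / sqrt p] for [S a p], plus [p^-2 <= 1 / sqrt p] for the loss in
    the higher powers. *)
Definition divisor_bound (P : nat) (a : int) (p : nat) : R :=
  if (P < p)%N && (p %| a)%Z then 1 - 33 / Num.sqrt p%:R else 1.

(** A prime [p > P] dividing [a] receives [coprime_bound] as well, which is at most [1]; in exchange
    only [divisor_bound] depends on [a]. *)
Definition lower_factor (P : nat) (a : int) (p : nat) : R :=
  (if (p <= P)%N then threshold_constant P else 1) * (coprime_bound P p * divisor_bound P a p).

Lemma threshold_constant_gt0 P : 0 < threshold_constant P.
Proof. by rewrite invr_gt0 mulr_gt0// exprn_gt0. Qed.

Lemma threshold_constant_le P x : 0 < x -> x <= 81 * P.+1%:R ^+ 2 -> threshold_constant P <= x^-1.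
Proof. by move=> x0 xP; rewrite lef_pV2// posrE mulr_gt0// exprn_gt0. Qed.

Lemma threshold_constant_le1 P : threshold_constant P <= 1.
Proof.
rewrite -[leRHS]invr1; apply: threshold_constant_le => //.
have : 1 <= P.+1%:R ^+ 2 :> R by rewrite exprn_ege1// ler1n.
lra.
Qed.

(** [154 = 2 * 77] and [66 = 2 * 33] keep both factors at least [1/2], hence positive, for
    [p > P]. *)
Lemma local_lower (z P : nat) (a : int) (p : nat) :
  154 <= P%:R :> R -> 66 <= Num.sqrt P%:R :> R ->
  (a != 4 %[mod 9])%Z -> (a != -4 %[mod 9])%Z -> (9 <= z)%N -> prime p -> (p <= z)%N ->
  (0 < lower_factor P a p <= 1) && (lower_factor P a p <= local_factor (S a) (trunc_log^~ z) p).
Proof.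
move=> P1 P2 a4 a5 z9 pp pz; have p0 := prime_gt0 pp.
have P0 : 0 < p%:R :> R by rewrite ltr0n.
have L1 : (0 < trunc_log p z)%N.
  by apply: trunc_log_max; rewrite ?expn1// prime_gt1.
have D1 : 1 + S a p = density R a p.
  by have := sum_S_density R pp a 1; rewrite expn1 => <-; rewrite big_nat_recr//= big_nat1 expn0 S_one expn1.
have lf : p != 3%N -> 1 + S a p - (p %| a)%Z%:R / p%:R ^+ 2 <= local_factor (S a) (trunc_log^~ z) p.
  by move=> p3; exact: sigma_ge.
rewrite /lower_factor /coprime_bound /divisor_bound; case: (leqP p P) => pP /=.
  rewrite !mulr1 threshold_constant_gt0 threshold_constant_le1 /=.
  have [p3|p3] := eqVneq p 3%N.
    apply: (@le_trans _ _ (81^-1)).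
      apply: threshold_constant_le => //.
      have : 1 <= P.+1%:R ^+ 2 :> R by rewrite exprn_ege1// ler1n.
      lra.
    apply: le_trans (density_nine_ge R a4 a5) _; rewrite p3.
    apply: (@sigma_ge9 R 3) => //.
    by apply: trunc_log_max.
  apply: le_trans (lf p3); rewrite D1; apply: le_trans (density_prime_ge R pp a).
  apply: threshold_constant_le; first by rewrite exprn_gt0.
  apply: (@le_trans _ _ (P.+1%:R ^+ 2)); last by rewrite ler_peMl ?exprn_ge0//; lra.
  by rewrite lerXn2r ?nnegrE// ler_nat leqW.
have p3 : p != 3%N.
  apply/eqP => p3; have : 154 <= p%:R :> R by apply: le_trans P1 _; rewrite ler_nat ltnW.
  by rewrite p3; lra.
rewrite mul1r.
have x1 : 77 / p%:R <= 1 / 2 :> R.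
  rewrite ler_pdivrMr//; have : P%:R <= p%:R :> R by rewrite ler_nat ltnW.
  lra.
have x0 : 0 <= 77 / p%:R :> R by rewrite divr_ge0.
have s0 : 0 < Num.sqrt p%:R :> R by rewrite sqrtr_gt0.
have y1 : 33 / Num.sqrt p%:R <= 1 / 2 :> R.
  rewrite ler_pdivrMr//; have : Num.sqrt P%:R <= Num.sqrt p%:R :> R by rewrite ler_wsqrtr// ler_nat ltnW.
  lra.
have y0 : 0 <= 33 / Num.sqrt p%:R :> R by rewrite divr_ge0// ltW.
have := lf p3; set F := local_factor _ _ _ => {}lf.
case: (boolP (p %| a)%Z) lf => pa /= lf; last first.
  rewrite mulr1; have := S_prime_coprime_le R pp pa; rewrite ler_norml => /andP[h _].
  move: x0 x1 h lf; rewrite mul0r; move: (77 / p%:R) (S a p) => x t; lra.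
have := S_prime_le R pp a; rewrite ler_norml => /andP[h _].
have p1 : 1 <= p%:R :> R by rewrite ler1n.
have s1 : Num.sqrt 1 <= Num.sqrt p%:R :> R by rewrite ler_wsqrtr.
have s2 : Num.sqrt p%:R ^+ 2 = p%:R :> R by rewrite sqr_sqrtr// ltW.
rewrite sqrtr1 in s1.
have q1 : p%:R ^- 2 <= (Num.sqrt p%:R)^-1 :> R.
  rewrite lef_pV2 ?posrE ?exprn_gt0//.
  apply: (@le_trans _ _ (p%:R : R)); last by rewrite expr2 ler_peMl.
  by rewrite -[leRHS]s2 expr2 ler_peMl// ltW.
have h2 : 1 - 33 / Num.sqrt p%:R <= F.
  move: h lf q1; rewrite mul1r; move: (p%:R ^- 2) (Num.sqrt p%:R)^-1 (S a p) => u w t; lra.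
move: x0 x1 y0 y1 h2; move: (77 / p%:R) (33 / Num.sqrt p%:R) => x y x0 x1 y0 y1 h2.
have yp : 0 < 1 - y by lra.
have xp : 0 < 1 - x by lra.
have xy : (1 - x) * (1 - y) <= 1 * (1 - y) by rewrite ler_wpM2r//; lra.
by rewrite mulr_gt0//=; apply/andP; split; lra.
Qed.

(** Bernoulli gives [(1 - x)^n >= 1 - n x], and [(1 - t) (1 + 2 t) >= 1] for [0 <= t <= 1/2]. This
    trades a power of a factor below [1] for a factor suited to products and moments. *)
Lemma bernoulli_inverse (x : R) n : 0 <= x -> n%:R * x <= 1 / 2 ->
  1 <= (1 - x) ^+ n * (1 + 2 * n%:R * x).
Proof.
move=> x0; case: n => [|n] nx; first by rewrite expr0 mul1r mulr0 mul0r addr0.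
have x1 : x <= 1 / 2 by apply: le_trans nx; rewrite ler_peMl// ler1n.
have H m : 1 - m%:R * x <= (1 - x) ^+ m.
  elim: m => [|m IH]; first by rewrite mul0r subr0.
  have x1' : 0 <= 1 - x by lra.
  rewrite exprSr; apply: le_trans (ler_wpM2r x1' IH).
  by rewrite -natr1; have := mulr_ge0 (mulr_ge0 (ler0n R m) x0) x0; lra.
have nx0 : 0 <= n.+1%:R * x by rewrite mulr_ge0.
apply: (@le_trans _ _ ((1 - n.+1%:R * x) * (1 + 2 * n.+1%:R * x))).
  rewrite -mulrA; move: nx nx0; move: (n.+1%:R * x) => t t1 t0.
  have : 0 <= t * (1 - 2 * t) by rewrite mulr_ge0//; lra.
  lra.
by rewrite ler_wpM2r// -mulrA; lra.
Qed.

Lemma prod_threshold_ge P (ps : seq nat) : uniq ps -> all (leq 1) ps ->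
  threshold_constant P ^+ P <=
  \prod_(p <- ps) (if (p <= P)%N then threshold_constant P else 1).
Proof.
move=> us ps1; rewrite -big_mkcond big_const_seq iter_mulr_1.
apply: ler_wiXn2l; rewrite ?(ltW (threshold_constant_gt0 P)) ?threshold_constant_le1//.
rewrite -size_filter -[leqRHS](size_iota 1 P); apply: uniq_leq_size; first exact: filter_uniq.
by move=> p; rewrite mem_filter mem_iota add1n ltnS => /andP[-> /(allP ps1)->].
Qed.

Lemma prod_coprime_bound P D (ps : seq nat) : 154 * D%:R <= P%:R :> R ->
  1 <= (\prod_(p <- ps) coprime_bound P p) ^+ D * \prod_(p <- ps) (1 + 154 * D%:R / p%:R).
Proof.
move=> PD; rewrite -prodrXl -big_split /=.
elim: ps => [|p ps IH]; first by rewrite big_nil.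
rewrite big_cons mulr_ege1// /coprime_bound; case: leqP => pP.
  by rewrite expr1n mul1r lerDl divr_ge0// mulr_ge0.
have p0 : 0 < p%:R :> R by rewrite ltr0n (leq_ltn_trans _ pP).
have := @bernoulli_inverse (77 / p%:R) D; rewrite divr_ge0// => /(_ isT).
rewrite (_ : 2 * D%:R * (77 / p%:R) = 154 * D%:R / p%:R); last by lra.
apply; rewrite mulrA ler_pdivrMr//.
have : P%:R <= p%:R :> R by rewrite ler_nat ltnW.
lra.
Qed.

Definition moment_coef (P r p : nat) : R := if (p <= P)%N then 0 else 66 * r%:R / Num.sqrt p%:R.

Lemma moment_coef_ge0 P r p : 0 <= moment_coef P r p.
Proof. by rewrite /moment_coef; case: ifP => // _; rewrite divr_ge0 ?sqrtr_ge0// mulr_ge0. Qed.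

Lemma prod_divisor_bound P r (a : int) (ps : seq nat) : 66 * r%:R <= Num.sqrt P%:R :> R ->
  1 <= (\prod_(p <- ps) divisor_bound P a p) ^+ r *
    \prod_(p <- ps) (1 + moment_coef P r p * (p %| absz a)%N%:R).
Proof.
move=> Pr; rewrite -prodrXl -big_split /=.
elim: ps => [|p ps IH]; first by rewrite big_nil.
rewrite big_cons mulr_ege1// /divisor_bound /moment_coef dvdzE /=.
case: leqP => pP /=; first by rewrite expr1n mul0r addr0 mulr1.
case: (p %| absz a)%N; last by rewrite expr1n mulr0 addr0 mulr1.
have p0 : 0 < p%:R :> R by rewrite ltr0n (leq_ltn_trans _ pP).
have s0 : 0 < Num.sqrt p%:R :> R by rewrite sqrtr_gt0.
have := @bernoulli_inverse (33 / Num.sqrt p%:R) r; rewrite divr_ge0 ?(ltW s0)// => /(_ isT).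
rewrite (_ : 2 * r%:R * (33 / Num.sqrt p%:R) = 66 * r%:R / Num.sqrt p%:R); last by lra.
rewrite mulr1; apply; rewrite mulrA ler_pdivrMr//.
have : Num.sqrt P%:R <= Num.sqrt p%:R :> R by rewrite ler_wsqrtr// ler_nat ltnW.
lra.
Qed.

(** The value [a = 0] is set aside because every prime divides it, which would spoil the moment; the
    rest is symmetric in the sign of [a]. *)
Lemma sum_centered (A : nat) (G : nat -> R) : (forall n, 0 <= G n) ->
  \sum_(i < (A + A).+1) (if i%:Z - A%:Z == 0 then 0 else G (absz (i%:Z - A%:Z))) =
  2 * \sum_(1 <= a < A.+1) G a.
Proof.
move=> G0.
rewrite (sum_ord_nat _ (fun x => if x - A%:Z == 0 then 0 else G (absz (x - A%:Z)))).
rewrite (big_cat_nat (n := A)) ?leqW ?leq_addr//= [X in _ + X]big_ltn ?ltnS ?leq_addr//.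
rewrite subrr eqxx add0r mulr2n mulrDl mul1r; congr (_ + _).
  rewrite big_nat_rev /= add0n big_add1 /= !big_nat; apply: eq_bigr => i /andP[_ iA].
  have -> : (A - i.+1)%N%:Z - A%:Z = - (i.+1)%:Z by lia.
  by rewrite oppr_eq0 abszN.
rewrite -[A.+1 in LHS]add1n big_addn subSn ?leq_addr// addnK !big_nat.
apply: eq_bigr => i /andP[i0 _].
have -> : (i + A)%N%:Z - A%:Z = i%:Z by lia.
by rewrite eqz_nat gtn_eqF.
Qed.

Lemma sum_moment (P r z A : nat) :
  \sum_(1 <= a < A.+1) \prod_(p <- primes_le z) (1 + moment_coef P r p * (p %| a)%N%:R) <=
  A%:R * expR (3 * (66 * r%:R)).
Proof.
have H := @moment_dvd R (moment_coef P r) (primes_le z) A 1 (moment_coef_ge0 P r)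
  (all_primes_le z) (uniq_primes_le z) isT (fun p _ => coprime1n p).
apply: (@le_trans _ _ (A%:R * \prod_(p <- primes_le z) (1 + moment_coef P r p / p%:R))).
  rewrite divr1 in H; apply: le_trans H; apply: ler_sum => a _.
  by rewrite dvd1n mul1r.
rewrite ler_wpM2l//.
apply: le_trans (@prod_primes_three_halves R (66 * r%:R) z _); last by rewrite mulr_ge0.
rewrite big_seq [leRHS]big_seq; apply: ler_prod => p; rewrite primes_leP => /andP[pp _].
have p0 : 0 < p%:R :> R by rewrite ltr0n prime_gt0.
rewrite addr_ge0 ?divr_ge0 ?moment_coef_ge0//= lerD2l /moment_coef.
have -> : 66 * r%:R / (p%:R * Num.sqrt p%:R) = 66 * r%:R / Num.sqrt p%:R / p%:R :> R.
  by field; rewrite !gt_eqF// sqrtr_gt0.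
by rewrite ler_wpM2r ?invr_ge0//; case: ifP.
Qed.

End LocalLowerBound.

(** * Comparison with the product *)

Section Counting.
Variable R : realType.
Local Notation S := (S_ R).

(** A boolean form of membership in the exceptional set, in terms of the real [S_], so that
    [a = i - A] can be counted over ordinals. *)
Definition small_sum (K : nat) (eta : R) (a : int) : bool :=
  [&& (a != 4 %[mod 9])%Z, (a != -4 %[mod 9])%Z & `|\sum_(1 <= n < K.+1) S a n| <= eta].

Lemma sqr_sum_le (I : Type) (s : seq I) (F : I -> R) :
  (\sum_(i <- s) F i) ^+ 2 <= (size s)%:R * \sum_(i <- s) F i ^+ 2.
Proof.
elim: s => [|i s IH]; first by rewrite !big_nil expr0n mul0r.
rewrite !big_cons /= -natr1 sqrrD [_ * (_ + _)]mulrDr.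
have : F i * (\sum_(i <- s) F i) *+ 2 <= (size s)%:R * F i ^+ 2 + \sum_(i <- s) F i ^+ 2.
  elim: s {IH} => [|k s IH]; first by rewrite !big_nil mulr0 mul0rn mul0r addr0.
  rewrite !big_cons /= -natr1 mulrDr mulrnDl mulrDl.
  have := sqr_ge0 (F i - F k); rewrite sqrrB; move: IH.
  by set u := \sum_(j <- s) F j; set w := \sum_(j <- s) F j ^+ 2; lra.
move: IH; set u := \sum_(j <- s) F j; set w := \sum_(j <- s) F j ^+ 2; lra.
Qed.

Definition remainder (z K : nat) : seq nat :=
  [seq n <- iota 1 K | n \notin smooth (trunc_log^~ z) (primes_le z)].

Lemma sum_truncated_remainder (z K : nat) (a : int) :
  \sum_(1 <= n < K.+1) S a n =
  truncated_sum (S a) (trunc_log^~ z) K (primes_le z) + \sum_(n <- remainder z K) S a n.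
Proof.
set D := smooth (trunc_log^~ z) (primes_le z).
rewrite /truncated_sum -/D -[in RHS]big_filter.
have -> : \sum_(n <- [seq n <- D | (n <= K)%N]) S a n = \sum_(n <- iota 1 K | n \in D) S a n.
  rewrite -[RHS]big_filter; apply: perm_big; apply: uniq_perm.
  - by rewrite filter_uniq// uniq_smooth ?all_primes_le// uniq_primes_le.
  - by rewrite filter_uniq// iota_uniq.
  move=> n; rewrite !mem_filter mem_iota add1n ltnS andbC.
  case: (boolP (n \in D)) => //= nD.
  by rewrite (smooth_gt0 (all_primes_le z) nD).
by rewrite /remainder big_filter /index_iota subSS subn0 (bigID (fun n => n \in D)).
Qed.

Lemma remainder_bounds z K n : n \in remainder z K -> (z < n <= K)%N.
Proof.
rewrite mem_filter mem_iota add1n ltnS => /andP[nD /andP[n0 ->]]; rewrite andbT ltnNge.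
by apply: contra nD => nz; apply: mem_smooth_primes_le; rewrite n0.
Qed.

Definition crossing_sum (z K : nat) (a : int) : R :=
  \sum_(s <- crossings (trunc_log^~ z) K (primes_le z)) `|\sum_(n <- s) S a n|.

(** If the crossing sum is small, the truncated sum over smooth [n] is at least [la / 2]; the full
    sum is at most [la / 4], so the remainder must supply the difference. *)
Lemma small_sum_dichotomy (z P K : nat) (a : int) (la eta : R) :
  154 <= P%:R :> R -> 66 <= Num.sqrt P%:R :> R -> (9 <= z)%N -> (0 < K)%N ->
  0 < la -> la <= \prod_(p <- primes_le z) lower_factor R P a p -> eta <= la / 4 ->
  small_sum K eta a -> crossing_sum z K a <= la / 2 ->
  la / 4 <= `|\sum_(n <- remainder z K) S a n|.
Proof.
move=> P1 P2 z9 K0 la0 laM eta_la /and3P[a4 a5 ha] hc.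
have U : la / 2 <= `|truncated_sum (S a) (trunc_log^~ z) K (primes_le z)|.
  apply: (@truncated_sum_ge R (S a) (trunc_log^~ z) K _ _ K0 (lower_factor R P a)) => //.
  - exact: S_one.
  - by move=> m n m0 n0; exact: S_crt.
  - exact: all_primes_le.
  - exact: uniq_primes_le.
  - by move=> p; rewrite primes_leP => /andP[pp pz]; exact: local_lower.
rewrite (sum_truncated_remainder z) in ha.
move: U ha; set u := truncated_sum _ _ _ _; set v := \sum_(n <- _) _ => U ha.
have : `|u| <= `|u + v| + `|v| by rewrite -{1}[u](addrK v) ler_normB.
lra.
Qed.

Lemma primes_le_size z : (size (primes_le z) <= z)%N.
Proof. by rewrite size_filter -{2}(size_iota 1 z) count_size. Qed.

(** The moduli lie in [(z, K]], and [4] comes from [(2 A + 1) + K^3 <= 4 A]. *)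
Lemma sum_remainder_sqr : exists2 C : R, 0 < C & forall z K A : nat,
  (0 < z)%N -> (0 < A)%N -> (K ^ 3 <= A)%N ->
  \sum_(i < (A + A).+1) (\sum_(n <- remainder z K) S (i%:Z - A%:Z) n) ^+ 2 <=
  C * A%:R / Num.sqrt z%:R.
Proof.
have [CV CV0 HV] := sum_S_variance_tail R; exists (4 * CV) => [|z K A z0 A0 KA].
  by rewrite mulr_gt0.
have ur : uniq (remainder z K) by rewrite filter_uniq// iota_uniq.
apply: le_trans (@second_moment R (remainder z K) K (A + A).+1 (- A%:Z) ur _) _.
  by move=> n /remainder_bounds/andP[zn ->]; rewrite (leq_ltn_trans _ zn).
have H := HV _ _ z0 ur (fun n nr => proj1 (andP (remainder_bounds nr))).
rewrite (_ : 4 * CV * A%:R / _ = 4 * A%:R * (CV / Num.sqrt z%:R)); last by ring.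
apply: ler_pM => //.
  by apply: sumr_ge0 => n _; exact: S_variance_ge0.
by rewrite -natrX -natrD -natrM ler_nat; lia.
Qed.

(** Each crossing has moduli in [(K, K z]], and [11] comes from [(2 A + 1) + 8 A <= 11 A]. There are
    at most [z] crossings, and Cauchy-Schwarz costs another [z]. *)
Lemma sum_crossing_sqr : exists2 C : R, 0 < C & forall z K A : nat,
  (0 < z)%N -> (0 < K)%N -> (0 < A)%N -> ((K * z) ^ 3 <= 8 * A)%N ->
  \sum_(i < (A + A).+1) crossing_sum z K (i%:Z - A%:Z) ^+ 2 <=
  C * A%:R * z%:R ^+ 2 / Num.sqrt K%:R.
Proof.
have [CV CV0 HV] := sum_S_variance_tail R; exists (11 * CV) => [|z K A z0 K0 A0 KA].
  by rewrite mulr_gt0.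
have ap := all_primes_le z; have up := uniq_primes_le z.
set L := trunc_log^~ z; set l := crossings L K (primes_le z).
have szl : (size l <= z)%N by rewrite size_crossings primes_le_size.
set B := 11 * A%:R * (CV / Num.sqrt K%:R).
have B0 : 0 <= B.
  by apply: mulr_ge0; [exact: mulr_ge0|rewrite divr_ge0 ?sqrtr_ge0// ltW].
have H s : s \in l -> \sum_(i < (A + A).+1) (\sum_(n <- s) S (i%:Z - A%:Z) n) ^+ 2 <= B.
  move=> /(crossingsP ap up)[p [qs [-> pps aqs uqs]]].
  move: pps; rewrite primes_leP => /andP[pp pz].
  have uc := uniq_crossing L K aqs uqs.
  have cb n : n \in crossing L K p qs -> (K < n <= K * z)%N.
    move=> /(crossing_bounds aqs uqs)/andP[-> h] /=; apply: leq_trans h _.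
    by rewrite leq_mul2l /L trunc_logP ?orbT// prime_gt1.
  apply: le_trans (@second_moment R _ (K * z) (A + A).+1 (- A%:Z) uc _) _.
    by move=> n /cb/andP[kn ->]; rewrite (leq_ltn_trans _ kn).
  have HV' := HV _ _ K0 uc (fun n nr => proj1 (andP (cb n nr))).
  apply: ler_pM => //.
    by apply: sumr_ge0 => n _; exact: S_variance_ge0.
  by rewrite -natrX -natrD -natrM ler_nat; lia.
apply: (@le_trans _ _ (\sum_(i < (A + A).+1) z%:R *
    \sum_(s <- l) (\sum_(n <- s) S (i%:Z - A%:Z) n) ^+ 2)).
  apply: ler_sum => i _; rewrite /crossing_sum -/L -/l.
  apply: le_trans (sqr_sum_le _ _) _.
  under eq_bigr do rewrite real_normK ?num_real//.
  rewrite ler_wpM2r ?ler_nat//; apply: sumr_ge0 => s _; exact: sqr_ge0.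
rewrite -mulr_sumr exchange_big /=.
apply: (@le_trans _ _ (z%:R * (z%:R * B))); last first.
  by rewrite le_eqVlt; apply/orP; left; apply/eqP; rewrite /B; ring.
rewrite ler_wpM2l//; apply: (@le_trans _ _ (\sum_(s <- l) B)).
  by rewrite big_seq [leRHS]big_seq; apply: ler_sum => s; exact: H.
by rewrite big_const_seq count_predT iter_addr_0 -[leLHS]mulr_natl ler_wpM2r// ler_nat.
Qed.

Lemma sum_moment_centered (P r z A : nat) :
  \sum_(i < (A + A).+1) (if i%:Z - A%:Z == 0 then 0 else
    \prod_(p <- primes_le z) (1 + moment_coef R P r p * (p %| absz (i%:Z - A%:Z))%N%:R)) <=
  2 * (A%:R * expR (3 * (66 * r%:R))).
Proof.
rewrite (@sum_centered R A (fun a => \prod_(p <- primes_le z) (1 + moment_coef R P r p * (p %| a)%N%:R))).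
  by rewrite ler_wpM2l// sum_moment.
move=> n; apply: prodr_ge0 => p _.
by rewrite addr_ge0// mulr_ge0// moment_coef_ge0.
Qed.

Lemma root_ge (x : R) n : (0 < n)%N -> 0 <= x -> 1 <= x ^+ n -> 1 <= x.
Proof.
move=> n0 x0; rewrite leNgt => h; rewrite leNgt; apply: contra h => x1.
by rewrite exprn_ilt1// -lt0n.
Qed.

(** The product of the [coprime_bound] is at least a constant times [1 / y], by extracting a [D]-th
    root from a bound linear in [z <= 2 y ^ D]; that of the [divisor_bound] is at least [1 / y], by
    an [r]-th root from the moment hypothesis. The primes up to [P] cost a constant. *)
Lemma prod_lower_factor_ge (D r : nat) : (0 < D)%N -> (0 < r)%N ->
  exists P c, [/\ 154 <= P%:R :> R, 66 <= Num.sqrt P%:R :> R, 0 < c &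
  forall (y : R) (z : nat) (a : int), 1 <= y -> (0 < z)%N -> z%:R <= 2 * y ^+ D ->
    \prod_(p <- primes_le z) (1 + moment_coef R P r p * (p %| absz a)%N%:R) <= y ^+ r ->
    c / y ^+ 2 <= \prod_(p <- primes_le z) lower_factor R P a p].
Proof.
move=> D0 r0; pose B : R := 154 * D%:R + 66 * r%:R.
have D1 : 1 <= D%:R :> R by rewrite ler1n.
have r1 : 1 <= r%:R :> R by rewrite ler1n.
have B1 : 1 <= B by rewrite /B; lra.
pose P := (Num.truncn (B ^+ 2)).+1.
have PB2 : B ^+ 2 <= P%:R by apply/ltW/real_truncnS_gt/num_real.
have PB : B <= P%:R by apply: le_trans PB2; rewrite expr2 ler_peMl//; lra.
have sPB : B <= Num.sqrt P%:R.
  by rewrite -[B]ger0_norm ?(le_trans ler01 B1)// -sqrtr_sqr ler_wsqrtr.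
have E0 : 0 <= 154 * D%:R :> R by rewrite mulr_ge0.
have [CM CM0 HM] := @prod_primes_linear R (154 * D%:R) E0.
(* The summand [1] ensures [C' <= C' ^ D], so the constant survives the [D]-th root. *)
pose C' := 1 + 2 * CM; have C'1 : 1 <= C' by rewrite /C'; lra.
have C'0 : 0 < C' by lra.
pose k := threshold_constant R P ^+ P.
have k0 : 0 < k by rewrite exprn_gt0// threshold_constant_gt0.
exists P, (k / C'); split.
- by apply: le_trans PB; rewrite /B; lra.
- by apply: le_trans sPB; rewrite /B; lra.
- exact: divr_gt0.
move=> y z a y1 z0 zy hmom.
have y0 : 0 < y by lra.
rewrite /lower_factor !big_split /=.
set T := \prod_(p <- _) _; set X := \prod_(p <- _) _; set Y := \prod_(p <- _) _.
have kT : k <= T.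
  apply: prod_threshold_ge; first exact: uniq_primes_le.
  by apply/allP => p; rewrite primes_leP => /andP[/prime_gt0].
have PD : 154 * D%:R <= P%:R :> R by apply: le_trans PB; rewrite /B; lra.
have Pr : 66 * r%:R <= Num.sqrt P%:R :> R by apply: le_trans sPB; rewrite /B; lra.
have X0 : 0 <= X.
  apply: prodr_ge0 => p _; rewrite /coprime_bound; case: leqP => // pP.
  rewrite subr_ge0 ler_pdivrMr ?ltr0n ?(leq_ltn_trans _ pP)// mul1r.
  have : P%:R <= p%:R :> R by rewrite ler_nat ltnW.
  lra.
have Y0 : 0 <= Y.
  apply: prodr_ge0 => p _; rewrite /divisor_bound; case: ifP => // /andP[pP _].
  have s0 : 0 < Num.sqrt p%:R :> R by rewrite sqrtr_gt0 ltr0n (leq_ltn_trans _ pP).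
  rewrite subr_ge0 ler_pdivrMr// mul1r.
  have : Num.sqrt P%:R <= Num.sqrt p%:R :> R by rewrite ler_wsqrtr// ler_nat ltnW.
  lra.
have hX : 1 <= C' * y * X.
  apply: (@root_ge _ D) => //; first by rewrite mulr_ge0// mulr_ge0// ltW.
  have := @prod_coprime_bound R P D (primes_le z) PD; rewrite -/X => /le_trans; apply.
  rewrite mulrC exprMn ler_wpM2r ?exprn_ge0//.
  apply: le_trans (HM z z0) _; apply: le_trans (ler_wpM2l (ltW CM0) zy) _.
  rewrite exprMn mulrA ler_wpM2r ?exprn_ge0 ?(ltW y0)//.
  apply: (@le_trans _ _ C'); first by rewrite /C'; lra.
  by rewrite -[leLHS]expr1 ler_weXn2l.
have hY : 1 <= y * Y.
  apply: (@root_ge _ r) => //; first by rewrite mulr_ge0// ltW.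
  have := @prod_divisor_bound R P r a (primes_le z) Pr; rewrite -/Y => /le_trans; apply.
  by rewrite exprMn mulrC ler_wpM2r// exprn_ge0.
rewrite ler_pdivrMr ?exprn_gt0// ler_pdivrMr//.
apply: (@le_trans _ _ (T * ((C' * y * X) * (y * Y)))).
  rewrite -[leLHS]mulr1; apply: ler_pM => //; first exact: ltW.
  by rewrite mulr_ege1.
by rewrite le_eqVlt; apply/orP; left; apply/eqP; ring.
Qed.

End Counting.

(** * Counting *)

Section Final.
Variable R : realType.

Lemma sqrt_ge_exp (y : R) n (N : nat) : 0 <= y -> y ^+ (n + n) <= N%:R ->
  y ^+ n <= Num.sqrt N%:R.
Proof.
move=> y0 h; rewrite -[leLHS]ger0_norm ?exprn_ge0// -sqrtr_sqr ler_wsqrtr//.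
by rewrite -exprM muln2 -addnn.
Qed.

Lemma card_centered_le A (Q : pred 'I_(A + A).+1) : (0 < A)%N -> #|Q|%:R <= 3 * A%:R :> R.
Proof.
move=> A0; rewrite -natrM ler_nat; apply: leq_trans (max_card _) _.
by rewrite card_ord; lia.
Qed.

(* Here y stands for eta^(-1/3): the product over p <= z is at least c / y^2 = c eta^(2/3), and
   D = 12 j + 8 makes z = y^D large enough for the tail n > z to contribute y^(4 - D / 2) =
   y^(-6 j) in mean square. *)
Lemma card_small_sum_le (j : nat) : (0 < j)%N -> exists2 C : R, 0 < C &
  forall (y : R) (A K : nat), 1 <= y -> y ^+ (100 * j) <= K%:R -> (K ^ (6 * j) <= A)%N ->
  #|[pred i : 'I_(A + A).+1 | small_sum K (y ^- 3) (i%:Z - A%:Z)]|%:R <=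
  C * A%:R / y ^+ (6 * j).
Proof.
move=> j0; pose D := (12 * j + 8)%N; pose r := (6 * j)%N.
have D0 : (0 < D)%N by rewrite /D; lia.
have r0 : (0 < r)%N by rewrite /r; lia.
have j3 : (3 <= 6 * j)%N by lia.
have j4 : (4 <= 6 * j)%N by lia.
have Dr : (r + 4 + (r + 4) = D)%N by rewrite /D /r; lia.
(* This and the next inequality fix the exponent in [y ^ (100 * j) <= K]: the first yields
   [z^3 <= 8 K], the second lets [sqrt K >= y ^ (50 * j)] absorb [z^2], [la^-2] and the target
   [y ^ r]. *)
have D3 : (D * 3 <= 100 * j)%N by rewrite /D; lia.
have rD : (r + (4 + (D + D)) <= 50 * j)%N by rewrite /D /r; lia.
have [P [c [P1 P2 c0 HP]]] := @prod_lower_factor_ge R D r D0 r0.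
have [CR CR0 HR] := sum_remainder_sqr R.
have [CC CC0 HC] := sum_crossing_sqr R.
pose M : R := expR (3 * (66 * r%:R)); have M0 : 0 < M by exact: expR_gt0.
(* For [y >= y0] both [z >= 9] and [c y >= 4] hold, the latter meaning [y^-3 <= la / 4]. Below [y0]
   the trivial count [3 A] suffices. *)
pose y0 : R := 9 + 4 / c.
have c40 : 0 < 4 / c by rewrite divr_gt0.
exists (3 * y0 ^+ r + 1 + 2 * M + 16 * CR / c ^+ 2 + 16 * CC / c ^+ 2).
  rewrite !addr_gt0 ?divr_gt0 ?mulr_gt0 ?exprn_gt0//.
  by rewrite /y0; lra.
move=> y A K y1 yK KA.
have yp : 0 < y by lra.
have yX n : 0 < y ^+ n by rewrite exprn_gt0.
have K0 : (0 < K)%N by rewrite -(ltr0n R); apply: lt_le_trans yK.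
have KK n : (0 < n)%N -> (K <= K ^ n)%N.
  by move=> n0; rewrite -{1}[K]expn1 leq_pexp2l.
have A0 : (0 < A)%N by apply: leq_trans KA; rewrite expn_gt0 K0.
have A0R : 0 < A%:R :> R by rewrite ltr0n.
have Cpos (x : R) : 0 < x -> 0 <= x * A%:R / y ^+ r.
  by move=> x0; rewrite divr_ge0 ?mulr_ge0// ltW.
have i1 : 0 <= 3 * y0 ^+ r * A%:R / y ^+ r.
  by apply: Cpos; rewrite mulr_gt0// exprn_gt0// /y0; lra.
have i2 : 0 <= 2 * M * A%:R / y ^+ r by apply: Cpos; rewrite mulr_gt0.
have i3 : 0 <= 16 * CR / c ^+ 2 * A%:R / y ^+ r.
  by apply: Cpos; rewrite divr_gt0 ?mulr_gt0// exprn_gt0.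
have i4 : 0 <= 16 * CC / c ^+ 2 * A%:R / y ^+ r.
  by apply: Cpos; rewrite divr_gt0 ?mulr_gt0// exprn_gt0.
have i5 : 0 <= 1 * A%:R / y ^+ r by apply: Cpos.
rewrite (_ : (_ + 1 + 2 * M + _ + _) * A%:R / y ^+ r =
  3 * y0 ^+ r * A%:R / y ^+ r + 1 * A%:R / y ^+ r + 2 * M * A%:R / y ^+ r +
  16 * CR / c ^+ 2 * A%:R / y ^+ r + 16 * CC / c ^+ 2 * A%:R / y ^+ r); last by ring.
have [yy0|yy0] := ltP y y0.
  suff : #|[pred i : 'I_(A + A).+1 | small_sum K (y ^- 3) (i%:Z - A%:Z)]|%:R <=
      3 * y0 ^+ r * A%:R / y ^+ r.
    move: i2 i3 i4 i5.
    move: (2 * M * A%:R / y ^+ r) (16 * CR / c ^+ 2 * A%:R / y ^+ r)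
      (16 * CC / c ^+ 2 * A%:R / y ^+ r) (1 * A%:R / y ^+ r) => *; lra.
  apply: (@le_trans _ _ (3 * A%:R)).
    exact: card_centered_le.
  rewrite ler_pdivlMr// mulrAC ler_wpM2r// ler_wpM2l// lerXn2r ?nnegrE ?(ltW yp) ?(ltW yy0)//.
  by apply: le_trans (ltW yy0); exact: ltW.
pose z := (Num.truncn (y ^+ D)).+1.
have zy : y ^+ D < z%:R by apply/real_truncnS_gt/num_real.
have yz : z%:R <= 2 * y ^+ D.
  have : (Num.truncn (y ^+ D))%:R <= y ^+ D by rewrite truncn_le ltW.
  have : 1 <= y ^+ D by rewrite exprn_ege1.
  by rewrite /z -natr1; lra.
have z9 : (9 <= z)%N.
  rewrite -(ler_nat R); apply: le_trans (ltW zy).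
  apply: (@le_trans _ _ y); first by move: yy0; rewrite /y0; lra.
  by rewrite -[leLHS]expr1 ler_weXn2l.
have z0 : (0 < z)%N by [].
pose la : R := c / y ^+ 2.
have la0 : 0 < la by rewrite divr_gt0.
have eta_la : y ^- 3 <= la / 4.
  have cy : 4 <= c * y.
    by rewrite mulrC -ler_pdivrMr//; move: yy0; rewrite /y0; move: (4 / c) => t; lra.
  rewrite ler_pdivlMr// /la (_ : c / y ^+ 2 = c * y * y ^- 3); last by field; rewrite gt_eqF.
  by rewrite mulrC ler_wpM2r// invr_ge0 ltW.
pose Mom (a : int) : R :=
  \prod_(p <- primes_le z) (1 + moment_coef R P r p * (p %| absz a)%N%:R).
have Mom0 a : 0 <= Mom a.
  by apply: prodr_ge0 => p _; rewrite addr_ge0// mulr_ge0// moment_coef_ge0.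
pose Rem (a : int) : R := \sum_(n <- remainder z K) S_ R a n.
(* A Markov-type majorant: a counted [a] is zero or has a large moment, remainder or crossing sum,
   and in each case the matching term is at least [1]. *)
have pointwise a : small_sum K (y ^- 3) a ->
    1 <= (a == 0)%:R + (if a == 0 then 0 else Mom a) / y ^+ r +
      16 / la ^+ 2 * Rem a ^+ 2 + 4 / la ^+ 2 * crossing_sum R z K a ^+ 2.
  move=> ha.
  have t3 : 0 <= 16 / la ^+ 2 * Rem a ^+ 2 by rewrite mulr_ge0 ?sqr_ge0// divr_ge0 ?sqr_ge0.
  have t4 : 0 <= 4 / la ^+ 2 * crossing_sum R z K a ^+ 2.
    by rewrite mulr_ge0 ?sqr_ge0// divr_ge0 ?sqr_ge0.
  set u3 := 16 / la ^+ 2 * Rem a ^+ 2 in t3 *.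
  set u4 := 4 / la ^+ 2 * crossing_sum R z K a ^+ 2 in t4 *.
  have [_|a0] := eqVneq a 0.
    by rewrite mul0r addr0 -addrA -[true%:R]/(1 : R) lerDl addr_ge0.
  rewrite -[false%:R]/(0 : R) add0r.
  have t2 : 0 <= Mom a / y ^+ r by rewrite divr_ge0// ltW.
  have [h|h] := lerP (y ^+ r) (Mom a).
    apply: (@le_trans _ _ (Mom a / y ^+ r)); first by rewrite ler_pdivlMr// mul1r.
    by rewrite -addrA lerDl addr_ge0.
  have laM := HP y z a y1 z0 yz (ltW h).
  have [h'|h'] := lerP (crossing_sum R z K a) (la / 2).
    have := small_sum_dichotomy P1 P2 z9 K0 la0 laM eta_la ha h'; rewrite -/(Rem a) => hR.
    apply: (@le_trans _ _ u3); last by rewrite -addrA addrCA lerDl addr_ge0.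
    rewrite /u3 mulrAC ler_pdivlMr ?exprn_gt0// mul1r.
    have -> : 16 * Rem a ^+ 2 = (4 * `|Rem a|) ^+ 2.
      by rewrite exprMn real_normK ?num_real// -natrX.
    rewrite lerXn2r ?nnegrE ?(ltW la0) ?mulr_ge0//.
    by rewrite mulrC -ler_pdivrMr.
  apply: (@le_trans _ _ u4); last by rewrite lerDr addr_ge0.
  rewrite /u4 mulrAC ler_pdivlMr ?exprn_gt0// mul1r.
  have -> : 4 * crossing_sum R z K a ^+ 2 = (2 * crossing_sum R z K a) ^+ 2.
    by rewrite exprMn -natrX.
  have l2 : la <= 2 * crossing_sum R z K a by rewrite mulrC -ler_pdivrMr// ltW.
  by rewrite lerXn2r ?nnegrE ?(ltW la0)//; exact: le_trans (ltW la0) l2.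
have sum0 : \sum_(i < (A + A).+1) (i%:Z - A%:Z == 0)%:R = 1 :> R.
  have hA : (A < (A + A).+1)%N by rewrite ltnS leq_addr.
  rewrite (bigD1 (Ordinal hA))//= subrr eqxx [X in _ + X]big1 ?addr0// => i iA.
  case: eqP => // /eqP; rewrite subr_eq0 eqz_nat => /eqP h.
  by move: iA; rewrite -val_eqE /= h eqxx.
have yrA : 1 <= 1 * A%:R / y ^+ r.
  rewrite mul1r ler_pdivlMr// mul1r.
  apply: (@le_trans _ _ (y ^+ (100 * j))); first by rewrite ler_weXn2l// /r leq_mul2r orbT.
  apply: le_trans yK _; rewrite ler_nat; apply: leq_trans KA; apply: KK.
  by rewrite muln_gt0.
have K3A : (K ^ 3 <= A)%N.
  by apply: leq_trans KA; rewrite leq_pexp2l.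
have sqz : y ^+ (r + 4) <= Num.sqrt z%:R.
  apply: sqrt_ge_exp; first exact: ltW.
  by rewrite Dr; exact: ltW.
have sqK : y ^+ (50 * j) <= Num.sqrt K%:R.
  apply: sqrt_ge_exp; first exact: ltW.
  by rewrite -mulnDl.
have sz0 : 0 < Num.sqrt z%:R :> R by rewrite sqrtr_gt0 ltr0n.
have sK0 : 0 < Num.sqrt K%:R :> R by rewrite sqrtr_gt0 ltr0n.
(* [z^3 <= 8 K], and [K^4 <= A] because [6 j >= 4]. *)
have KzA : ((K * z) ^ 3 <= 8 * A)%N.
  rewrite expnMn; apply: (@leq_trans (K ^ 3 * (8 * K))%N).
    rewrite leq_mul2l; apply/orP; right; rewrite -(ler_nat R) natrX natrM.
    apply: (@le_trans _ _ ((2 * y ^+ D) ^+ 3)).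
      by rewrite lerXn2r ?nnegrE// mulr_ge0// ltW.
    rewrite exprMn -exprM -natrX -[(2 ^ 3)%N]/8%N ler_wpM2l//.
    by apply: le_trans yK; rewrite ler_weXn2l.
  rewrite mulnCA leq_mul2l /=; apply: leq_trans KA.
  by rewrite -expnSr leq_pexp2l.
rewrite -sum1_card natr_sum big_mkcond /=.
apply: (@le_trans _ _ (\sum_(i < (A + A).+1) ((i%:Z - A%:Z == 0)%:R +
   (if i%:Z - A%:Z == 0 then 0 else Mom (i%:Z - A%:Z)) / y ^+ r +
      16 / la ^+ 2 * Rem (i%:Z - A%:Z) ^+ 2 +
      4 / la ^+ 2 * crossing_sum R z K (i%:Z - A%:Z) ^+ 2))).
  apply: ler_sum => i _; rewrite inE; case: ifP => [/pointwise//|_].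
  have w4 (t u : R) : 0 <= t -> 0 <= t / la ^+ 2 * u ^+ 2.
    by move=> t0; rewrite mulr_ge0 ?sqr_ge0// divr_ge0 ?sqr_ge0.
  apply: addr_ge0; last exact: w4.
  apply: addr_ge0; last exact: w4.
  apply: addr_ge0 => //; apply: divr_ge0; last exact: ltW.
  by case: ifP.
rewrite !big_split /= sum0 -mulr_suml -!mulr_sumr.
have la2 : la ^+ 2 = c ^+ 2 / y ^+ 4 by rewrite /la exprMn exprVn -exprM.
have B2 := @sum_moment_centered R P r z A.
have B3 := HR z K A z0 A0 K3A.
have B4 := HC z K A z0 K0 A0 KzA.
have H2 : (\sum_(i < (A + A).+1) (if i%:Z - A%:Z == 0 then 0 else Mom (i%:Z - A%:Z))) / y ^+ r <=
    2 * M * A%:R / y ^+ r.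
  rewrite ler_wpM2r ?invr_ge0 ?(ltW (yX _))//; apply: le_trans B2 _.
  by rewrite -/M -mulrA [M * _]mulrC.
have H3 : 16 / la ^+ 2 * (\sum_(i < (A + A).+1) Rem (i%:Z - A%:Z) ^+ 2) <=
    16 * CR / c ^+ 2 * A%:R / y ^+ r.
  apply: (@le_trans _ _ (16 / la ^+ 2 * (CR * A%:R / Num.sqrt z%:R))).
    by rewrite ler_wpM2l// divr_ge0// sqr_ge0.
  apply: (@le_trans _ _ (16 / la ^+ 2 * (CR * A%:R / y ^+ (r + 4)))).
    rewrite ler_wpM2l ?divr_ge0 ?sqr_ge0// ler_wpM2l ?mulr_ge0 ?(ltW CR0)//.
    by rewrite lef_pV2 ?posrE.
  rewrite le_eqVlt; apply/orP; left; apply/eqP; rewrite la2 exprD.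
  by field; rewrite !gt_eqF.
have H4 : 4 / la ^+ 2 * (\sum_(i < (A + A).+1) crossing_sum R z K (i%:Z - A%:Z) ^+ 2) <=
    16 * CC / c ^+ 2 * A%:R / y ^+ r.
  apply: (@le_trans _ _ (4 / la ^+ 2 * (CC * A%:R * z%:R ^+ 2 / Num.sqrt K%:R))).
    by rewrite ler_wpM2l// divr_ge0// sqr_ge0.
  apply: (@le_trans _ _ (4 / la ^+ 2 * (CC * A%:R * (2 * y ^+ D) ^+ 2 / y ^+ (50 * j)))).
    rewrite ler_wpM2l ?divr_ge0 ?sqr_ge0//; apply: ler_pM.
    - by rewrite mulr_ge0 ?sqr_ge0// mulr_ge0// ltW.
    - by rewrite invr_ge0 ltW.
    - rewrite ler_wpM2l ?mulr_ge0 ?(ltW CC0)//.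
      by rewrite lerXn2r ?nnegrE// mulr_ge0// ltW.
    - by rewrite lef_pV2 ?posrE.
  rewrite (_ : 4 / la ^+ 2 * _ = 16 * CC / c ^+ 2 * A%:R * (y ^+ (4 + (D + D)) / y ^+ (50 * j))); last first.
    by rewrite la2 !exprD; field; rewrite !gt_eqF.
  rewrite ler_wpM2l//; first by rewrite mulr_ge0// divr_ge0 ?mulr_ge0 ?sqr_ge0// ltW.
  by rewrite ler_pdivrMr// ler_pdivlMl// -exprD ler_weXn2l.
move: i1 yrA H2 H3 H4.
move: (3 * y0 ^+ r * A%:R / y ^+ r) (1 * A%:R / y ^+ r) (2 * M * A%:R / y ^+ r)
  (16 * CR / c ^+ 2 * A%:R / y ^+ r) (16 * CC / c ^+ 2 * A%:R / y ^+ r) => b1 b2 b3 b4 b5.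
move=> i1 h1 h2 h3 h4.
have : 1 <= b1 + b2 by lra.
by move=> h; apply: lerD h4; apply: lerD h3; apply: lerD h2.
Qed.

End Final.

(** * From powers of [y] to powers of [eta] and [K] *)

Lemma card_exceptional_le (R : realType) (K A : nat) (eta eta' : R) : eta <= eta' ->
  (#|` fset_set (exceptional K eta `&` [set a : int | (- A%:Z <= a <= A%:Z)%R])|%fset <=
   #|[pred i : 'I_(A + A).+1 | small_sum K eta' (i%:Z - A%:Z)%R]|)%N.
Proof.
move=> le_eta; set X := _ `&` _; set Q := [pred i | _].
have finX : finite_set X by exact: finite_exceptionalI.
rewrite cardE -(size_map (fun i : 'I_(A + A).+1 => i%:Z - A%:Z)).
apply: uniq_leq_size; first exact: fset_uniq.
move=> a; rewrite in_fset_set// inE => -[[a4 a5 ha] /= /andP[aA Aa]].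
have a0 : 0 <= a + A%:Z by rewrite -lerBlDr sub0r.
have hA : (absz (a + A%:Z)%R < (A + A).+1)%N.
  by rewrite ltnS -lez_nat gez0_abs// PoszD lerD2r.
have E : (Ordinal hA)%:Z - A%:Z = a by rewrite /= gez0_abs// addrK.
rewrite -E; apply: map_f; rewrite mem_enum inE E /small_sum a4 a5 /=.
by apply: le_trans le_eta; rewrite -norm_s.
Qed.

Theorem theorem3p9 (R : realType) (j : nat) (eps : R) :
  (0 < j)%N -> 0 < eps ->
  exists C : R, 0 < C /\
    forall (A K : nat) (eta : R),
      (0 < A)%N -> (0 < K)%N -> 0 < eta ->
      (K ^ (6 * j) <= A)%N ->
      A%:R^-1 *
        #|` fset_set (exceptional K eta `&`
                      [set a : int | - A%:Z <= a <= A%:Z])|%fset%:R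
      <= C * (eta `^ (9 / 5 * j%:R)
              + A%:R `^ eps * K%:R `^ (- (3 / 2) * j%:R)
              + eta `^ (- (1 / 5) * j%:R) * K%:R `^ (- (4 / 5) * j%:R)
              + K%:R `^ (- (1 / 24))).
Proof.
move=> j0 _; have [C C0 HC] := card_small_sum_le R j0.
exists (C + 3); split => [|A K eta A0 K0 eta0 KA]; first by rewrite addr_gt0.
have jR : 0 < j%:R :> R by rewrite ltr0n.
have A0R : 0 < A%:R :> R by rewrite ltr0n.
have K1R : 1 <= K%:R :> R by rewrite ler1n.
have K0R : 0 < K%:R :> R by rewrite ltr0n.
(* Chosen so that [(9/5) j s = 1/24]: the power of [t] is exactly the last term of the bound. *)
pose s : R := 5 / 216 / j%:R; pose t : R := K%:R `^ (- s).
have s0 : 0 < s by rewrite !divr_gt0.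
pose eta1 := Num.max eta t.
have eta1_gt0 : 0 < eta1 by rewrite lt_max eta0.
have te : t <= eta1 by rewrite le_max lexx orbT.
have ee : eta <= eta1 by rewrite le_max lexx.
set N := #|` _|%fset.
suff main : N%:R <= (C + 3) * A%:R * eta1 `^ (9 / 5 * j%:R).
  rewrite mulrC ler_pdivrMr//; apply: le_trans main _.
  rewrite -mulrA mulrCA [leRHS]mulrC; apply: ler_wpM2l; first exact: ltW.
  apply: ler_wpM2l; first by rewrite addr_ge0// ltW.
  (* The maximum [eta1] is [eta] or [t], so its power is one of the two outer terms; the middle
     terms are nonnegative. *)
  apply: (@le_trans _ _ (eta `^ (9 / 5 * j%:R) + K%:R `^ (- (1 / 24)))).
    have -> : K%:R `^ (- (1 / 24)) = t `^ (9 / 5 * j%:R).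
      rewrite /t -powRrM; congr (_ `^ _); rewrite /s.
      by field; rewrite gt_eqF.
    by rewrite /eta1; case: (leP eta t) => _; rewrite ?lerDl ?lerDr powR_ge0.
  by rewrite lerD2r -addrA lerDl addr_ge0// mulr_ge0// powR_ge0.
have [eta1_le1|eta1_gt1] := leP eta1 1; last first.
  apply: (@le_trans _ _ (3 * A%:R)).
    apply: le_trans (card_centered_le R _ A0); rewrite ler_nat.
    exact: (@card_exceptional_le R K A eta eta1).
  rewrite -mulrA; apply: ler_pM => //; first by rewrite lerDr ltW.
  rewrite ler_peMr// -[leLHS](powRr0 eta1); apply: ler_powR; first exact: ltW.
  by rewrite mulr_ge0// divr_ge0.
pose w := eta1 `^ (1 / 3); have w0 : 0 < w by exact: powR_gt0.
have wX n : w ^+ (3 * n) = eta1 `^ n%:R.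
  rewrite -powR_mulrn ?(ltW w0)// -powRrM; congr (_ `^ _); rewrite natrM.
  by field.
have w1 : 1 <= w^-1.
  rewrite invf_ge1//; rewrite -[leRHS](powRr0 eta1).
  by apply: ger_powR; [rewrite eta1_gt0|rewrite divr_ge0].
(* [w^-1] plays the role of [y]. From [eta1 >= K^(-s)] the left side is at most
   [K^(100 j s / 3) = K^(500/648)]. *)
have yK : w^-1 ^+ (100 * j) <= K%:R.
  rewrite exprVn -[leRHS]invrK lef_pV2 ?posrE ?invr_gt0 ?exprn_gt0//.
  rewrite -powR_inv1 ?(ltW K0R)//.
  apply: (@le_trans _ _ ((t `^ (1 / 3)) ^+ (100 * j))).
    rewrite -powR_mulrn ?powR_ge0// -!powRrM; apply: ler_powR => //.
    rewrite /s natrM (_ : - (5 / 216 / j%:R) * (1 / 3 * (100 * j%:R)) = - (500 / 648)).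
      by lra.
    by field; rewrite gt_eqF.
  by rewrite lerXn2r ?nnegrE ?powR_ge0//; apply: ge0_ler_powR;
    rewrite ?nnegrE ?powR_ge0 ?(ltW eta1_gt0).
have wE : w^-1 ^- 3 = eta1.
  by rewrite exprVn invrK -[3%N]muln1 wX powRr1// ltW.
have := HC _ A K w1 yK KA; rewrite wE => H.
apply: (@le_trans _ _ (C * A%:R * eta1 `^ (9 / 5 * j%:R))); last first.
  by rewrite ler_wpM2r ?powR_ge0// ler_wpM2r// lerDl.
apply: (@le_trans _ _ (C * A%:R / w^-1 ^+ (6 * j))).
  by apply: le_trans H; rewrite ler_nat card_exceptional_le.
rewrite ler_wpM2l ?mulr_ge0 ?(ltW C0)// exprVn invrK.
(* [y^(-6 j)] is [eta1^(2 j)], which is at most [eta1^(9 j / 5)] because [eta1 <= 1]. *)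
rewrite (_ : (6 * j = 3 * (2 * j))%N); last by rewrite mulnA.
rewrite wX; apply: ger_powR; first by rewrite eta1_gt0.
by rewrite natrM ler_wpM2r//; lra.
Qed.
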